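(* Let $N>1$ and let $\mathcal H$ denote either $H^2(B_N)$ or $A^2_\alpha(B_N)$ with $\alpha>-1$. Suppose $\varphi$ and $\psi$ are parabolic linear-fractional self-maps of $B_N$ fixing $e_1=(1,0,\dots,0)$, so that $D_1\varphi_1(e_1)=1=D_1\psi_1(e_1)$. If $\varphi\neq\psi$, then $C_\varphi-C_\psi$ is not compact on $\mathcal H$.
   Context: $B_N$ is the open unit ball of $\mathbb C^N$ with inner product $\langle z,w\rangle=\sum z_j\overline{w_j}$. $H^2(B_N)$ is the space of analytic $f$ on $B_N$ with $\sup_{0<r<1}\int_{\partial B_N}|f(r\zeta)|^2d\sigma(\zeta)<\infty$ ($\sigma$ normalized surface measure); $A^2_\alpha(B_N)$ is the space of analytic $f$ with $\int_{B_N}|f|^2\frac{\Gamma(N+\alpha+1)}{\Gamma(N+1)\Gamma(\alpha+1)}(1-|z|^2)^\alpha d\nu<\infty$ ($\nu$ normalized volume measure). A linear-fractional self-map of $B_N$ is a map $\varphi(z)=\frac{Az+B}{\langle z,C\rangle+d}$ ($A$ an $N\times N$ matrix, $B,C\in\mathbb C^N$, $d\in\mathbb C$) analytic on $B_N$ with $\varphi(B_N)\subseteq B_N$; it is analytic on a neighborhood of $\overline{B_N}$. $C_\varphi f=f\circ\varphi$. $\varphi_1$ is the first coordinate function of $\varphi$ and $D_1$ is the partial derivative with respect to $z_1$. A parabolic linear-fractional self-map of $B_N$ fixing $e_1$ is a linear-fractional self-map $\tau$ of $B_N$ with $\tau(e_1)=e_1$ and $D_1\tau_1(e_1)=1$ that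 fixes no other point of $\overline{B_N}$. *)

(* Defs.v *)
From HB Require Import structures.
From mathcomp Require Import all_boot all_order all_algebra.
From mathcomp Require Import all_classical all_reals all_analysis.
From mathcomp Require Import complex.
Set Implicit Arguments. Unset Strict Implicit. Unset Printing Implicit Defensive.
Import Order.TTheory GRing.Theory Num.Theory.
Import numFieldNormedType.Exports.
Local Open Scope classical_set_scope.
Local Open Scope ring_scope.
Local Open Scope complex_scope.

Definition Cx (R : realType) : numClosedFieldType := R[i].

Section Defs.
Variables (R : realType) (N : nat).
Local Notation C := (Cx R).
Local Notation V := 'rV[C]_N.

Definition inner (z w : V) : C := \sum_(j < N) z 0 j * (w 0 j)^*.

Definition sqnorm (z : V) : R := complex.Re (inner z z : R[i]).

Definition cabs2 (x : C) : R := complex.Re (x : R[i]) ^+ 2 + complex.Im (x : R[i]) ^+ 2.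

Definition e1 : V := \row_(j < N) (if val j == 0%N then 1 else 0).

Definition RtoC (r : R) : C := (r +i* 0).

Definition holomorphic_ball (f : V -> C) : Prop :=
  forall z : V, sqnorm z < 1 -> differentiable f z.

Definition linfrac (A : 'M[C]_N) (B Cv : V) (d : C) : V -> V :=
  fun z => (inner z Cv + d)^-1 *: (z *m A^T + B).

Definition LF_selfmap (phi : V -> V) : Prop :=
  exists (A : 'M[C]_N) (B Cv : V) (d : C),
    [/\ phi = linfrac A B Cv d,
        (forall z : V, sqnorm z < 1 -> inner z Cv + d != 0) &
        (forall z : V, sqnorm z < 1 -> sqnorm (phi z) < 1)].

(* parabolic linear-fractional self-map fixing e_1:
   tau(e1) = e1, D_1 tau_1 (e1) = 1, no other fixed point in the closed ball.
   tau_1 z = <tau z, e1> and D_1 is the complex derivative in direction e1. *)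
Definition parabolic_e1 (tau : V -> V) : Prop :=
  [/\ LF_selfmap tau,
      tau e1 = e1,
      is_derive e1 e1 (fun z => inner (tau z) e1) (1 : C) &
      (forall z : V, sqnorm z <= 1 -> tau z = z -> z = e1)].

(* ---- integration on C^N = R^(2N) (iterated Lebesgue integrals) ---- *)
Definition upd (s : nat -> R) (k : nat) (x : R) : nat -> R :=
  fun n => if n == k then x else s n.

Fixpoint iint (k : nat) (G : (nat -> R) -> \bar R) : \bar R :=
  match k with
  | 0%N => G (fun _ => 0)
  | k'.+1 => (\int[@lebesgue_measure R]_x iint k' (fun s => G (upd s k' x)))%E
  end.

Definition vec_of (s : nat -> R) : V :=
  \row_(j < N) (s (2 * j)%N +i* s (2 * j + 1)%N).

(* Lebesgue volume integral over C^N of a nonnegative function *)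
Definition vol_int (g : V -> \bar R) : \bar R := iint (2 * N) (fun s => g (vec_of s)).

Definition ball_ind (g : V -> \bar R) : V -> \bar R :=
  fun z => if sqnorm z < 1 then g z else 0%E.

Definition ball_vol : R := fine (vol_int (ball_ind (fun _ => 1%E))).

Definition nu_int (g : V -> \bar R) : \bar R :=
  (vol_int (ball_ind g) * (ball_vol^-1)%:E)%E.

(* integral over the unit sphere w.r.t. normalized surface measure sigma,
   defined via the cone construction sigma(E) = nu({r zeta : 0<r<1, zeta in E}) *)
Definition sigma_int (h : V -> \bar R) : \bar R :=
  nu_int (fun z => h (RtoC ((Num.sqrt (sqnorm z))^-1) *: z)).

Definition H2norm2 (f : V -> C) : \bar R :=
  ereal_sup [set sigma_int (fun zeta => (cabs2 (f (RtoC r *: zeta)))%:E)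
            | r in [set r : R | 0 < r < 1]].

Definition inH2 (f : V -> C) : Prop := holomorphic_ball f /\ (H2norm2 f < +oo)%E.

Definition Gamma (s : R) : R :=
  fine (\int[@lebesgue_measure R]_(t in [set t : R | (0 < t)%R])
          (powR t (s - 1) * expR (- t))%:E)%E.

Definition c_alpha (alpha : R) : R :=
  Gamma (N%:R + alpha + 1) / (Gamma (N%:R + 1) * Gamma (alpha + 1)).

Definition A2norm2 (alpha : R) (f : V -> C) : \bar R :=
  ((c_alpha alpha)%:E *
   nu_int (fun z => (cabs2 (f z) * powR (1 - sqnorm z) alpha)%:E))%E.

Definition inA2 (alpha : R) (f : V -> C) : Prop :=
  holomorphic_ball f /\ (A2norm2 alpha f < +oo)%E.

Definition comp_op (phi : V -> V) (f : V -> C) : V -> C := fun z => f (phi z).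

Definition diff_op (T S : (V -> C) -> (V -> C)) (f : V -> C) : V -> C :=
  fun z => T f z - S f z.

Definition compact_op (mem : (V -> C) -> Prop) (nrm2 : (V -> C) -> \bar R)
    (T : (V -> C) -> (V -> C)) : Prop :=
  forall u : nat -> (V -> C),
    (forall k, mem (u k)) ->
    (exists M : R, forall k, (nrm2 (u k) <= M%:E)%E) ->
    exists sg : nat -> nat, (forall k, (sg k < sg k.+1)%N) /\
      exists g : V -> C, mem g /\
        (fun k => nrm2 (fun z => T (u (sg k)) z - g z)) @ \oo --> 0%E.

End Defs.

(* Main.v *)
Require Import Defs.
From HB Require Import structures.
From mathcomp Require Import all_boot all_order all_algebra.
From mathcomp Require Import all_classical all_reals all_analysis.
From mathcomp Require Import complex measurable_realfun.
From mathcomp Require Import ring lra zify.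
Set Implicit Arguments. Unset Strict Implicit. Unset Printing Implicit Defensive.
Import Order.TTheory GRing.Theory Num.Theory.
Import numFieldNormedType.Exports.
Local Open Scope classical_set_scope.
Local Open Scope ring_scope.

(* In the coordinates v = 1/(1-z_1), u = z'/(1-z_1) a parabolic map fixing e1 becomes
   affine, (u, v) -> (D u + f, v + <b, u> + c): the numerator of 1 - tau_1 has no
   tangential first-order term at e1, because tau preserves the ball, and D_1 tau_1 = 1
   makes the coefficient of v equal to 1.  Such a map commutes with v -> v + iy.

   Take test functions f_y that are powers of the kernel 1/(1 - conj(a) z_1) with
   1/(1-a) = 1 + iy and y -> infinity (times one further coordinate z_j when phi and
   psi agree in the first component), normalized to have bounded norms.  Near the
   translate by iy of a point z0 with phi z0 <> psi z0, the images under phi and psi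
   keep a fixed difference in the new coordinates, so f_y o phi - f_y o psi has maximal
   size on a box whose contribution to the norm is bounded below.  On the other hand
   f_y o phi and f_y o psi tend to 0 locally uniformly, so that 0 is the only possible
   norm limit of a subsequence: a contradiction.

   All norm estimates bound iterated integrals of nonnegative functions from above or
   below by monotonicity alone, so that the integrands need not be measurable and no
   change of variables occurs. *)

(** * Iterated integrals of nonnegative functions *)

(** The points a lie on the horocycle |1 - a|^2 = 1 - |a|^2 = eps and approach 1 tangentially. This
    matters: if v -> +oo along the real axis with u fixed, the images v + O(1) under phi and psi
    have ratio tending to 1, and normalized kernels centred there cannot tell them apart. Along iy
    the kernel is (v - iy) / (v (1 - iy)), so after normalization only the offset v - iy survives in
    the limit, and this offset tends to different numbers p0 and q0 for the two maps.

    The limits (i / p0)^m and (i / q0)^m may still coincide when p0 / q0 is a root of unity, so the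
    exponent is picked among two consecutive ones.

    A box of size eps in z_1 and sqrt eps in the other coordinates has volume of order eps^(N+1),
    hence weighted mass of order eps^(N+1+alpha); its trace on the sphere has measure of order
    eps^N. These exponents are [sg]: a peak of |f|^2 of height eps^(-sg) has norm of order 1,
    provided m is large enough for the kernel power to decay integrably in every direction. *)

Section Integration.
Variable R : realType.
Implicit Types (f g : R -> \bar R).
Local Notation mu := (@lebesgue_measure R).

(* The library's monotonicity lemma asks for measurability; the integral of a
   nonnegative function is a supremum over simple minorants, so none is needed. *)
Lemma le_integralT f g : (forall x, 0 <= f x)%E -> (forall x, f x <= g x)%E ->
  (\int[mu]_x f x <= \int[mu]_x g x)%E.
Proof.
move=> f0 fg.
have g0 x : (0 <= g x)%E by exact: le_trans (f0 x) (fg x).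
rewrite !ge0_integralTE//; apply: ereal_sup_le => _ [h hf <-].
by exists h => // x; exact: le_trans (hf x) (fg x).
Qed.

Lemma iint_ge0 k (G : (nat -> R) -> \bar R) :
  (forall s, 0 <= G s)%E -> (0 <= iint k G)%E.
Proof. by elim: k G => [|k IH] G G0 //=; apply: integral_ge0 => x _; apply: IH. Qed.

Lemma integral_lower (a r K : R) (F : R -> \bar R) : 0 <= r -> 0 <= K ->
  (forall x, 0 <= F x)%E -> (forall x, `|x - a| <= r -> (K%:E <= F x)%E) ->
  ((K * (2 * r))%:E <= \int[mu]_x F x)%E.
Proof.
move=> r0 K0 F0 FK.
have -> : (K * (2 * r))%:E = (\int[mu]_(x in `[(a - r)%R, (a + r)%R]) K%:E)%E.
  rewrite integral_cst//= lebesgue_measure_itv/= lte_fin.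
  case: ltP => h; rewrite -?EFinB -?EFinM.
    by congr (_%:E); ring.
  have -> : r = 0 by lra.
  by rewrite !mulr0.
rewrite integral_mkcond; apply: le_integralT => x; rewrite patchE; case: ifPn => //.
rewrite inE /= in_itv/= => h.
by apply: FK; rewrite ler_distl.
Qed.

(* Only the innermost centre may move, with the second coordinate: this is what
   the slanted boxes of the Hardy space need. *)
Lemma iint_lower k (G : (nat -> R) -> \bar R) (m : R -> R) (c l : nat -> R) (K : R) :
  (forall s, 0 <= G s)%E -> 0 <= K -> (forall i, 0 <= l i) ->
  (forall s, `|s 0%N - m (s 1%N)| <= l 0%N ->
     (forall i, (1 <= i < k.+2)%N -> `|s i - c i| <= l i) -> (K%:E <= G s)%E) ->
  ((K * \prod_(i < k.+2) (2 * l i))%:E <= iint k.+2 G)%E.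
Proof.
move=> + K0 l0.
have step := integral_lower.
elim: k G => [|k IH] G G0 hG.
  have -> : K * \prod_(i < 2) (2 * l i) = K * (2 * l 0%N) * (2 * l 1%N).
    by rewrite !big_ord_recr big_ord0 /=; ring.
  rewrite /=; apply: (step (c 1%N)) => // [||x hx].
  - by rewrite mulr_ge0// mulr_ge0.
  - by move=> x; apply: integral_ge0.
  apply: (step (m x)) => // z hz.
  apply: hG; first by rewrite /upd/=.
  by case=> [|[|i]].
have -> : K * \prod_(i < k.+3) (2 * l i) = K * \prod_(i < k.+2) (2 * l i) * (2 * l k.+2).
  by rewrite big_ord_recr/=; ring.
rewrite -[iint k.+3 G]/(\int[mu]_x iint k.+2 (fun s => G (upd s k.+2 x)))%E.
apply: (step (c k.+2)) => // [||x hx].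
- by rewrite mulr_ge0// prodr_ge0// => i _; rewrite mulr_ge0.
- by move=> x; exact: (@iint_ge0 k.+2).
apply: IH => // s h0 h1; apply: hG; first by rewrite /upd/=.
move=> i /andP[i1 ik]; rewrite /upd; case: eqP => [->//|/eqP ne].
by apply: h1; rewrite i1/=; move: ik; rewrite ltnS leq_eqVlt (negPf ne).
Qed.

(** Two variables stay coupled under the inner double integral, because a slanted strip and a
    singular weight do not factor; every other variable contributes one factor [J]. In the induction
    [K] absorbs the value of [h] at the outermost variable. *)
Lemma iint_upper k (G : (nat -> R) -> \bar R) (K J : R) (h : R -> R) :
  (forall s, 0 <= G s)%E -> 0 <= K -> (forall x, 0 <= h x) -> measurable_fun setT h ->
  (\int[mu]_x (h x)%:E <= J%:E)%E ->
  (forall s, (\int[mu]_y \int[mu]_x G (upd (upd s 1 y) 0 x)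
      <= (K * \prod_(i < k) h (s i.+2))%:E)%E) ->
  (iint k.+2 G <= (K * J ^+ k)%:E)%E.
Proof.
move=> + K0 h0 mh hJ.
have J0 : 0 <= J.
  by rewrite -lee_fin (le_trans _ hJ)//; apply: integral_ge0 => x _; rewrite lee_fin.
elim: k K K0 G => [|k IH] K K0 G G0 hG.
  have := hG (fun=> 0); rewrite big_ord0 /= expr0 mulr1.
  apply: le_trans; apply: le_integralT => y; first by apply: integral_ge0.
  apply: le_integralT => x //; rewrite (_ : upd _ 1 y = upd (upd (fun=> 0) 1 y) 0 x)//.
  by apply/funext => -[|[|i]].
rewrite -[iint k.+3 G]/(\int[mu]_x iint k.+2 (fun s => G (upd s k.+2 x)))%E.
apply: (@le_trans _ _ (\int[mu]_x ((K * J ^+ k)%:E * (h x)%:E))%E).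
  apply: le_integralT => x; first exact: (@iint_ge0 k.+2).
  rewrite -EFinM.
  have -> : K * J ^+ k * h x = (K * h x) * J ^+ k by ring.
  apply: IH => //; first by rewrite mulr_ge0.
  move=> s; have := hG (upd s k.+2 x).
  have -> : \prod_(i < k.+1) h (upd s k.+2 x i.+2) = \prod_(i < k) h (s i.+2) * h x.
    rewrite big_ord_recr/=; congr (_ * _); last by rewrite /upd eqxx.
    by apply: eq_bigr => i _; rewrite /upd !eqSS (ltn_eqF (ltn_ord i)).
  rewrite -mulrA (mulrC (h x)); apply: le_trans.
  apply: le_integralT => y; first exact: integral_ge0.
  apply: le_integralT => z //.
  have -> : upd (upd (upd s 1 y) 0 z) k.+2 x = upd (upd (upd s k.+2 x) 1 y) 0 z.
    by apply/funext => -[|[|i]].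
  by [].
rewrite ge0_integralZl_EFin//; last first.
- by rewrite mulr_ge0 ?exprn_ge0.
- exact/measurable_EFinP.
- by move=> x _; rewrite lee_fin.
rewrite exprSr mulrA [leRHS]EFinM; apply: lee_pmul => //.
- by rewrite lee_fin mulr_ge0 ?exprn_ge0.
- by apply: integral_ge0 => x _; rewrite lee_fin.
Qed.

End Integration.

(** * Integrals of the model profiles *)

Section OneDim.
Variable R : realType.
Local Notation mu := (@lebesgue_measure R).

Lemma integral_derivative (f F : R -> R) (p q : R) : p < q ->
  (forall x, x \in `[p, q] -> is_derive x 1 F (f x)) ->
  (forall x, x \in `[p, q] -> {for x, continuous f}) ->
  (\int[mu]_(x in `[p, q]) (f x)%:E = (F q - F p)%:E)%E.
Proof.
move=> pq dF cf.
have cF x : x \in `[p, q] -> {for x, continuous F}.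
  move=> /dF [df _]; apply: differentiable_continuous.
  exact/derivable1_diffP.
rewrite (@continuous_FTC2 _ f F)//.
- by apply: continuous_in_subspaceT => x /[!inE]; exact: cf.
- split.
  + by move=> x xpq; have [] := dF x (subset_itv_oo_cc xpq).
  + by apply: cvg_at_right_filter; apply: cF; rewrite in_itv/= lexx ltW.
  + by apply: cvg_at_left_filter; apply: cF; rewrite in_itv/= lexx ltW.
- move=> x xpq; have [_ <-] := dF x (subset_itv_oo_cc xpq).
  by rewrite derive1E.
Qed.

Lemma integral_bigcup_le (f : R -> R) (F : (set R)^nat) (K : \bar R) :
  nondecreasing_seq F -> (forall i, measurable (F i)) ->
  (forall x, (\bigcup_i F i) x -> 0 <= f x) ->
  (forall i, measurable_fun (F i) f) ->
  (forall i, (\int[mu]_(x in F i) (f x)%:E <= K)%E) ->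
  (\int[mu]_(x in \bigcup_i F i) (f x)%:E <= K)%E.
Proof.
move=> ndF mF f0 mf hK.
have c : (\int[mu]_(x in F i) (f x)%:E)%E @[i --> \oo] -->
    (\int[mu]_(x in \bigcup_i F i) (f x)%:E)%E.
  apply: ge0_nondecreasing_set_cvg_integral => //.
  - by move=> i; apply/measurable_EFinP; exact: mf.
  - by move=> i x Fx; rewrite lee_fin f0//; exists i.
rewrite -(cvg_lim _ c)//; apply: lime_le; first by apply/cvg_ex; eexists; exact: c.
exact: nearW.
Qed.

(** The Cauchy profile of centre [b] and width [a], an integrable majorant for concentration at
    scale [a]: its mass is [pi * a]. *)
Definition lorentz (a b x : R) : R := (1 + ((x - b) / a) ^+ 2)^-1.

Lemma lorentz_ge0 (a b x : R) : 0 <= lorentz a b x.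
Proof. by rewrite invr_ge0 addr_ge0// sqr_ge0. Qed.

Lemma lorentz_le1 (a b x : R) : lorentz a b x <= 1.
Proof. by rewrite invf_le1 ?lerDl ?sqr_ge0// ltr_pwDl// sqr_ge0. Qed.

Lemma continuous_lorentz (a b : R) : continuous (lorentz a b).
Proof.
move=> x; apply: cvgV; first by rewrite gt_eqF// ltr_pwDl// sqr_ge0.
apply: cvgD; first exact: cvg_cst.
by rewrite expr2; apply: cvgM; exact: (cvgM (cvgB cvg_id (cvg_cst _)) (cvg_cst _)).
Qed.

Lemma measurable_lorentz (a b : R) : measurable_fun setT (lorentz a b).
Proof. by apply: continuous_measurable_fun => x; exact: continuous_lorentz. Qed.

Lemma integral_lorentz_le (a b : R) : 0 < a ->
  (\int[mu]_x (lorentz a b x)%:E <= (pi * a)%:E)%E.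
Proof.
move=> a0.
have -> : [set: R] = \bigcup_n `[- n.+1%:R, n.+1%:R]%classic.
  apply/esym; rewrite -subTset => x _.
  exists (Num.trunc `|x|) => //=; rewrite in_itv/= -ler_norml ltW//.
  exact: truncnS_gt.
apply: integral_bigcup_le => //.
- move=> m n mn; apply/subsetPset => x /=; rewrite !in_itv/= -!ler_norml.
  by move/le_trans; apply; rewrite ler_nat ltnS.
- by move=> x _; exact: lorentz_ge0.
- by move=> n; apply: measurable_funTS; exact: measurable_lorentz.
move=> n.
have dF (x : R) : x \in `[- n.+1%:R, n.+1%:R] ->
    is_derive x 1 (fun x => a * atan ((x - b) / a)) (lorentz a b x).
  move=> _; have h : is_derive x 1 (fun x : R => (x - b) / a) a^-1.
    have -> : (fun x : R => (x - b) / a) = (a^-1 \*: (id - cst b)).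
      by apply/funext => y /=; rewrite !fctE mulrC.
    by apply: is_derive_eq; rewrite subr0 [LHS]mulr1.
  have h2 := @is_derive1_comp _ atan (fun x : R => (x - b) / a) x _ _ (is_derive1_atan _) h.
  have -> : (fun x : R => a * atan ((x - b) / a)) = a \*: (atan \o (fun x : R => (x - b) / a)).
    by apply/funext.
  apply: is_derive_eq; rewrite /GRing.scale/= mulrCA mulfV ?mulr1//.
  by rewrite gt_eqF.
rewrite (integral_derivative _ dF).
- rewrite lee_fin -mulrBr mulrC ler_pM2r//.
  have := atan_ltpi2 ((n.+1%:R - b) / a).
  have := atan_gtNpi2 ((- n.+1%:R - b) / a).
  by lra.
- by rewrite gtrN// ltr0n.
- by move=> x _; exact: continuous_lorentz.
Qed.

(** [sg] is a sign, so that one statement covers a singularity at the left end and at the right end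
    of an interval. *)
Lemma integral_powR_le (be r d sg : R) : -1 < be -> 0 < d -> sg ^+ 2 = 1 ->
  (\int[mu]_(x in [set x | 0 < sg * (x - r) <= d]%R) ((sg * (x - r)) `^ be)%:E
     <= (d `^ (be + 1) / (be + 1))%:E)%E.
Proof.
move=> be1 d0 sg2.
have b0 : 0 < be + 1 by lra.
have h (x : R) : is_derive x 1 (fun x : R => sg * (x - r)) sg.
  have -> : (fun x : R => sg * (x - r)) = (sg \*: (id - cst r)) by apply/funext.
  by apply: is_derive_eq; rewrite subr0 [LHS]mulr1.
have ch (x : R) : {for x, continuous (fun x : R => sg * (x - r))}.
  by apply: differentiable_continuous; apply/derivable1_diffP; have [] := h x.
have mpow : measurable_fun setT (fun x : R => (sg * (x - r)) `^ be).
  apply: (@measurableT_comp _ _ _ _ _ _ (fun y : R => y `^ be)).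
    exact: measurable_powR.
  by apply: continuous_measurable_fun => x; exact: ch.
have ftc p q : p < q -> (forall x, x \in `[p, q] -> 0 < sg * (x - r)) ->
  (\int[mu]_(x in `[p, q]) ((sg * (x - r)) `^ be)%:E =
   (sg * ((sg * (q - r)) `^ (be + 1) - (sg * (p - r)) `^ (be + 1)) / (be + 1))%:E)%E.
  move=> pq pos.
  have dF (x : R) : x \in `[p, q] ->
    is_derive x 1 (fun x => sg / (be + 1) * (sg * (x - r)) `^ (be + 1)) ((sg * (x - r)) `^ be).
    move=> /pos x0.
    have h2 := @is_derive1_comp _ (powR (R:=R) ^~ (be + 1)) (fun x : R => sg * (x - r)) x _ _ (is_derive1_powR (be + 1) x0) (h x).
    have -> : (fun x : R => sg / (be + 1) * (sg * (x - r)) `^ (be + 1)) =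
      (sg / (be + 1)) \*: (powR (R:=R) ^~ (be + 1) \o (fun x : R => sg * (x - r))).
      by apply/funext.
    apply: is_derive_eq; rewrite /GRing.scale/= addrK.
    transitivity (sg ^+ 2 * (sg * (x - r)) `^ be); last by rewrite sg2 mul1r.
    by field; rewrite gt_eqF.
  rewrite (integral_derivative pq dF); first by congr (_%:E); ring.
  move=> x /pos x0.
  apply: (@continuous_comp _ _ _ (fun x : R => sg * (x - r)) (powR (R:=R) ^~ be)); first exact: ch.
  apply: differentiable_continuous; apply/derivable1_diffP.
  by apply: derivable_powR; rewrite in_itv/= andbT.
(* The pieces stay off the singular end, where the antiderivative need not be differentiable; [n.+2]
   rather than [n.+1] keeps every piece a nondegenerate interval. *)
pose F n : set R := [set x | d / n.+2%:R <= sg * (x - r) <= d].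
have dn n : 0 < d / n.+2%:R < d.
  by rewrite divr_gt0//= ltr_pdivrMr// ltr_pMr// ltr1n.
have FU : [set x | 0 < sg * (x - r) <= d] = \bigcup_n F n.
  apply/seteqP; split => x /=.
    move=> /andP[x0 xd].
    exists (Num.trunc (d / (sg * (x - r)))) => //=; rewrite /F/= xd andbT.
    rewrite ler_pdivrMr// mulrC -ler_pdivrMr// ltW//.
    by rewrite (lt_trans (truncnS_gt _))// ltr_nat.
  by move=> [n _] /= /andP[xn ->]; rewrite andbT (lt_le_trans _ xn)//; have /andP[] := dn n.
have key (p q : nat -> R) : (forall n, F n = `[p n, q n]%classic) ->
   (forall n, p n < q n) ->
   (forall n, sg * ((sg * (q n - r)) `^ (be + 1) - (sg * (p n - r)) `^ (be + 1)) <= d `^ (be + 1)) ->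
   (\int[mu]_(x in [set x | 0 < sg * (x - r) <= d]%R) ((sg * (x - r)) `^ be)%:E
     <= (d `^ (be + 1) / (be + 1))%:E)%E.
  move=> FE pq hb; rewrite FU; apply: integral_bigcup_le.
  - apply/nondecreasing_seqP => n; apply/subsetPset => x; rewrite /F/= => /andP[xn ->].
    by rewrite andbT (le_trans _ xn)// ler_pM2l// lef_pV2 ?posrE// ler_nat.
  - by move=> n; rewrite FE.
  - by move=> x _; exact: powR_ge0.
  - by move=> n; apply: measurable_funTS.
  - move=> n; rewrite FE ftc//; first by rewrite lee_fin ler_pM2r ?invr_gt0.
    move=> x xn; have : F n x by rewrite FE.
    by move=> /andP[xn' _]; rewrite (lt_le_trans _ xn')//; have /andP[] := dn n.
have [sgE|sgE] : sg = 1 \/ sg = -1.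
  by have /eqP := sg2; rewrite sqrf_eq1 => /orP[]/eqP; [left|right].
- apply: (key (fun n => r + d / n.+2%:R) (fun n => r + d)) => n.
  + apply/seteqP; split => x /=; rewrite /F in_itv/= sgE mul1r; set e := d / _;
    move=> /andP[h1 h2]; apply/andP; split; lra.
  + by have := dn n; set e := d / _ => /andP[h1 h2]; lra.
  + rewrite sgE !mul1r (_ : r + d - r = d); last by ring.
    by rewrite gerBl powR_ge0.
- apply: (key (fun n => r - d) (fun n => r - d / n.+2%:R)) => n.
  + apply/seteqP; split => x /=; rewrite /F in_itv/= sgE mulN1r; set e := d / _;
    move=> /andP[h1 h2]; apply/andP; split; lra.
  + by have := dn n; set e := d / _ => /andP[h1 h2]; lra.
  + rewrite sgE !mulN1r opprB (_ : - (r - d - r) = d); last by ring.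
    by rewrite gerBl powR_ge0.
Qed.
End OneDim.

(** * One-variable bounds for singular weights *)

Section OneDimBounds.
Variable R : realType.
Local Notation mu := (@lebesgue_measure R).

(** Scaling by [c^-1] maps simple minorants of [c * f] to simple minorants of [f], so the two
    suprema compare directly. *)
Lemma integral_scale_le (f : R -> \bar R) (c : R) : 0 <= c ->
  (forall x, 0 <= f x)%E -> (\int[mu]_x (c%:E * f x) <= c%:E * \int[mu]_x f x)%E.
Proof.
move=> c0 f0; have [->|cn0] := eqVneq c 0.
  by under eq_integral do rewrite mul0e; rewrite integral0 mul0e.
have cp : 0 < c by rewrite lt_neqAle eq_sym cn0.
have ci : 0 <= c^-1 by rewrite invr_ge0.
rewrite !ge0_integralTE//; last by move=> x; rewrite mule_ge0.
apply: ge_ereal_sup => _ [h hf <-].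
rewrite -lee_pdivrMl//.
apply: ereal_sup_ubound; exists (scale_nnsfun h ci).
  move=> x /=; rewrite EFinM lee_pdivrMl//.
exact: sintegralrM.
Qed.

(** Let t be the distance from x to the nearer of r and -r. Then r^2 - x^2 = t (2r - t) >= r t, so
    its power al <= 0 is at most r^al t^al, on t <= ep / r. Each end contributes r^al (ep / r)^(al +
    1) / (al + 1). *)
Lemma integral_shell_le (al rho2 r ep : R) : -1 < al -> al <= 0 -> 0 < r -> 0 < ep ->
  rho2 = r ^+ 2 ->
  (\int[mu]_x (if (0 < rho2 - x ^+ 2 < ep)%R then (rho2 - x ^+ 2) `^ al else 0)%:E
    <= (2 / (al + 1) * ep `^ (al + 1) / r)%:E)%E.
Proof.
move=> al1 al0 r0 ep0 ->.
pose D sg := [set x | 0 < sg * (x - sg * r) <= ep / r].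
pose g (sg : R) (x : R) := ((fun x => ((- sg) * (x - sg * r)) `^ al) \_ [set x | 0 < (- sg) * (x - sg * r) <= ep / r]) x.
have gmono sg : sg ^+ 2 = 1 ->
    (\int[mu]_x (g sg x)%:E <= ((ep / r) `^ (al + 1) / (al + 1))%:E)%E.
  move=> sg2; rewrite /g.
  have := @integral_powR_le R al (sg * r) (ep / r) (- sg) al1 (divr_gt0 ep0 r0).
  rewrite sqrrN => /(_ sg2); apply: le_trans.
  by rewrite [leRHS]integral_mkcond/= restrict_EFin.
have mlin sg : measurable_fun setT (fun x : R => - sg * (x - sg * r)).
  apply: continuous_measurable_fun => x.
  exact: (cvgM (cvg_cst _) (cvgB cvg_id (cvg_cst _))).
have mg sg : measurable_fun setT (g sg).
  have mD : measurable [set x | 0 < - sg * (x - sg * r) <= ep / r].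
    have -> : [set x | 0 < - sg * (x - sg * r) <= ep / r] =
       (fun x => - sg * (x - sg * r)) @^-1` `]0, ep / r]%classic.
      by apply/seteqP; split => x /=; rewrite in_itv.
    by rewrite -[X in measurable X]setTI; apply: (mlin sg).
  apply: (measurable_restrictT _ mD).1.
  exact: measurable_funTS (measurableT_comp (measurable_powR al) (mlin sg)).
have g0 sg x : 0 <= g sg x.
  by rewrite /g patchE; case: ifP => // _; exact: powR_ge0.
apply: (@le_trans _ _ (\int[mu]_x ((r `^ al)%:E * ((g 1 x)%:E + (g (-1) x)%:E)))%E).
  apply: le_integralT => x; first by rewrite lee_fin; case: ifP => // _; exact: powR_ge0.
  rewrite -EFinD -EFinM lee_fin; case: ifPn => [|_]; last first.
    by rewrite mulr_ge0 ?powR_ge0// addr_ge0.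
  move=> /andP[x0 xep].
  have main t : 0 < t -> t <= r -> r ^+ 2 - x ^+ 2 = t * (2 * r - t) ->
      (r ^+ 2 - x ^+ 2) `^ al <= r `^ al * t `^ al /\ t <= ep / r.
    move=> t0 tr e; split; last by rewrite ler_pdivlMr//; nra.
    have h1 : 0 < r * t by rewrite mulr_gt0.
    have h2 : r * t <= r ^+ 2 - x ^+ 2 by rewrite e; nra.
    have h3 := lt_le_trans h1 h2.
    rewrite -(powRM _ (ltW r0) (ltW t0)).
    rewrite -[al]opprK !(powRN _ (- al)) lef_pV2 ?posrE ?powR_gt0//.
    by rewrite ge0_ler_powR// ?nnegrE ?oppr_ge0 ?(ltW h1)// (ltW h3).
  case: (leP 0 x) => xs.
    have xr : x < r.
      by rewrite -subr_gt0 -(pmulr_lgt0 _ (ltr_pwDl r0 xs)) -subr_sqr.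
    have [|||h1 h2] := main (r - x); [by rewrite subr_gt0|lra|by ring|].
    apply: (le_trans h1); rewrite ler_pM2l ?powR_gt0//.
    rewrite -[leLHS]addr0 lerD//.
    have e : - 1 * (x - 1 * r) = r - x by ring.
    by rewrite /g patchE ifT ?e// inE/= e h2 andbT subr_gt0.
  have xr : - x < r.
    rewrite -subr_gt0 -(pmulr_lgt0 _ (_ : 0 < r - x)); last by lra.
    by rewrite (_ : _ * _ = r ^+ 2 - x ^+ 2)//; ring.
  have [|||h1 h2] := main (r + x); [lra|lra|by ring|].
  apply: (le_trans h1); rewrite ler_pM2l ?powR_gt0//.
  rewrite -[leLHS]add0r lerD//.
  have e : - -1 * (x - -1 * r) = r + x by ring.
  rewrite /g patchE e ifT ?e// inE/= e h2 andbT; lra.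
apply: le_trans (integral_scale_le _ _) _; first exact: powR_ge0.
  by move=> x; rewrite adde_ge0 ?lee_fin.
have mE sg : measurable_fun setT (fun x => (g sg x)%:E).
  by apply/measurable_EFinP; exact: mg.
have gE sg x : (0 <= (g sg x)%:E)%E by rewrite lee_fin.
rewrite ge0_integralD//; [|exact: mE|exact: mE].
have e1 : (1 : R) ^+ 2 = 1 by rewrite expr1n.
have e2 : (-1 : R) ^+ 2 = 1 by rewrite sqrrN expr1n.
apply: le_trans (lee_wpmul2l _ (leeD (gmono _ e1) (gmono _ e2))) _.
  by rewrite lee_fin powR_ge0.
rewrite -EFinD -EFinM lee_fin.
rewrite powRM ?invr_ge0 ?(ltW ep0) ?(ltW r0)//.
have rn : r != 0 by rewrite gt_eqF.
have -> : r^-1 `^ (al + 1) = (r `^ al)^-1 * r^-1.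
  rewrite -(powR_inv1 (ltW r0)) -powRrM mulN1r powRN powRD; last by rewrite rn implybT.
  by rewrite (powRr1 (ltW r0)) invfM (powR_inv1 (ltW r0)).
rewrite le_eqVlt; apply/orP; left; apply/eqP.
have : r `^ al != 0 by rewrite gt_eqF ?powR_gt0.
have : r != 0 by rewrite gt_eqF.
have : al + 1 != 0 by rewrite gt_eqF//; lra.
move: (r `^ al) (ep `^ _) => a b h1 h2 h3; field.
by rewrite h1 h2 h3.
Qed.

Lemma integral_sum_le (f g h : R -> R) (A B : R) :
  (forall x, 0 <= f x) -> (forall x, 0 <= g x) -> (forall x, 0 <= h x) ->
  measurable_fun setT g -> measurable_fun setT h ->
  (forall x, f x <= g x + h x) ->
  (\int[mu]_x (g x)%:E <= A%:E)%E -> (\int[mu]_x (h x)%:E <= B%:E)%E ->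
  (\int[mu]_x (f x)%:E <= (A + B)%:E)%E.
Proof.
move=> f0 g0 h0 mg mh fgh gA hB.
apply: (@le_trans _ _ (\int[mu]_x ((g x)%:E + (h x)%:E))%E).
  by apply: le_integralT => x; rewrite ?lee_fin// -EFinD lee_fin.
rewrite ge0_integralD//; [|by move=> x _; rewrite lee_fin|exact/measurable_EFinP
  |by move=> x _; rewrite lee_fin|exact/measurable_EFinP].
by rewrite EFinD; exact: leeD.
Qed.

Lemma integral_scaleR_le (f : R -> R) (c A : R) : 0 <= c -> (forall x, 0 <= f x) ->
  (\int[mu]_x (f x)%:E <= A%:E)%E -> (\int[mu]_x (c * f x)%:E <= (c * A)%:E)%E.
Proof.
move=> c0 f0 fA; under eq_integral do rewrite EFinM.
apply: le_trans (integral_scale_le c0 _) _; first by move=> x; rewrite lee_fin.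
by rewrite EFinM; apply: lee_wpmul2l.
Qed.

Definition shell (al rho ep x : R) : R :=
  if 0 < rho - x ^+ 2 < ep then (rho - x ^+ 2) `^ al else 0.

Lemma shell_ge0 al rho ep x : 0 <= shell al rho ep x.
Proof. by rewrite /shell; case: ifP => // _; exact: powR_ge0. Qed.

Lemma measurable_shell al rho ep : measurable_fun setT (shell al rho ep).
Proof.
have mq : measurable_fun setT (fun x : R => rho - x ^+ 2).
  apply: continuous_measurable_fun => x; apply: cvgB; first exact: cvg_cst.
  by rewrite expr2; exact: (cvgM cvg_id cvg_id).
apply: measurable_fun_ifT.
- by apply: measurable_and; apply: measurable_fun_ltr.
- exact: (measurableT_comp (measurable_powR al) mq).
- exact: measurable_cst.
Qed.

(** Where r^2 - x^2 < ep the power is integrated and the profile bounded by 1; elsewhere the power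
    is at most ep^al and the profile has mass pi ep. Both parts have order ep^(al + 1). *)
Lemma integral_shell_lorentz_le (al r ep : R) : -1 < al -> al <= 0 -> 0 < r <= 1 -> 0 < ep ->
  (\int[mu]_x (if (0 < r ^+ 2 - x ^+ 2)%R then
     (r ^+ 2 - x ^+ 2) `^ al * lorentz ep 1 x else 0)%:E
    <= ((2 / (al + 1) + pi) * ep `^ (al + 1) / r)%:E)%E.
Proof.
move=> al1 al0 /andP[r0 r1] ep0.
have e0 := powR_gt0 (al + 1) ep0.
apply: (@le_trans _ _ (2 / (al + 1) * ep `^ (al + 1) / r + ep `^ al * (pi * ep))%:E).
  apply: (@integral_sum_le _ (shell al (r ^+ 2) ep) (fun x => ep `^ al * lorentz ep 1 x)).
  - by move=> x; case: ifP => // _; rewrite mulr_ge0 ?powR_ge0 ?lorentz_ge0.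
  - exact: shell_ge0.
  - by move=> x; rewrite mulr_ge0 ?powR_ge0 ?lorentz_ge0.
  - exact: measurable_shell.
  - by apply: measurable_funM; [exact: measurable_cst|exact: measurable_lorentz].
  - move=> x; case: ifPn => [x0|_]; last first.
      by rewrite addr_ge0 ?shell_ge0// mulr_ge0 ?powR_ge0 ?lorentz_ge0.
    rewrite /shell x0/=; case: ltP => h.
      rewrite -[leLHS]addr0 lerD//.
        by rewrite ler_piMr ?powR_ge0 ?lorentz_le1.
      by rewrite mulr_ge0 ?powR_ge0 ?lorentz_ge0.
    rewrite add0r ler_wpM2r ?lorentz_ge0//.
    rewrite -[al]opprK !(powRN _ (- al)) lef_pV2 ?posrE ?powR_gt0//.
    by rewrite ge0_ler_powR// ?nnegrE ?oppr_ge0 ?(ltW ep0)// (ltW x0).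
  - exact: integral_shell_le.
  - apply: integral_scaleR_le; [exact: powR_ge0|exact: lorentz_ge0|exact: integral_lorentz_le].
have e1 : ep `^ (al + 1) = ep `^ al * ep.
  by rewrite powRD ?(powRr1 (ltW ep0))// (gt_eqF ep0) implybT.
rewrite lee_fin (mulrDl _ pi) (mulrDl _ (pi * _)) lerD2l mulrCA -e1 ler_pdivlMr// ler_piMr//.
by rewrite mulr_ge0 ?pi_ge0// ltW.
Qed.

(** The inverse square root is the factor 1 / r that [integral_shell_lorentz_le] leaves behind. Away
    from its singularity it is at most 2. Near it, either x is far from b or q is not small, so one
    of the other two factors is at most 7 ep, while the inverse square root has integral at most 8:
    hence 56. *)
Lemma integral_strip_le (q b ep : R) : 0 <= q -> `|b| <= 4^-1 -> 0 < ep <= 1 ->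
  (\int[mu]_x (if (0 < 1 - q - x ^+ 2)%R then
     (Num.sqrt (1 - q - x ^+ 2))^-1 * lorentz ep b x * (1 + q / ep)^-1 else 0)%:E
    <= ((2 * pi + 56) * ep)%:E)%E.
Proof.
move=> q0 b4 /andP[ep0 ep1].
have qe0 : 0 <= q / ep by rewrite divr_ge0// ltW.
have qi : (1 + q / ep)^-1 <= 1 by rewrite invf_le1 ?lerDl// ltr_pwDl.
have qi0 : 0 <= (1 + q / ep)^-1 by rewrite invr_ge0 addr_ge0.
have [q1|q1] := leP 1 q.
  rewrite (_ : (fun x => _) = cst 0%E); last first.
    apply/funext => x; rewrite ifF//; apply/negbTE; rewrite -leNgt.
    by have := sqr_ge0 x; lra.
  by rewrite integral0 lee_fin mulr_ge0 ?(ltW ep0)// addr_ge0// mulr_ge0// pi_ge0.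
pose r := Num.sqrt (1 - q).
have r0 : 0 < r by rewrite sqrtr_gt0; lra.
have r2 : 1 - q = r ^+ 2 by rewrite sqr_sqrtr//; lra.
have -> : (2 * pi + 56) * ep = 2 * (pi * ep) + 7 * ep * 8 by ring.
(* The cut-off 2 r^2 exceeds every value of r^2 - x^2, so this [shell] is the whole inverse square
   root. *)
apply: (@integral_sum_le _ (fun x => 2 * lorentz ep b x)
  (fun x => 7 * ep * shell (- 2^-1) (r ^+ 2) (2 * r ^+ 2) x)).
- move=> x; case: ifP => // _.
  by rewrite !mulr_ge0 ?lorentz_ge0 ?invr_ge0 ?sqrtr_ge0 ?addr_ge0.
- by move=> x; rewrite mulr_ge0 ?lorentz_ge0.
- by move=> x; rewrite mulr_ge0 ?shell_ge0// mulr_ge0// ltW.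
- by apply: measurable_funM; [exact: measurable_cst|exact: measurable_lorentz].
- by apply: measurable_funM; [exact: measurable_cst|exact: measurable_shell].
- move=> x; case: ifPn => [x0|_]; last first.
    by rewrite addr_ge0// mulr_ge0 ?lorentz_ge0 ?shell_ge0// mulr_ge0// ltW.
  have sx : 0 < Num.sqrt (1 - q - x ^+ 2) by rewrite sqrtr_gt0.
  have [h|h] := leP 4^-1 (1 - q - x ^+ 2).
    rewrite -[leLHS]addr0 lerD//; last by rewrite mulr_ge0 ?shell_ge0// mulr_ge0// ltW.
    rewrite -[leRHS]mulr1; apply: ler_pM => //.
      by rewrite mulr_ge0 ?lorentz_ge0 ?invr_ge0 ?sqrtr_ge0.
    rewrite ler_wpM2r ?lorentz_ge0//.
    rewrite -[leRHS]invrK lef_pV2 ?posrE ?invr_gt0//.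
    have -> : 2^-1 = Num.sqrt (4^-1) :> R.
      by rewrite (_ : 4^-1 = (2^-1) ^+ 2) ?sqrtr_sqr ?ger0_norm ?invr_ge0//; field.
    exact: ler_wsqrtr.
  rewrite -[leLHS]add0r lerD//; first by rewrite mulr_ge0 ?lorentz_ge0.
  have -> : shell (- 2^-1) (r ^+ 2) (2 * r ^+ 2) x = (Num.sqrt (1 - q - x ^+ 2))^-1.
    rewrite /shell -r2 x0/= ifT ?powRN ?powR12_sqrt ?(ltW x0)//.
    by have := sqr_ge0 x; lra.
  rewrite -mulrA mulrC ler_wpM2r ?invr_ge0 ?sqrtr_ge0//.
  have [hq|hq] := leP q 4^-1.
    have x2 : 2^-1 <= x ^+ 2 by lra.
    have l7 : lorentz ep b x <= 7 * ep.
      have dx : 7^-1 <= (x - b) ^+ 2.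
        have : `|x| - `|b| <= `|x - b| by exact: lerB_dist.
        rewrite -(real_normK (num_real (x - b))).
        rewrite -(real_normK (num_real x)) in x2.
        move: (normr_ge0 x) (normr_ge0 b) (normr_ge0 (x - b)) b4 x2.
        move: `|x| `|b| `|x - b| => X B D X0 B0 D0 B4 X2 h3.
        have X7 : 7 / 10 <= X by nra.
        by nra.
      rewrite /lorentz exprMn.
      rewrite invf_ple ?posrE; last 2 first.
        by rewrite ltr_pwDl// mulr_ge0 ?sqr_ge0.
        by rewrite mulr_gt0.
      rewrite invfM; have : 1 <= ep^-1 by rewrite invf_ge1.
      by move: (ep^-1) ((x - b) ^+ 2) dx => z d dx z1; nra.
    by rewrite -[leRHS]mulr1 ler_pM ?lorentz_ge0.
  have : (1 + q / ep)^-1 <= 7 * ep.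
    rewrite invf_ple ?posrE ?mulr_gt0 ?ltr_pwDl// invfM.
    have : 0 < ep^-1 by rewrite invr_gt0.
    by move: (ep^-1) => z z0; nra.
  by move=> h7; rewrite -[leRHS]mul1r ler_pM ?lorentz_ge0 ?lorentz_le1.
- by apply: integral_scaleR_le => //; [exact: lorentz_ge0|exact: integral_lorentz_le].
- apply: integral_scaleR_le; [by rewrite mulr_ge0// ltW|exact: shell_ge0|].
  have rr : 0 < 2 * r ^+ 2 by rewrite mulr_gt0// exprn_gt0.
  apply: le_trans (integral_shell_le _ _ r0 rr erefl) _; [lra|lra|].
  rewrite lee_fin ler_pdivrMr// (_ : - 2^-1 + 1 = 2^-1); last by field.
  rewrite invrK powR12_sqrt ?(ltW rr)// (_ : 8 * r = 2 * 2 * (2 * r)); last by ring.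
  rewrite ler_wpM2l// -[leRHS]ger0_norm ?mulr_ge0 ?(ltW r0)// -sqrtr_sqr.
  by apply: ler_wsqrtr; rewrite exprMn ler_wpM2r ?sqr_ge0// expr2; lra.
Qed.

End OneDimBounds.

(** * Two-variable bounds and positivity of Gamma *)

Section TwoDim.
Variable R : realType.
Local Notation mu := (@lebesgue_measure R).

Lemma integral2_lorentz_le (a b ep : R) : 0 < ep ->
  (\int[mu]_y \int[mu]_x (lorentz ep a x * lorentz ep b y)%:E <= ((pi * ep) ^+ 2)%:E)%E.
Proof.
move=> ep0.
apply: (@le_trans _ _ (\int[mu]_y (pi * ep * lorentz ep b y)%:E)%E); last first.
  rewrite expr2; apply: integral_scaleR_le; [|exact: lorentz_ge0|exact: integral_lorentz_le].
  by rewrite mulr_ge0 ?pi_ge0// ltW.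
apply: le_integralT => y.
  by apply: integral_ge0 => x _; rewrite lee_fin mulr_ge0 ?lorentz_ge0.
under eq_integral do rewrite mulrC.
rewrite (mulrC (pi * ep)).
by apply: integral_scaleR_le; [exact: lorentz_ge0|exact: lorentz_ge0|exact: integral_lorentz_le].
Qed.

(** The inner integral runs over x. For |y| < 2t the integrand is a profile in x of width ep / t;
    for |y| >= 2t one has |y - x t| >= |y| / 2, so it is at most 4 (ep / |y|)^2. Both cases lie
    below a multiple of (ep / t) [lorentz t 0 y], whose integral over y is at most a multiple of
    ep. *)
Lemma integral2_slant_le (t ep : R) : 0 < ep -> ep <= t ->
  (\int[mu]_y \int[mu]_x (if `|x| <= 1 then lorentz ep (x * t) y else 0)%:E
    <= ((5 * pi + 10) * pi * ep)%:E)%E.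
Proof.
move=> ep0 ept; have t0 := lt_le_trans ep0 ept.
have c0 : 0 <= (5 * pi + 10) * (ep / t) by rewrite mulr_ge0 ?divr_ge0 ?addr_ge0 ?mulr_ge0 ?pi_ge0 ?(ltW ep0) ?(ltW t0).
have f0 y x : 0 <= if `|x| <= 1 then lorentz ep (x * t) y else 0.
  by case: ifP => // _; exact: lorentz_ge0.
apply: (@le_trans _ _ (\int[mu]_y ((5 * pi + 10) * (ep / t) * lorentz t 0 y)%:E)%E); last first.
  have -> : (5 * pi + 10) * pi * ep = (5 * pi + 10) * (ep / t) * (pi * t).
    by field; rewrite gt_eqF.
  by apply: integral_scaleR_le => //; [exact: lorentz_ge0|exact: integral_lorentz_le].
apply: le_integralT => y.
  by apply: integral_ge0 => x _; rewrite lee_fin.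
have [yt|yt] := ltP `|y| (2 * t).
  apply: (@le_trans _ _ (pi * (ep / t))%:E).
    apply: le_trans (integral_lorentz_le (y / t) (divr_gt0 ep0 t0)).
    apply: le_integralT => x; rewrite lee_fin//.
    case: ifP => _; last exact: lorentz_ge0.
    rewrite /lorentz.
    have -> : (y - x * t) / ep = - ((x - y / t) / (ep / t)).
      by field; rewrite !gt_eqF.
    by rewrite sqrrN.
  rewrite lee_fin mulrAC ler_wpM2r ?divr_ge0 ?ltW//.
  have : 5^-1 <= lorentz t 0 y.
    rewrite /lorentz subr0 lef_pV2 ?posrE ?ltr_pwDl ?sqr_ge0//.
    have : `|y / t| <= 2.
      by rewrite normrM normfV (gtr0_norm t0) ler_pdivrMr// ltW.
    rewrite -(real_normK (num_real (y / t))).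
    by move: `|_| (normr_ge0 (y / t)) => z z0 z2; nra.
  move: (lorentz _ _ _) (pi_ge0 R) => l p0 l5; nra.
have t2 : 0 < 2 * t by rewrite mulr_gt0.
have y0 : 0 < `|y| by exact: lt_le_trans yt.
apply: (@le_trans _ _ (4 * (ep / `|y|) ^+ 2 * 2)%:E).
  apply: (@le_trans _ _ (\int[mu]_(x in `[(-1)%R, 1%R]) (4 * (ep / `|y|) ^+ 2)%:E)%E).
    rewrite [leRHS]integral_mkcond; apply: le_integralT => x; rewrite ?lee_fin//.
    rewrite patchE; have -> : (x \in `[-1, 1]%classic) = (`|x| <= 1).
      by rewrite mem_setE in_itv/= ler_norml.
    case: ifPn => // x1.
    rewrite lee_fin /lorentz.
    have e : `|y| / 2 <= `|y - x * t|.
      have : `|y| - `|x * t| <= `|y - x * t| by exact: lerB_dist.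
      have : `|x * t| <= t by rewrite normrM (gtr0_norm t0) ler_piMl// ltW.
      by lra.
    have p1 : 0 < 1 + ((y - x * t) / ep) ^+ 2 by rewrite ltr_pwDl// sqr_ge0.
    have p2 : 0 < 4 * (ep / `|y|) ^+ 2 by rewrite mulr_gt0// exprn_gt0// divr_gt0.
    rewrite -[leRHS]invrK lef_pV2 ?posrE ?invr_gt0//.
    rewrite -(real_normK (num_real ((y - x * t) / ep))) normrM normfV (gtr0_norm ep0).
    rewrite invfM -exprVn invf_div.
    apply: (@le_trans _ _ ((`|y| / 2 / ep) ^+ 2)).
      by rewrite le_eqVlt; apply/orP; left; apply/eqP; field; rewrite gt_eqF.
    apply: (@le_trans _ _ ((`|y - x * t| / ep) ^+ 2)); last by lra.
    rewrite lerXn2r ?nnegrE ?divr_ge0 ?(ltW ep0) ?(ltW y0)//.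
    by rewrite ler_pM2r ?invr_gt0.
  rewrite integral_cst//= lebesgue_measure_itv/= lte_fin ifT; last by lra.
  by rewrite -EFinB -EFinM lee_fin opprK.
rewrite lee_fin /lorentz subr0 -(real_normK (num_real (y / t))) normrM normfV (gtr0_norm t0).
move: `|y| y0 yt => z z0 zt.
apply: (@le_trans _ _ (10 * (ep / t) * (1 + (z / t) ^+ 2)^-1)); last first.
  rewrite -!mulrA ler_wpM2r//; last by have := pi_ge0 R; lra.
  by rewrite mulr_ge0 ?divr_ge0 ?invr_ge0 ?addr_ge0 ?sqr_ge0 ?(ltW ep0) ?(ltW t0).
rewrite ler_pdivlMr; last by rewrite ltr_pwDl// sqr_ge0.
have -> : 4 * (ep / z) ^+ 2 * 2 * (1 + (z / t) ^+ 2) = 8 * (ep ^+ 2) * ((t / z) ^+ 2 + 1) / t ^+ 2.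
  by field; rewrite !gt_eqF.
have -> : 10 * (ep / t) = 10 * ep * t / t ^+ 2 by field; rewrite gt_eqF.
rewrite ler_pM2r ?invr_gt0 ?exprn_gt0//.
have h : (t / z) ^+ 2 <= 4^-1.
  have : t / z <= 2^-1 by rewrite ler_pdivrMr//; lra.
  have : 0 <= t / z by rewrite divr_ge0 ?ltW.
  by move: (t / z) => w w0 w2; nra.
move: ((t / z) ^+ 2) h (sqr_ge0 (t / z)) => w w4 w0; nra.
Qed.

(** This is the Bergman weight for al <= 0 in the real and imaginary parts of z_1, with q the sum of
    the squares of the other coordinates. The inner integral costs 1 / r with r = sqrt (1 - q -
    y^2); the last factor compensates for q near 1, where r degenerates. *)
Lemma integral2_singular_le (al b q ep : R) : -1 < al -> al <= 0 -> `|b| <= 4^-1 ->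
  0 <= q -> 0 < ep <= 1 ->
  (\int[mu]_y \int[mu]_x (if (0 < 1 - q - y ^+ 2 - x ^+ 2)%R then
     (1 - q - y ^+ 2 - x ^+ 2) `^ al * lorentz ep 1 x * lorentz ep b y * (1 + q / ep)^-1 else 0)%:E
    <= ((2 / (al + 1) + pi) * ep `^ (al + 1) * ((2 * pi + 56) * ep))%:E)%E.
Proof.
move=> al1 al0 b4 q0 /andP[ep0 ep1].
have qi0 : 0 <= (1 + q / ep)^-1 by rewrite invr_ge0 addr_ge0// divr_ge0// ltW.
have c0 : 0 <= (2 / (al + 1) + pi) * ep `^ (al + 1).
  by rewrite mulr_ge0 ?powR_ge0// addr_ge0 ?pi_ge0// divr_ge0//; lra.
have ep01 : 0 < ep <= 1 by rewrite ep0.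
apply: le_trans (integral_scaleR_le c0 _ (integral_strip_le q0 b4 ep01)); last first.
  move=> y; case: ifP => // _.
  by rewrite !mulr_ge0 ?lorentz_ge0// invr_ge0 sqrtr_ge0.
have pos y x : 0 <= (if (0 < 1 - q - y ^+ 2 - x ^+ 2)%R then
     (1 - q - y ^+ 2 - x ^+ 2) `^ al * lorentz ep 1 x * lorentz ep b y * (1 + q / ep)^-1 else 0).
  by case: ifP => // _; rewrite !mulr_ge0 ?lorentz_ge0 ?powR_ge0.
apply: le_integralT => y; first by apply: integral_ge0 => x _; rewrite lee_fin.
case: ifPn => [y0|]; last first.
  rewrite -leNgt => y0; rewrite (_ : (fun x => _) = cst 0%E) ?integral0 ?mulr0//.
  apply/funext => x; rewrite ifF//; apply/negbTE; rewrite -leNgt.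
  by have := sqr_ge0 x; lra.
set r := Num.sqrt _.
have r0 : 0 < r by rewrite sqrtr_gt0.
have r2 : 1 - q - y ^+ 2 = r ^+ 2 by rewrite sqr_sqrtr// ltW.
have r1 : r <= 1.
  rewrite -(@expr_le1 _ 2) ?(ltW r0)// -r2; have := sqr_ge0 y; lra.
have r01 : 0 < r <= 1 by rewrite r0.
rewrite r2.
have := integral_shell_lorentz_le al1 al0 r01 ep0 => h.
have k0 : 0 <= lorentz ep b y * (1 + q / ep)^-1 by rewrite mulr_ge0 ?lorentz_ge0.
pose f x := if 0 < r ^+ 2 - x ^+ 2 then (r ^+ 2 - x ^+ 2) `^ al * lorentz ep 1 x else 0.
have g0 x : 0 <= f x.
  by rewrite /f; case: ifP => // _; rewrite mulr_ge0 ?powR_ge0 ?lorentz_ge0.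
apply: le_trans (le_trans _ (integral_scaleR_le k0 g0 h)) _.
  apply: le_integralT => x; rewrite lee_fin; first by rewrite -r2.
  rewrite /f; case: ifP => _; last by rewrite mulr0.
  by rewrite le_eqVlt; apply/orP; left; apply/eqP; ring.
rewrite lee_fin le_eqVlt; apply/orP; left; apply/eqP.
by move: (r^-1) (lorentz _ _ _) ((1 + _)^-1) => u v w; ring.
Qed.

(** [fine] sends +oo to 0, so positivity needs finiteness of the integral besides a positive lower
    bound. *)
Lemma Gamma_gt0 (s : R) : 0 < s -> 0 < Gamma s.
Proof.
move=> s0; rewrite /Gamma integral_mkcond.
set F := (X in fine (integral _ _ X)).
have FE x : F x = (if 0 < x then x `^ (s - 1) * expR (- x) else 0)%:E.
  rewrite /F patchE; have -> : (x \in [set t : R | 0 < t]) = (0 < x) by apply/idP/idP; rewrite inE.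
  by case: ifP.
have F0 x : (0 <= F x)%E.
  by rewrite FE lee_fin; case: ifP => // _; rewrite mulr_ge0 ?powR_ge0 ?expR_ge0.
apply: fine_gt0; apply/andP; split.
  (* On [1, 2] a power is at least the smaller of its endpoint values, whatever the sign of the
     exponent. *)
  pose K := Num.min (1 `^ (s - 1)) (2 `^ (s - 1)) * expR (-2) : R.
  have K0 : 0 < K by rewrite mulr_gt0 ?expR_gt0// lt_min !powR_gt0.
  have half : 0 <= 2^-1 :> R by rewrite invr_ge0.
  apply: lt_le_trans (integral_lower (a := 3 / 2) half (ltW K0) F0 _).
    by rewrite lte_fin mulr_gt0// mulr_gt0// invr_gt0.
  move=> x; rewrite ler_distl => /andP[x1 x2].
  have x0 : 0 < x by lra.
  rewrite FE x0 lee_fin /K; apply: ler_pM.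
  - by rewrite le_min !powR_ge0.
  - exact: expR_ge0.
  - have [s1|s1] := leP 0 (s - 1).
      by rewrite ge_min ge0_ler_powR ?nnegrE// ?(ltW x0)//; lra.
    rewrite ge_min; apply/orP; right.
    rewrite -[s - 1]opprK !(powRN _ (- (s - 1))) lef_pV2 ?posrE ?powR_gt0//.
    by rewrite ge0_ler_powR// ?nnegrE ?oppr_ge0 ?(ltW s1) ?(ltW x0)//; lra.
  - by rewrite ler_expR; lra.
(* [n - 2] is at least [s - 1], so the bound n! / x^n for the exponential leaves n! / x^2, which the
   profile majorizes for x > 1. *)
pose n := (Num.trunc s).+2.
apply: (@le_lt_trans _ _ (1 `^ (s - 1 + 1) / (s - 1 + 1) + 2 * n`!%:R * (pi * 1))%:E); last exact: ltry.
have s1 : -1 < s - 1 by lra.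
pose g x : R := ((fun x : R => (1 * (x - 0)) `^ (s - 1)) \_ [set x : R | 0 < 1 * (x - 0) <= 1]) x.
have mD : measurable [set x : R | 0 < 1 * (x - 0) <= 1].
  rewrite (_ : mkset _ = `]0, 1]%classic)//.
  by apply/seteqP; split => x /=; rewrite in_itv/= mul1r subr0.
rewrite (_ : F = fun x => (if 0 < x then x `^ (s - 1) * expR (- x) else 0)%:E); last exact/funext.
apply: (@integral_sum_le _ _ g (fun x => 2 * n`!%:R * lorentz 1 0 x)).
- by move=> x; case: ifP => // _; rewrite mulr_ge0 ?powR_ge0 ?expR_ge0.
- by move=> x; rewrite /g patchE; case: ifP => // _; exact: powR_ge0.
- by move=> x; rewrite mulr_ge0 ?lorentz_ge0.
- apply: (measurable_restrictT _ mD).1; apply: measurable_funTS.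
  rewrite (_ : (fun x => _) = powR (R := R) ^~ (s - 1)); first exact: measurable_powR.
  by apply/funext => x; rewrite mul1r subr0.
- by apply: measurable_funM; [exact: measurable_cst|exact: measurable_lorentz].
- move=> x; case: ifPn => x0; last first.
    by rewrite addr_ge0 ?mulr_ge0 ?lorentz_ge0// /g patchE; case: ifP => // _; exact: powR_ge0.
  have [x1|x1] := leP x 1.
    rewrite -[leLHS]addr0 lerD ?mulr_ge0 ?lorentz_ge0//.
    rewrite /g patchE ifT; last by rewrite inE/= mul1r subr0 x0.
    by rewrite mul1r subr0 ler_piMr ?powR_ge0// -expR0 ler_expR oppr_le0 ltW.
  rewrite -[leLHS]add0r lerD//.
    by rewrite /g patchE; case: ifP => // _; exact: powR_ge0.
  have xn : 0 < x ^+ n by rewrite exprn_gt0.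
  have h1 : x `^ (s - 1) <= x ^+ (n - 2).
    rewrite -powR_mulrn ?(ltW x0)//; apply: ler_powR; first exact: ltW.
    have := truncnS_gt s; rewrite /n subn2/= -natr1; lra.
  have h2 : expR (- x) <= n`!%:R / x ^+ n.
    rewrite expRN -[leRHS]invf_div lef_pV2 ?posrE ?expR_gt0 ?divr_gt0 ?ltr0n ?fact_gt0//.
    by have := expR_ge1Dxn (Num.trunc s).+1 (ltW x0); rewrite -/n; lra.
  apply: (@le_trans _ _ (x ^+ (n - 2) * (n`!%:R / x ^+ n))).
    by rewrite ler_pM ?powR_ge0 ?expR_ge0.
  have xe : x ^+ n = x ^+ (n - 2) * x ^+ 2 by rewrite -exprD subnK.
  rewrite xe /lorentz subr0 divr1.
  have -> : x ^+ (n - 2) * (n`!%:R / (x ^+ (n - 2) * x ^+ 2)) = n`!%:R / x ^+ 2.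
    by field; rewrite (gt_eqF x0) expf_neq0 ?(gt_eqF x0).
  rewrite -mulrA mulrCA ler_wpM2l// -[leRHS]invrK lef_pV2 ?posrE ?exprn_gt0//; last first.
    by rewrite invr_gt0 mulr_gt0// invr_gt0 ltr_pwDl// sqr_ge0.
  rewrite invfM invrK; nra.
- have := @integral_powR_le R (s - 1) 0 1 1 s1 ltr01 (expr1n _ _).
  by rewrite integral_mkcond/= restrict_EFin.
- by apply: integral_scaleR_le => //; [exact: lorentz_ge0|exact: integral_lorentz_le].
Qed.

End TwoDim.

(** * Complex numbers as pairs of reals *)

Section Cplx.
Local Open Scope complex_scope.
Variable R : realType.
Local Notation C := (Cx R).
(** The modulus with values in [R]: the norm of [C] is itself an element of [C], out of reach of
    real arithmetic. *)
Definition cnorm (x : C) : R := Num.sqrt (cabs2 x).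

Lemma cabs2_ge0 (x : C) : 0 <= cabs2 x.
Proof. by rewrite addr_ge0// sqr_ge0. Qed.

Lemma cnormE (x : C) : cnorm x = Normc.normc (x : R[i]).
Proof. by case: x. Qed.

Lemma sqr_cnorm (x : C) : cnorm x ^+ 2 = cabs2 x.
Proof. by rewrite sqr_sqrtr// cabs2_ge0. Qed.

Lemma cnorm_ge0 (x : C) : 0 <= cnorm x.
Proof. exact: sqrtr_ge0. Qed.

Lemma cnormM (x y : C) : cnorm (x * y) = cnorm x * cnorm y.
Proof. by rewrite !cnormE; exact: Normc.normcM. Qed.

Lemma cnormV (x : C) : cnorm x^-1 = (cnorm x)^-1.
Proof. by rewrite !cnormE; exact: Normc.normcV. Qed.

Lemma cnormN (x : C) : cnorm (- x) = cnorm x.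
Proof. by rewrite !cnormE; exact: normcN. Qed.

Lemma cnorm1 : cnorm 1 = 1.
Proof. by rewrite cnormE; exact: Normc.normc1. Qed.

Lemma cnorm0 : cnorm 0 = 0.
Proof. by rewrite cnormE; exact: Normc.normc0. Qed.

Lemma cnormX (x : C) n : cnorm (x ^+ n) = cnorm x ^+ n.
Proof. by elim: n => [|n IH]; rewrite ?cnorm1// !exprS cnormM IH. Qed.

Lemma cnormD (x y : C) : cnorm (x + y) <= cnorm x + cnorm y.
Proof. by rewrite !cnormE; exact: le_normcD. Qed.

Lemma cnormB (x y : C) : cnorm (x - y) <= cnorm x + cnorm y.
Proof. by rewrite -(cnormN y) cnormD. Qed.

Lemma cnormC (x y : C) : cnorm (x - y) = cnorm (y - x).
Proof. by rewrite -cnormN opprB. Qed.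

Lemma cnormBl (x y : C) : cnorm x - cnorm y <= cnorm (x - y).
Proof. by rewrite lerBlDr -{1}(subrK y x) cnormD. Qed.

Lemma cnorm_eq0 (x : C) : (cnorm x == 0) = (x == 0).
Proof.
apply/idP/idP => [/eqP|/eqP ->]; last by rewrite cnorm0.
by rewrite cnormE => /Normc.eq0_normc ->.
Qed.

Lemma cnorm_gt0 (x : C) : (0 < cnorm x) = (x != 0).
Proof. by rewrite lt_neqAle cnorm_ge0 andbT eq_sym cnorm_eq0. Qed.

Lemma normr_cnorm (x : C) : `|x| = RtoC (cnorm x).
Proof. by case: x. Qed.

Definition cRe (x : C) : R := complex.Re (x : R[i]).
Definition cIm (x : C) : R := complex.Im (x : R[i]).

Lemma cabs2E x : cabs2 x = cRe x ^+ 2 + cIm x ^+ 2.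
Proof. by []. Qed.

Lemma cRe_le (x : C) : `|cRe x| <= cnorm x.
Proof. by rewrite -sqrtr_sqr; apply: ler_wsqrtr; rewrite lerDl sqr_ge0. Qed.

Lemma cIm_le (x : C) : `|cIm x| <= cnorm x.
Proof. by rewrite -sqrtr_sqr; apply: ler_wsqrtr; rewrite lerDr sqr_ge0. Qed.

Lemma cnorm_le (x : C) : cnorm x <= `|cRe x| + `|cIm x|.
Proof.
rewrite -(@ler_pXn2r _ 2) ?nnegrE ?cnorm_ge0 ?addr_ge0//.
rewrite sqr_cnorm cabs2E -(real_normK (num_real (cRe x))) -(real_normK (num_real (cIm x))).
by have := normr_ge0 (cRe x); have := normr_ge0 (cIm x); nra.
Qed.

Lemma cnorm_RtoC (r : R) : cnorm (RtoC r) = `|r|.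
Proof. by rewrite /cnorm /cabs2 /= expr0n addr0 sqrtr_sqr. Qed.

Lemma RtoCM (a b : R) : RtoC (a * b) = RtoC a * RtoC b.
Proof. by rewrite /RtoC; congr (_ +i* _); rewrite /= ?mulr0 ?mul0r ?subr0 ?addr0. Qed.

Lemma RtoCD (a b : R) : RtoC (a + b) = RtoC a + RtoC b.
Proof. by rewrite /RtoC; congr (_ +i* _); rewrite /= addr0. Qed.

Lemma cReD (x y : C) : cRe (x + y) = cRe x + cRe y.
Proof. by case: x; case: y. Qed.

Lemma cImD (x y : C) : cIm (x + y) = cIm x + cIm y.
Proof. by case: x; case: y. Qed.

Lemma cReN (x : C) : cRe (- x) = - cRe x.
Proof. by case: x. Qed.

Lemma cImN (x : C) : cIm (- x) = - cIm x.
Proof. by case: x. Qed.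

Lemma cReM (x y : C) : cRe (x * y) = cRe x * cRe y - cIm x * cIm y.
Proof. by case: x; case: y. Qed.

Lemma cImM (x y : C) : cIm (x * y) = cRe x * cIm y + cIm x * cRe y.
Proof. by case: x; case: y => a b c d; rewrite [LHS]/cIm /= /cRe/=. Qed.

Lemma cImV (x : C) : cIm x^-1 = - (cIm x / cabs2 x).
Proof. by case: x. Qed.

Lemma cRe_RtoCM (a : R) (x : C) : cRe (RtoC a * x) = a * cRe x.
Proof. by rewrite cReM /= mul0r subr0. Qed.

Lemma cIm_RtoCM (a : R) (x : C) : cIm (RtoC a * x) = a * cIm x.
Proof. by rewrite cImM /= mul0r addr0. Qed.

Lemma complex_ext (x y : C) : cRe x = cRe y -> cIm x = cIm y -> x = y.
Proof. by case: x; case: y => a b c d /= ; rewrite /cRe /cIm /= => -> ->. Qed.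

Definition mkC (a b : R) : C := (a +i* b).

Lemma mulr_conj_cRe (x : C) : cRe (x * x^*) = cabs2 x.
Proof. by case: x => a b; rewrite /cRe /cabs2 /=; ring. Qed.

Lemma sqnormE N (z : 'rV[C]_N) : sqnorm z = \sum_(j < N) cabs2 (z 0 j).
Proof.
apply: (big_ind2 (fun (a : C) (b : R) => cRe a = b)) => // [a x b y <- <-|i _].
  exact: cReD.
exact: mulr_conj_cRe.
Qed.

Lemma inner_e1 n (z : 'rV[C]_n.+1) : inner z (@e1 R n.+1) = z 0 0.
Proof.
rewrite /inner big_ord_recl big1 => [|i _]; last by rewrite !mxE/= conjC0 mulr0.
by rewrite !mxE/= conjC1 mulr1 addr0.
Qed.

End Cplx.

(** * The kernel 1 - conj(a) z_1 *)

Section Kernel.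
Local Open Scope complex_scope.
Variable R : realType.
Local Notation C := (Cx R).

(* For a = iy/(1+iy), the point of the disc with 1/(1-a) = 1+iy: [eps y] is
   1 - |a|^2 and [abar y] is the conjugate of a. *)
Definition eps (y : R) : R := (1 + y ^+ 2)^-1.
Definition abar (y : R) : C := mkC (eps y * y ^+ 2) (- (eps y * y)).
Definition kdist (y : R) (x : C) : R := cnorm (1 - abar y * x).

Lemma eps_gt0 y : 0 < eps y.
Proof. by rewrite invr_gt0 ltr_pwDl// sqr_ge0. Qed.

Lemma epsK y : eps y * (1 + y ^+ 2) = 1.
Proof. by rewrite mulVf// gt_eqF// ltr_pwDl// sqr_ge0. Qed.

Lemma eps_le1 y : eps y <= 1.
Proof. by have := epsK y; have := eps_gt0 y; have := sqr_ge0 y; nra. Qed.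

Lemma eps_small y : 4 <= y -> eps y <= 17^-1.
Proof. by move=> y4; rewrite lef_pV2 ?posrE ?ltr_pwDl ?sqr_ge0//; nra. Qed.

Lemma eps_le_inv y : 4 <= y -> eps y <= y^-1.
Proof. by move=> y4; rewrite lef_pV2 ?posrE ?ltr_pwDl ?sqr_ge0//; nra. Qed.

Lemma cabs2_abar y : cabs2 (abar y) = 1 - eps y.
Proof.
rewrite cabs2E /cRe /cIm /=.
have -> : (eps y * y ^+ 2) ^+ 2 + (- (eps y * y)) ^+ 2 = eps y * (eps y * (1 + y ^+ 2)) * y ^+ 2 by ring.
by rewrite epsK -{2}(epsK y); ring.
Qed.

Lemma cnorm_abar y : cnorm (abar y) <= 1 - eps y / 2.
Proof.
rewrite -(@ler_pXn2r _ 2) ?nnegrE ?cnorm_ge0//; last by have := eps_le1 y; lra.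
by rewrite sqr_cnorm cabs2_abar; have := sqr_ge0 (eps y); nra.
Qed.

Lemma kdist_ge (y : R) (x : C) : 1 - (1 - eps y / 2) * cnorm x <= kdist y x.
Proof.
apply: le_trans (cnormBl _ _); rewrite cnorm1 cnormM lerD2l lerN2.
by rewrite ler_wpM2r ?cnorm_ge0 ?cnorm_abar.
Qed.

Lemma kdist_ge_eps y x : cnorm x <= 1 -> eps y / 2 <= kdist y x.
Proof.
move=> x1; apply: le_trans (kdist_ge _ _).
by have := eps_le1 y; have := cnorm_ge0 x; nra.
Qed.

Lemma kdist_gt0 y x : cnorm x <= 1 -> 0 < kdist y x.
Proof. by move=> /(kdist_ge_eps y); apply: lt_le_trans; rewrite divr_gt0 ?eps_gt0. Qed.

Lemma kdist_ge_norm y x : 1 - cnorm x <= kdist y x.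
Proof.
apply: le_trans (kdist_ge _ _).
by have := eps_gt0 y; have := cnorm_ge0 x; nra.
Qed.

Lemma kdist_ge_defect y x : cnorm x <= 1 -> (1 - cabs2 x) / 2 <= kdist y x.
Proof.
move=> x1; apply: le_trans (kdist_ge_norm _ _); rewrite -sqr_cnorm.
by have := cnorm_ge0 x; nra.
Qed.

(** The ray from 0 through a has slope 1 / y, so the left side measures the distance to that ray. It
    is homogeneous in x, hence compatible with the radial projection in the Hardy norm. *)
Lemma kdist_ge_strip y x : 4 <= y -> `|cIm x - cRe x / y| / 2 <= kdist y x.
Proof.
move=> y4; have y0 : y != 0 by rewrite gt_eqF//; lra.
apply: le_trans (cIm_le _).
have -> : cIm (1 - abar y * x) = - ((1 - eps y) * (cIm x - cRe x / y)).
  rewrite cImD cImN cImM /= add0r; congr (- _).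
  rewrite -{1}(epsK y); move: (eps y) (cRe x) (cIm x) => e a b.
  by field.
rewrite normrN normrM mulrC ler_wpM2r//.
by have := eps_small y4 => h; rewrite ger0_norm; lra.
Qed.

(** The zero of 1 - conj(a) x is 1 + i / y, and |a|^2 = 1 - eps. *)
Lemma kdist_sqr y x : y != 0 ->
  kdist y x ^+ 2 = (1 - eps y) * ((cRe x - 1) ^+ 2 + (cIm x - y^-1) ^+ 2).
Proof.
move=> y0; rewrite sqr_cnorm -cabs2_abar !cabs2E !(cReD, cImD, cReN, cImN, cReM, cImM).
have [-> ->] : cRe (1 : C) = 1 /\ cIm (1 : C) = 0 by [].
have [-> ->] : cRe (abar y) = eps y * y ^+ 2 /\ cIm (abar y) = - (eps y * y) by [].
move: (cRe x) (cIm x) (eps y) (epsK y) => a b e he.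
have h2 : e * (1 + y ^+ 2) - 1 = 0 by rewrite he subrr.
apply/eqP; rewrite -subr_eq0; apply/eqP.
transitivity ((e * (1 + y ^+ 2) - 1) * (- (e * (1 + y ^+ 2)) - 1 + 2 * e * y * (y * a + b))).
  by field.
by rewrite h2 mul0r.
Qed.

Lemma kdist_ge_box y x : 4 <= y ->
  `|cRe x - 1| / 2 <= kdist y x /\ `|cIm x - y^-1| / 2 <= kdist y x.
Proof.
move=> y4; have y0 : y != 0 by rewrite gt_eqF//; lra.
have e17 := eps_small y4.
have := kdist_sqr x y0.
rewrite -(real_normK (num_real (cRe x - 1))) -(real_normK (num_real (cIm x - y^-1))).
have : 0 <= kdist y x by exact: cnorm_ge0.
have := normr_ge0 (cRe x - 1); have := normr_ge0 (cIm x - y^-1).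
move: `|_| `|_| (kdist _ _) (eps y) e17 => b a d e e17 b0 a0 d0 h.
by split; rewrite -(@ler_pXn2r _ 2) ?nnegrE ?divr_ge0//; nra.
Qed.

Section Profile.
Variables (ep D : R).
Hypotheses (ep0 : 0 < ep) (D0 : ep / 2 <= D).
Local Notation v := (ep / D).

Lemma ratio_gt0 : 0 < v.
Proof. by rewrite divr_gt0//; apply: lt_le_trans D0; rewrite divr_gt0. Qed.

Lemma ratio_le2 : v <= 2.
Proof.
rewrite ler_pdivrMr; last by apply: lt_le_trans D0; rewrite divr_gt0.
by have h := D0; lra.
Qed.

(** Powers of ep / D are the currency of the norm estimates. Two of them buy a profile of width ep
    in a direction where D grows linearly; one buys a profile of width sqrt ep where D grows
    quadratically ([ratio_sqrt]). *)
Lemma ratio_lorentz (c b x : R) : 0 < c -> `|x - b| / c <= D ->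
  v ^+ 2 <= (4 + c ^+ 2) * lorentz ep b x.
Proof.
move=> cp h; have c0 := ltW cp.
have Dp : 0 < D by apply: lt_le_trans D0; rewrite divr_gt0.
rewrite /lorentz ler_pdivlMr; last by rewrite ltr_pwDl// sqr_ge0.
rewrite mulrDr mulr1; apply: lerD.
  by have := ratio_gt0; have := ratio_le2; move: (ep / D) => w w2 w0; nra.
rewrite -exprMn (_ : v * ((x - b) / ep) = (x - b) / D); last first.
  by field; rewrite !gt_eqF.
rewrite -(real_normK (num_real ((x - b) / D))) normrM normfV (gtr0_norm Dp).
rewrite ler_pXn2r ?nnegrE ?divr_ge0 ?(ltW Dp)//.
by rewrite ler_pdivrMr// mulrC -ler_pdivrMr.
Qed.

Lemma ratio_quad q : 0 <= q -> q / 2 <= D -> v <= 4 * (1 + q / ep)^-1.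
Proof.
move=> q0 h.
have Dp : 0 < D by apply: lt_le_trans D0; rewrite divr_gt0.
rewrite ler_pdivlMr; last by rewrite ltr_pwDl// divr_ge0// ltW.
rewrite mulrDr mulr1 (_ : 4 = 2 + 2); last by ring.
apply: lerD; first exact: ratio_le2.
have -> : v * (q / ep) = q / D by field; rewrite !gt_eqF.
by rewrite ler_pdivrMr//; lra.
Qed.

Lemma ratio_sqrt x : x ^+ 2 / 2 <= D -> v <= 4 * lorentz (Num.sqrt ep) 0 x.
Proof.
move=> h; rewrite /lorentz subr0 exprMn exprVn sqr_sqrtr ?(ltW ep0)//.
by apply: ratio_quad => //; exact: sqr_ge0.
Qed.

Lemma ratio_prod (s : nat -> R) k : (forall i, (i < k)%N -> s i ^+ 2 / 2 <= D) ->
  v ^+ k <= 4 ^+ k * \prod_(i < k) lorentz (Num.sqrt ep) 0 (s i).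
Proof.
elim: k => [|k IH] h; first by rewrite !expr0 big_ord0 mulr1.
rewrite big_ord_recr/= !exprSr mulrACA; apply: ler_pM.
- by rewrite exprn_ge0// ltW// ratio_gt0.
- by rewrite ltW// ratio_gt0.
- by apply: IH => i ik; apply: h; rewrite ltnS ltnW.
- exact/ratio_sqrt/h.
Qed.

(** T / ep is at most 2 / v, and 2 / v is at least 1, so its power al can be raised to the integer
    A: a weight that vanishes on the sphere costs A powers of v. *)
Lemma ratio_powR (al T : R) (A : nat) : 0 < T -> T / 2 <= D -> al <= A%:R -> 0 <= al ->
  T `^ al <= ep `^ al * (2 ^+ A / v ^+ A).
Proof.
move=> T0 h alA al0.
have Dp : 0 < D by apply: lt_le_trans D0; rewrite divr_gt0.
have -> : T = ep * (T / ep) by field; rewrite gt_eqF.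
rewrite (powRM _ (ltW ep0) (divr_ge0 (ltW T0) (ltW ep0))).
rewrite ler_wpM2l ?powR_ge0//.
have w1 : 1 <= 2 / v by rewrite ler_pdivlMr ?ratio_gt0// mul1r ratio_le2.
have w0 : 0 <= 2 / v by apply: le_trans w1.
apply: (@le_trans _ _ ((2 / v) `^ al)).
  rewrite ge0_ler_powR ?nnegrE ?divr_ge0 ?(ltW T0) ?(ltW ep0)//.
    by rewrite ltW// ratio_gt0.
  by rewrite invf_div mulrA ler_pM2r ?invr_gt0//; lra.
apply: (@le_trans _ _ ((2 / v) `^ A%:R)); first exact: ler_powR.
by rewrite powR_mulrn// exprMn exprVn.
Qed.

End Profile.
End Kernel.

(** * Upper bounds for the norms *)

Section NormUpper.
Local Open Scope complex_scope.
Variables (R : realType) (n : nat).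
Local Notation C := (Cx R).
Local Notation V := 'rV[C]_n.+1.
Local Notation mu := (@lebesgue_measure R).
Implicit Types (s : nat -> R) (z : V) (f : V -> C).

Lemma vec_of0 s : vec_of n.+1 s 0 0 = mkC (s 0%N) (s 1%N).
Proof. by rewrite mxE. Qed.

Lemma sqnorm_vec s :
  sqnorm (vec_of n.+1 s) = s 0%N ^+ 2 + s 1%N ^+ 2 + \sum_(i < 2 * n) s i.+2 ^+ 2.
Proof.
rewrite sqnormE big_ord_recl; congr (_ + _); first by rewrite vec_of0.
under eq_bigr => i _ do rewrite mxE cabs2E /cRe /cIm /=.
have E m : \sum_(i < m) (s (2 * i.+1)%N ^+ 2 + s (2 * i.+1 + 1)%N ^+ 2) =
    \sum_(i < 2 * m) s i.+2 ^+ 2.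
  elim: m => [|m IH]; first by rewrite !big_ord0.
  rewrite big_ord_recr IH (_ : (2 * m.+1 = (2 * m).+2)%N); last by lia.
  rewrite 2!big_ord_recr/= -addrA; congr (_ + (s _ ^+ 2 + s _ ^+ 2)); lia.
exact: E.
Qed.

Lemma sqnorm_scale (a : R) z : sqnorm (RtoC a *: z) = a ^+ 2 * sqnorm z.
Proof.
rewrite !sqnormE mulr_sumr; apply: eq_bigr => i _.
by rewrite mxE -!sqr_cnorm cnormM cnorm_RtoC exprMn real_normK ?num_real.
Qed.

Lemma sqnorm_ge0 z : 0 <= sqnorm z.
Proof. by rewrite sqnormE; apply: sumr_ge0 => i _; exact: cabs2_ge0. Qed.

Lemma cabs2_le_sqnorm z j : cabs2 (z 0 j) <= sqnorm z.
Proof.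
by rewrite sqnormE (bigD1 j)//= lerDl sumr_ge0// => i _; exact: cabs2_ge0.
Qed.

Lemma cnorm_le1 z : sqnorm z < 1 -> cnorm (z 0 0) <= 1.
Proof.
move=> z1; rewrite -(@ler_pXn2r _ 2) ?nnegrE ?cnorm_ge0// sqr_cnorm expr1n.
exact: le_trans (cabs2_le_sqnorm _ _) (ltW z1).
Qed.

Lemma nu_intE (g : V -> \bar R) :
  nu_int g = (iint (2 * n).+2 (fun s => if (sqnorm (vec_of n.+1 s) < 1)%R then g (vec_of n.+1 s) else 0)
     * (@ball_vol R n.+1)^-1%:E)%E.
Proof. by rewrite /nu_int /vol_int (_ : (2 * n.+1 = (2 * n).+2)%N)//; lia. Qed.

Lemma iint_sum_upper k (G : (nat -> R) -> \bar R) (g : (nat -> R) -> R -> R -> R)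
    (h : R -> R) (K J A : R) :
  (forall s, 0 <= G s)%E -> 0 <= K -> 0 <= A -> (forall x, 0 <= h x) ->
  measurable_fun setT h -> (\int[mu]_x (h x)%:E <= J%:E)%E ->
  (forall s x y, 0 <= g s x y) ->
  (forall s, (\int[mu]_y \int[mu]_x (g s x y)%:E <= A%:E)%E) ->
  (forall s x y, (G (upd (upd s 1 y) 0 x)
     <= (K * \prod_(i < k) h (s i.+2) * g s x y)%:E)%E) ->
  (iint k.+2 G <= (K * A * J ^+ k)%:E)%E.
Proof.
move=> G0 K0 A0 h0 mh hJ g0 hg hG.
apply: (iint_upper (h := h)) => //; first by rewrite mulr_ge0.
move=> s; set p := \prod_(i < k) _ in hG *.
have p0 : 0 <= K * \prod_(i < k) h (s i.+2) by rewrite mulr_ge0// prodr_ge0.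
apply: (@le_trans _ _ (\int[mu]_y \int[mu]_x ((K * \prod_(i < k) h (s i.+2))%:E * (g s x y)%:E))%E).
  apply: le_integralT => y; first exact: integral_ge0.
  by apply: le_integralT => x //; rewrite -EFinM.
apply: (@le_trans _ _ (\int[mu]_y ((K * \prod_(i < k) h (s i.+2))%:E * \int[mu]_x (g s x y)%:E))%E).
  apply: le_integralT => y; first by apply: integral_ge0 => x _; rewrite -EFinM lee_fin mulr_ge0.
  by apply: integral_scale_le => // x; rewrite lee_fin.
apply: le_trans (integral_scale_le p0 _) _.
  by move=> y; apply: integral_ge0 => x _; rewrite lee_fin.
by rewrite /p mulrAC [leRHS]EFinM; apply: lee_wpmul2l.
Qed.

(** The volume is a [fine] value and a divisor, so it must be finite and nonzero. A cube of
    half-side 1 / (2n + 2) gives the lower bound, a product of profiles of width 1 the upper one. *)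
Lemma ball_vol_gt0 : 0 < @ball_vol R n.+1.
Proof.
rewrite /ball_vol /vol_int (_ : (2 * n.+1 = (2 * n).+2)%N); last by lia.
have G0 s : (0 <= ball_ind (fun=> 1%E) (vec_of n.+1 s))%E.
  by rewrite /ball_ind; case: ifP.
apply: fine_gt0; apply/andP; split.
  pose l (_ : nat) : R := ((2 * n).+2)%:R^-1.
  have l0 i : 0 < l i by rewrite invr_gt0 ltr0n.
  apply: lt_le_trans (iint_lower (m := fun=> 0) (c := fun=> 0) (l := l) (K := 1) G0 _ _ _) => //.
  - by rewrite mul1r lte_fin prodr_gt0// => i _; rewrite mulr_gt0.
  - by move=> i; exact: ltW.
  move=> s h0 h1.
  have hs i : (i < (2 * n).+2)%N -> s i ^+ 2 <= l 0%N ^+ 2.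
    move=> i2; rewrite -(real_normK (num_real (s i))) ler_pXn2r ?nnegrE ?(ltW (l0 _))//.
    by case: i i2 => [|i] i2; [have := h0|have := h1 i.+1 i2]; rewrite subr0.
  rewrite /ball_ind ifT// sqnorm_vec.
  apply: (@le_lt_trans _ _ (l 0%N ^+ 2 + l 0%N ^+ 2 + \sum_(i < 2 * n) l 0%N ^+ 2)).
    by rewrite !lerD ?hs// ler_sum// => i _; apply: hs; rewrite !ltnS.
  rewrite sumr_const card_ord -mulr2n -mulrnDr -mulr_natl -[ltRHS](mulfV (x := (2 * n).+2%:R))//.
  rewrite ltr_pM2l ?ltr0n// expr2 gtr_pMl// invf_lt1 ?ltr0n// ltr1n.
  by [].
apply: le_lt_trans (iint_sum_upper (g := fun _ x y => lorentz 1 0 x * lorentz 1 0 y) (K := 4)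
   (h := fun x => 2 * lorentz 1 0 x) G0 _ (sqr_ge0 (pi * 1)) _ _ _ _ _ _) (ltry _) => //.
- by move=> x; rewrite mulr_ge0 ?lorentz_ge0.
- by apply: measurable_funM; [exact: measurable_cst|exact: measurable_lorentz].
- by apply: integral_scaleR_le => //; [exact: lorentz_ge0|exact: integral_lorentz_le].
- by move=> s x y; rewrite mulr_ge0 ?lorentz_ge0.
- by move=> s; apply: integral2_lorentz_le.
move=> s x y; rewrite /ball_ind; case: ifPn => [|_]; last first.
  rewrite lee_fin !mulr_ge0 ?lorentz_ge0 ?prodr_ge0// => i _.
  by rewrite mulr_ge0 ?lorentz_ge0.
rewrite sqnorm_vec /= => s1; rewrite lee_fin.
have l1 (t : R) : t ^+ 2 <= 1 -> 1 <= 2 * lorentz 1 0 t.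
  move=> t1; rewrite /lorentz subr0 divr1 ler_pdivlMr ?ltr_pwDl ?sqr_ge0//.
  by rewrite mul1r; lra.
have q0 : 0 <= \sum_(i < 2 * n) s i.+2 ^+ 2 by apply: sumr_ge0 => i _; exact: sqr_ge0.
rewrite /upd /= in s1.
have p1 : 1 <= \prod_(i < 2 * n) (2 * lorentz 1 0 (s i.+2)).
  elim/big_ind: _ => // [a b a1 b1|i _]; [exact: mulr_ege1|apply: l1].
  have : s i.+2 ^+ 2 <= \sum_(i < 2 * n) s i.+2 ^+ 2.
    by rewrite (bigD1 i)//= lerDl sumr_ge0// => j _; exact: sqr_ge0.
  by have := sqr_ge0 x; have := sqr_ge0 y; lra.
have x1 : 1 <= 2 * lorentz 1 0 x by apply: l1; have := sqr_ge0 y; lra.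
have y1 : 1 <= 2 * lorentz 1 0 y by apply: l1; have := sqr_ge0 x; lra.
rewrite (_ : 4 * _ * _ = \prod_(i < 2 * n) (2 * lorentz 1 0 (s i.+2)) *
   ((2 * lorentz 1 0 x) * (2 * lorentz 1 0 y))); last by ring.
by rewrite -[leLHS]mul1r ler_pM// -[leLHS]mul1r ler_pM.
Qed.

End NormUpper.

(** * Upper bound in the Hardy space *)

Section HardyUpper.
Local Open Scope complex_scope.
Variables (R : realType) (n : nat).
Local Notation C := (Cx R).
Local Notation V := 'rV[C]_n.+1.
Local Notation mu := (@lebesgue_measure R).
Implicit Types (s : nat -> R) (z : V) (f : V -> C).

(** [s] is the exponent that balances height against mass, and [P] is the stock of decay that the
    norm estimates spend. *)
Definition peak_bound (s : R) (P : nat) (M y : R) f :=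
  forall z, sqnorm z < 1 ->
    cabs2 (f z) <= M * eps y `^ (- s) * (eps y / kdist y (z 0 0)) ^+ P.

Definition hgt (y x : R) : R := lorentz (Num.sqrt (eps y)) 0 x.

Lemma sqrt_eps_gt0 (y : R) : 0 < Num.sqrt (eps y).
Proof. by rewrite sqrtr_gt0 eps_gt0. Qed.

Lemma sqrt_epsX (y : R) k : Num.sqrt (eps y) ^+ (2 * k) = eps y ^+ k.
Proof. by rewrite exprM sqr_sqrtr// ltW// eps_gt0. Qed.

Lemma exprn_split_le (v : R) (P k : nat) (B : R) : 0 <= v -> v <= 2 -> (k <= P)%N ->
  v ^+ k <= B -> v ^+ P <= 2 ^+ P * B.
Proof.
move=> v0 v2 kP vB; have B0 : 0 <= B by apply: le_trans vB; rewrite exprn_ge0.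
rewrite -{1}(subnK kP) exprD ler_pM ?exprn_ge0//.
apply: (@le_trans _ _ (2 ^+ (P - k))); first by rewrite lerXn2r ?nnegrE.
by rewrite ler_weXn2l ?leq_subr// ler1n.
Qed.

Lemma powR_eps_cancel (y a b : R) (k : nat) : a = b + k%:R ->
  eps y `^ (- a) * eps y `^ b * eps y ^+ k = 1.
Proof.
move=> ->; have e0 : eps y != 0 by rewrite gt_eqF// eps_gt0.
rewrite -powR_mulrn ?(ltW (eps_gt0 y))// -!powRD ?e0 ?implybT//.
by rewrite -addrA addNr powRr0.
Qed.

Lemma nu_int_le (g : V -> \bar R) (A : R) : (forall z, 0 <= g z)%E -> 
  (iint (2 * n).+2 (fun s => if (sqnorm (vec_of n.+1 s) < 1)%R then g (vec_of n.+1 s) else 0) <= A%:E)%E ->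
  (nu_int g <= (A / @ball_vol R n.+1)%:E)%E.
Proof.
move=> g0 h; rewrite nu_intE EFinM; apply: lee_pmul => //; last first.
  by rewrite lee_fin invr_ge0 ltW// ball_vol_gt0.
by apply: iint_ge0 => s; case: ifP.
Qed.

(** [sigma_int] integrates over the solid ball a function constant along rays, so there is no decay
    along the ray through a and only |x| <= 1 is used there. Decay across that ray takes two powers
    and yields a factor eps; the 2n tangential coordinates take one power each and yield eps^n.
    Together they cancel the height eps^(-N). *)
Lemma hardy_upper (P : nat) : (2 * n + 2 <= P)%N ->
  exists2 K : R, 0 <= K & forall y M f, 4 <= y -> 0 <= M ->
    peak_bound n.+1%:R P M y f -> (H2norm2 f <= (K * M)%:E)%E.
Proof.
move=> nP.
pose K1 : R := 2 ^+ P * (4 ^+ (2 * n) * (4 + 4 ^+ 2)).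
pose K2 : R := (5 * pi + 10) * pi.
have K10 : 0 <= K1 by rewrite /K1 !mulr_ge0 ?exprn_ge0 ?addr_ge0.
have p0 := pi_ge0 R.
have K20 : 0 <= K2 by apply: mulr_ge0 => //; lra.
exists (K1 * K2 * pi ^+ (2 * n) / @ball_vol R n.+1).
  by rewrite divr_ge0 ?(ltW (ball_vol_gt0 _ _))// mulr_ge0 ?exprn_ge0// mulr_ge0.
move=> y M f y4 M0 hf.
have y0 : 0 < y by lra.
have ep0 := eps_gt0 y.
apply: ge_ereal_sup => _ [r /= /andP[r0 r1] <-].
pose A := M * eps y `^ (- n.+1%:R) * K1 * (K2 * eps y) * (pi * Num.sqrt (eps y)) ^+ (2 * n).
have -> : K1 * K2 * pi ^+ (2 * n) / ball_vol R n.+1 * M = A / ball_vol R n.+1.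
  rewrite /A exprMn sqrt_epsX.
  have ea : n.+1%:R = 1 + n%:R :> R by rewrite -natr1 addrC.
  have := powR_eps_cancel y ea; rewrite powRr1 ?(ltW ep0)//.
  move: (eps y) (eps y ^+ n) (eps y `^ _) => c b a abc.
  rewrite (_ : M * a * K1 * (K2 * c) * (pi ^+ (2 * n) * b) = M * K1 * K2 * pi ^+ (2 * n) * (a * c * b)); last by ring.
  by rewrite abc; ring.
rewrite /sigma_int; apply: nu_int_le => [z|]; first by rewrite lee_fin cabs2_ge0.
apply: (iint_sum_upper (h := hgt y) (K := M * eps y `^ (- n.+1%:R) * K1)
  (g := fun _ x t => if `|x| <= 1 then lorentz (eps y) (x * y^-1) t else 0)).
- by move=> s; case: ifP => // _; rewrite lee_fin cabs2_ge0.
- by rewrite mulr_ge0// mulr_ge0 ?powR_ge0.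
- by rewrite mulr_ge0// ltW.
- by move=> x; exact: lorentz_ge0.
- exact: measurable_lorentz.
- exact/integral_lorentz_le/sqrt_eps_gt0.
- by move=> _ x t; case: ifP => // _; exact: lorentz_ge0.
- by move=> _; rewrite /K2; apply: integral2_slant_le => //; exact: eps_le_inv.
move=> s x t; set s' := upd _ _ _.
have pr0 : 0 <= \prod_(i < 2 * n) hgt y (s i.+2).
  by rewrite prodr_ge0// => i _; exact: lorentz_ge0.
have l0 : 0 <= if `|x| <= 1 then lorentz (eps y) (x * y^-1) t else 0.
  by case: ifP => // _; exact: lorentz_ge0.
case: ifPn => z1; last by rewrite lee_fin mulr_ge0// mulr_ge0// mulr_ge0// mulr_ge0 ?powR_ge0.
set z := vec_of n.+1 s' in z1 *.
have zE : sqnorm z = x ^+ 2 + t ^+ 2 + \sum_(i < 2 * n) s i.+2 ^+ 2.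
  by rewrite sqnorm_vec.
have q0 : 0 <= \sum_(i < 2 * n) s i.+2 ^+ 2 by apply: sumr_ge0 => i _; exact: sqr_ge0.
have hs i : (i < 2 * n)%N -> s i.+2 ^+ 2 <= \sum_(i < 2 * n) s i.+2 ^+ 2.
  move=> i2; rewrite (bigD1 (Ordinal i2))//= lerDl sumr_ge0// => j _; exact: sqr_ge0.
have x1 : `|x| <= 1.
  rewrite -(@ler_pXn2r _ 2) ?nnegrE// real_normK ?num_real// expr1n.
  by have := sqr_ge0 t; lra.
rewrite x1 lee_fin.
pose X := Num.sqrt (sqnorm z).
have X2 : X ^+ 2 = sqnorm z by rewrite sqr_sqrtr// sqnorm_ge0.
have X0 : 0 <= X by exact: sqrtr_ge0.
pose w := RtoC r *: (RtoC X^-1 *: z).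
have XV : X^-1 ^+ 2 * sqnorm z <= 1.
  rewrite -X2 -exprMn; have [->|X00] := eqVneq X 0; first by rewrite mulr0 expr0n.
  by rewrite mulVf// expr1n.
have w1 : sqnorm w < 1.
  rewrite /w !sqnorm_scale; apply: (@le_lt_trans _ _ (r ^+ 2)).
    by rewrite ler_piMr// sqr_ge0.
  by rewrite expr_lt1// ltW.
have wn := cnorm_le1 w1.
have D0 := kdist_ge_eps y wn.
set D := kdist y (w 0 0) in D0.
have Dd := kdist_ge_defect y wn.
have w00 : w 0 0 = RtoC (r / X) * mkC x t.
  by rewrite /w !mxE mulrA -RtoCM.
have Re_w : cRe (w 0 0) = r / X * x by rewrite w00 cRe_RtoCM.
have Im_w : cIm (w 0 0) = r / X * t by rewrite w00 cIm_RtoCM.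
have lam0 : 0 <= r / X by rewrite divr_ge0// ltW.
(* Since r < 1, the defect 1 - |w_1|^2 is at least the tangential part of |z|^2 divided by |z|^2,
   and |z| < 1. *)
have Dq i : (i < 2 * n)%N -> s i.+2 ^+ 2 / 2 <= D.
  move=> i2; apply: le_trans Dd; rewrite ler_pM2r ?invr_gt0//.
  apply: le_trans (hs _ i2) _.
  (* At z = 0 the inverse of [X] is 0 by convention; the tangential part vanishes too, so the bound
     is trivial. *)
  have [Xz|Xn] := eqVneq X 0.
    have := sqr_ge0 x; have := sqr_ge0 t; move: X2; rewrite Xz expr0n/= zE => e a b.
    have := cabs2_le_sqnorm w 0; lra.
  rewrite cabs2E Re_w Im_w !exprMn -mulrDr -!exprMn.
  have LX : (r / X) ^+ 2 * X ^+ 2 = r ^+ 2 by rewrite -exprMn divfK.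
  have XX : 0 < X ^+ 2 by rewrite exprn_gt0// lt_neqAle eq_sym Xn.
  have r2 : r ^+ 2 <= 1 by rewrite expr_le1// ltW.
  rewrite lerBrDr -(ler_pM2r XX) mul1r mulrDl mulrAC LX.
  rewrite X2 zE in XX *; rewrite zE in z1.
  move: (\sum_(_ < _) _) q0 z1 XX => q q0 z1 XX.
  have := sqr_ge0 x; have := sqr_ge0 t; have := sqr_ge0 r.
  move: (x ^+ 2) (t ^+ 2) (r ^+ 2) z1 XX r2 => a b c z1 XX r2 c0 b0 a0.
  by nra.
(* If r / X >= 1/2, rescaling the strip bound loses a factor 2, hence 4 in place of 2. Otherwise
   |w_1| <= 1/2, the kernel is at least 1/2, and the left side is at most 1/2 anyway. *)
have Dt : `|t - x * y^-1| / 4 <= D.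
  have [lam|lam] := leP 2^-1 (r / X).
    apply: le_trans (kdist_ge_strip (w 0 0) y4); rewrite Re_w Im_w.
    rewrite (_ : r / X * t - r / X * x / y = r / X * (t - x * y^-1)); last by ring.
    rewrite normrM (ger0_norm lam0).
    by have := normr_ge0 (t - x * y^-1); move: `|_| (r / X) lam => a b; nra.
  have t1 : `|t| <= 1.
    rewrite -(@ler_pXn2r _ 2) ?nnegrE// real_normK ?num_real// expr1n.
    by have := sqr_ge0 x; lra.
  have tx : `|t - x * y^-1| <= 2.
    apply: le_trans (ler_normB _ _) _; rewrite normrM.
    have : `|y^-1| <= 1.
      rewrite ger0_norm ?invr_ge0 ?(ltW y0)// invf_le1//; lra.
    by have := normr_ge0 x; have := normr_ge0 y^-1; nra.
  apply: le_trans (kdist_ge_norm y (w 0 0)).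
  have z1' : cnorm (mkC x t) <= 1.
    rewrite -(@ler_pXn2r _ 2) ?nnegrE ?cnorm_ge0// sqr_cnorm expr1n cabs2E /cRe /cIm /=.
    lra.
  rewrite w00 cnormM cnorm_RtoC (ger0_norm lam0).
  by have := cnorm_ge0 (mkC x t); nra.
apply: le_trans (hf w w1) _; rewrite -/D -!mulrA ler_wpM2l// ler_wpM2l ?powR_ge0//.
rewrite mulrA.
have v0 := ratio_gt0 ep0 D0; have v2 := ratio_le2 ep0 D0.
apply: le_trans (exprn_split_le (ltW v0) v2 nP (_ : _ <= (4 ^+ (2 * n) * \prod_(i < 2 * n) hgt y (s i.+2)) *
   ((4 + 4 ^+ 2) * lorentz (eps y) (x * y^-1) t))) _.
  rewrite exprD ler_pM ?exprn_ge0 ?(ltW v0)//.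
    exact: (ratio_prod ep0 D0 (s := fun i => s i.+2)).
  exact: ratio_lorentz.
by rewrite /K1 le_eqVlt; apply/orP; left; apply/eqP; ring.
Qed.

End HardyUpper.

(** * Upper bound in the weighted Bergman spaces *)

Section BergmanUpper.
Local Open Scope complex_scope.
Variables (R : realType) (n : nat).
Local Notation C := (Cx R).
Local Notation V := 'rV[C]_n.+1.
Local Notation mu := (@lebesgue_measure R).
Implicit Types (s : nat -> R) (z : V) (f : V -> C).

Lemma c_alpha_gt0 (al : R) : -1 < al -> 0 < c_alpha n.+1 al.
Proof.
move=> al1; have n0 : 0 <= n%:R :> R by rewrite ler0n.
rewrite divr_gt0 ?mulr_gt0 ?Gamma_gt0// -?natr1; lra.
Qed.

Lemma vec_of_upd_bounds s x t (s' := upd (upd s 1 t) 0 x) (z := vec_of n.+1 s') :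
  [/\ sqnorm z = x ^+ 2 + t ^+ 2 + \sum_(i < 2 * n) s i.+2 ^+ 2,
      cRe (z 0 0) = x, cIm (z 0 0) = t, 0 <= \sum_(i < 2 * n) s i.+2 ^+ 2 &
      forall i, (i < 2 * n)%N -> s i.+2 ^+ 2 <= \sum_(i < 2 * n) s i.+2 ^+ 2].
Proof.
split.
- by rewrite sqnorm_vec.
- by rewrite vec_of0.
- by rewrite vec_of0.
- by apply: sumr_ge0 => i _; exact: sqr_ge0.
- move=> i i2; rewrite (bigD1 (Ordinal i2))//= lerDl sumr_ge0// => j _; exact: sqr_ge0.
Qed.

(** The budget of powers: 2n for the tangential coordinates and 2 for each real coordinate of z_1.
    For al >= 0 the weight is then bounded pointwise at the price of A more; for al < 0 it is
    unbounded and has to be integrated, at the price of one more. *)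
Lemma bergman_upper (al : R) : -1 < al -> exists P0, forall P, (P0 <= P)%N ->
  exists2 K : R, 0 <= K & forall y M f, 4 <= y -> 0 <= M ->
    peak_bound (n.+1%:R + 1 + al) P M y f -> (A2norm2 al f <= (K * M)%:E)%E.
Proof.
move=> al1; set sg := n.+1%:R + 1 + al.
have [A alA] : exists A : nat, al <= A%:R.
  by exists (Num.trunc `|al|).+1; rewrite (le_trans (ler_norm _))// ltW// truncnS_gt.
have pi0 := pi_ge0 R.
exists (2 * n + 2 + 2 + 1 + A)%N => P nP.
pose K1 : R := 2 ^+ P * (4 ^+ (2 * n) * (4 + 2 ^+ 2) * (4 + 2 ^+ 2) * 4) * 2 ^+ A.
have K10 : 0 <= K1 by rewrite /K1 !mulr_ge0 ?exprn_ge0 ?addr_ge0.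
(* [g] is the profile in the two real coordinates of z_1, in the form that the sign of [al]
   dictates; what follows uses only its double integral and this majorization. *)
have [g [K2 [K20 g0 hg hgb]]] : exists g : (nat -> R) -> R -> R -> R -> R, exists K2 : R, [/\ 0 <= K2,
   (forall s y x t, 0 <= g s y x t),
   (forall s y, 4 <= y -> (\int[mu]_t \int[mu]_x (g s y x t)%:E <= (K2 * (eps y `^ al * eps y ^+ 2))%:E)%E) &
   forall s y x t, 4 <= y -> let z := vec_of n.+1 (upd (upd s 1 t) 0 x) in sqnorm z < 1 ->
     (eps y / kdist y (z 0 0)) ^+ P * (1 - sqnorm z) `^ al <=
     K1 * \prod_(i < 2 * n) hgt y (s i.+2) * g s y x t].
  have common s y x t : 4 <= y -> let z := vec_of n.+1 (upd (upd s 1 t) 0 x) in sqnorm z < 1 ->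
    let v := eps y / kdist y (z 0 0) in
    [/\ 0 < v, v <= 2, v ^+ (2 * n) <= 4 ^+ (2 * n) * \prod_(i < 2 * n) hgt y (s i.+2),
      v ^+ 2 <= (4 + 2 ^+ 2) * lorentz (eps y) 1 x & v ^+ 2 <= (4 + 2 ^+ 2) * lorentz (eps y) y^-1 t].
    move=> y4 z z1 v; have [zE xE tE q0 hs] := vec_of_upd_bounds s x t.
    have zn := cnorm_le1 z1; have D0 := kdist_ge_eps y zn; have ep0 := eps_gt0 y.
    have Dd := kdist_ge_defect y zn.
    have [Dx Dt] := kdist_ge_box (z 0 0) y4.
    rewrite xE in Dx; rewrite tE in Dt.
    split; [exact: ratio_gt0|exact: ratio_le2| |exact: ratio_lorentz|exact: ratio_lorentz].
    apply: (ratio_prod ep0 D0 (s := fun i => s i.+2)) => i i2.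
    apply: le_trans Dd; rewrite ler_pM2r ?invr_gt0//; apply: le_trans (hs _ i2) _.
    rewrite cabs2E xE tE; rewrite zE in z1; lra.
  have [al0|al0] := leP 0 al.
    exists (fun s y x t => eps y `^ al * (lorentz (eps y) 1 x * lorentz (eps y) y^-1 t)).
    exists (pi ^+ 2); split.
    - exact: sqr_ge0.
    - by move=> s y x t; rewrite mulr_ge0 ?powR_ge0 ?mulr_ge0 ?lorentz_ge0.
    - move=> s y y4.
      apply: (@le_trans _ _ (\int[mu]_t ((eps y `^ al)%:E * \int[mu]_x (lorentz (eps y) 1 x * lorentz (eps y) y^-1 t)%:E))%E).
        apply: le_integralT => t.
          by apply: integral_ge0 => x _; rewrite lee_fin mulr_ge0 ?powR_ge0 ?mulr_ge0 ?lorentz_ge0.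
        under eq_integral do rewrite EFinM.
        by apply: integral_scale_le => [|x]; rewrite ?powR_ge0// lee_fin mulr_ge0 ?lorentz_ge0.
      apply: le_trans (integral_scale_le (powR_ge0 _ _) _) _.
        by move=> t; apply: integral_ge0 => x _; rewrite lee_fin mulr_ge0 ?lorentz_ge0.
      rewrite mulrCA -exprMn EFinM; apply: lee_wpmul2l; first by rewrite lee_fin powR_ge0.
      exact: integral2_lorentz_le (eps_gt0 y).
    move=> s y x t y4 z z1; have [v0 v2 vp vx vt] := common s y x t y4 z1.
    have zn := cnorm_le1 z1; have D0 := kdist_ge_eps y zn; have ep0 := eps_gt0 y.
    have Dd := kdist_ge_defect y zn.
    have T0 : 0 < 1 - sqnorm z by rewrite subr_gt0.
    have T2 : (1 - sqnorm z) / 2 <= kdist y (z 0 0).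
      by apply: le_trans Dd; rewrite ler_pM2r ?invr_gt0// lerD2l lerN2 cabs2_le_sqnorm.
    have hT := ratio_powR ep0 D0 T0 T2 alA al0.
    rewrite -/z in v0 v2 vp vx vt *.
    set v := eps y / kdist y (z 0 0) in v0 v2 vp vx vt hT *.
    apply: (@le_trans _ _ (v ^+ P * (eps y `^ al * (2 ^+ A / v ^+ A)))).
      by rewrite ler_wpM2l// exprn_ge0// ltW.
    have AP : (A <= P)%N by apply: leq_trans nP; rewrite leq_addl.
    have -> : v ^+ P * (eps y `^ al * (2 ^+ A / v ^+ A)) = v ^+ (P - A) * (eps y `^ al * 2 ^+ A).
      rewrite -{1}(subnK AP) exprD; field; exact/expf_neq0/lt0r_neq0.
    have kP : (2 * n + 2 + 2 <= P - A)%N by move: nP; clear; lia.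
    have vB : v ^+ (2 * n + 2 + 2) <= (4 ^+ (2 * n) * \prod_(i < 2 * n) hgt y (s i.+2)) *
       ((4 + 2 ^+ 2) * lorentz (eps y) 1 x) * ((4 + 2 ^+ 2) * lorentz (eps y) y^-1 t).
      rewrite (exprD v (2 * n + 2)) (exprD v (2 * n)); have e k : 0 <= v ^+ k by rewrite exprn_ge0// ltW.
      by apply: ler_pM => //; [exact: mulr_ge0|apply: ler_pM].
    have := exprn_split_le (ltW v0) v2 kP vB => h.
    apply: le_trans (ler_wpM2r _ h) _; first by rewrite mulr_ge0 ?powR_ge0 ?exprn_ge0.
    set pr := \prod_(_ < _) _.
    have pr0 : 0 <= pr by rewrite prodr_ge0// => i _; exact: lorentz_ge0.
    have pP : 2 ^+ (P - A) <= 2 ^+ P * 4 :> R.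
      rewrite -[leLHS]mulr1 ler_pM ?exprn_ge0//; last by lra.
      by rewrite ler_weXn2l ?leq_subr// ler1n.
    rewrite /K1; move: (lorentz_ge0 (eps y) 1 x) (lorentz_ge0 (eps y) y^-1 t) (powR_ge0 (eps y) al).
    move: (lorentz _ _ _) (lorentz _ _ _) (_ `^ _) => a b c a0 b0 c0.
    rewrite [leLHS](_ : _ = 2 ^+ (P - A) * (4 ^+ (2 * n) * (4 + 2 ^+ 2) * (4 + 2 ^+ 2) * 2 ^+ A * pr * a * b * c)); last by ring.
    rewrite [leRHS](_ : _ = 2 ^+ P * 4 * (4 ^+ (2 * n) * (4 + 2 ^+ 2) * (4 + 2 ^+ 2) * 2 ^+ A * pr * a * b * c)); last by ring.
    rewrite ler_wpM2r//; do 8! (apply: mulr_ge0 => //); rewrite ?exprn_ge0// addr_ge0// exprn_ge0.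
  pose q s := \sum_(i < 2 * n) s i.+2 ^+ 2 : R.
  exists (fun s y x t => if (0 < 1 - q s - t ^+ 2 - x ^+ 2)%R then
     (1 - q s - t ^+ 2 - x ^+ 2) `^ al * lorentz (eps y) 1 x * lorentz (eps y) y^-1 t * (1 + q s / eps y)^-1 else 0).
  exists ((2 / (al + 1) + pi) * (2 * pi + 56)).
  have qq s : 0 <= q s by apply: sumr_ge0 => i _; exact: sqr_ge0.
  have qi s y : 0 <= (1 + q s / eps y)^-1.
    by rewrite invr_ge0 addr_ge0// divr_ge0// ltW// eps_gt0.
  split.
  - by rewrite mulr_ge0// addr_ge0// ?mulr_ge0// invr_ge0; lra.
  - by move=> s y x t; case: ifP => // _; rewrite !mulr_ge0 ?powR_ge0 ?lorentz_ge0.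
  - move=> s y y4; have ep0 := eps_gt0 y.
    have y14 : `|y^-1| <= 4^-1.
      by rewrite ger0_norm ?invr_ge0 ?lef_pV2 ?posrE//; lra.
    have e01 : 0 < eps y <= 1 by rewrite ep0 eps_le1.
    apply: le_trans (integral2_singular_le al1 (ltW al0) y14 (qq s) e01) _.
    rewrite powRD; last by rewrite (gt_eqF ep0) implybT.
    rewrite (powRr1 (ltW ep0)).
    by rewrite lee_fin le_eqVlt; apply/orP; left; apply/eqP; ring.
  move=> s y x t y4 z z1; have [v0 v2 vp vx vt] := common s y x t y4 z1.
  have zn := cnorm_le1 z1; have D0 := kdist_ge_eps y zn; have ep0 := eps_gt0 y.
  have Dd := kdist_ge_defect y zn.
  have [zE xE tE q0 hs] := vec_of_upd_bounds s x t.
  rewrite -/z in v0 v2 vp vx vt *.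
  have TE : 1 - sqnorm z = 1 - q s - t ^+ 2 - x ^+ 2 by rewrite zE /q; ring.
  rewrite -TE subr_gt0 z1.
  have vq : eps y / kdist y (z 0 0) <= 4 * (1 + q s / eps y)^-1.
    apply: ratio_quad => //; apply: le_trans Dd; rewrite ler_pM2r ?invr_gt0//.
    by rewrite cabs2E xE tE; move: z1; rewrite zE /q; lra.
  set v := eps y / kdist y (z 0 0) in v0 v2 vp vx vt vq *.
  have kP : (2 * n + 2 + 2 + 1 <= P)%N by apply: leq_trans nP; rewrite leq_addr.
  have vB : v ^+ (2 * n + 2 + 2 + 1) <= (4 ^+ (2 * n) * \prod_(i < 2 * n) hgt y (s i.+2)) *
       ((4 + 2 ^+ 2) * lorentz (eps y) 1 x) * ((4 + 2 ^+ 2) * lorentz (eps y) y^-1 t) * (4 * (1 + q s / eps y)^-1).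
    rewrite (exprD v (2 * n + 2 + 2)) (exprD v (2 * n + 2)) (exprD v (2 * n)) expr1; have e k : 0 <= v ^+ k by rewrite exprn_ge0// ltW.
    apply: ler_pM => //; [by apply: mulr_ge0 => //; exact: mulr_ge0|by rewrite ltW|].
    by apply: ler_pM => //; [exact: mulr_ge0|apply: ler_pM].
  have := exprn_split_le (ltW v0) v2 kP vB => h.
  apply: le_trans (ler_wpM2r (powR_ge0 _ _) h) _.
  set pr := \prod_(_ < _) _.
  have pr0 : 0 <= pr by rewrite prodr_ge0// => i _; exact: lorentz_ge0.
  have A1 : 1 <= 2 ^+ A :> R by rewrite exprn_ege1// ler1n.
  rewrite /K1; move: (lorentz_ge0 (eps y) 1 x) (lorentz_ge0 (eps y) y^-1 t) (powR_ge0 (1 - sqnorm z) al) (qi s y).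
  move: (lorentz _ _ _) (lorentz _ _ _) (_ `^ _) ((1 + _)^-1) => a b c d a0 b0 c0 d0.
  rewrite [leLHS](_ : _ = 1 * (2 ^+ P * 4 ^+ (2 * n) * (4 + 2 ^+ 2) * (4 + 2 ^+ 2) * 4 * pr * a * b * c * d)); last by ring.
  rewrite [leRHS](_ : _ = 2 ^+ A * (2 ^+ P * 4 ^+ (2 * n) * (4 + 2 ^+ 2) * (4 + 2 ^+ 2) * 4 * pr * a * b * c * d)); last by ring.
  rewrite ler_wpM2r//; do 9! (apply: mulr_ge0 => //); rewrite ?exprn_ge0// addr_ge0// exprn_ge0.
clearbody K1; have bv := ball_vol_gt0 R n; have ca := c_alpha_gt0 al1.
exists (c_alpha n.+1 al * (K1 * K2 * pi ^+ (2 * n) / @ball_vol R n.+1)).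
  by rewrite mulr_ge0 ?(ltW ca)// divr_ge0 ?(ltW bv)// mulr_ge0 ?exprn_ge0// mulr_ge0.
move=> y M f y4 M0 hf; have ep0 := eps_gt0 y.
pose B := M * eps y `^ (- sg) * K1 * (K2 * (eps y `^ al * eps y ^+ 2)) * (pi * Num.sqrt (eps y)) ^+ (2 * n).
have -> : c_alpha n.+1 al * (K1 * K2 * pi ^+ (2 * n) / ball_vol R n.+1) * M = c_alpha n.+1 al * (B / ball_vol R n.+1).
  rewrite /B exprMn sqrt_epsX.
  have ea : sg = al + (2 + n)%:R by rewrite /sg natrD -natr1; ring.
  have := powR_eps_cancel y ea; rewrite exprD.
  move: (eps y ^+ 2) (eps y ^+ n) (eps y `^ al) (eps y `^ _) => c b a' a abc.
  rewrite (_ : M * a * K1 * (K2 * (a' * c)) * (pi ^+ (2 * n) * b) = M * K1 * K2 * pi ^+ (2 * n) * (a * a' * (c * b))); last by ring.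
  by rewrite abc; ring.
rewrite /A2norm2 [leRHS]EFinM; apply: lee_wpmul2l; first by rewrite lee_fin ltW.
apply: nu_int_le => [z|]; first by rewrite lee_fin mulr_ge0 ?cabs2_ge0 ?powR_ge0.
apply: (iint_sum_upper (h := hgt y) (K := M * eps y `^ (- sg) * K1) (g := fun s x t => g s y x t)).
- by move=> s; case: ifP => // _; rewrite lee_fin mulr_ge0 ?cabs2_ge0 ?powR_ge0.
- by rewrite mulr_ge0// mulr_ge0 ?powR_ge0.
- by rewrite mulr_ge0// mulr_ge0 ?powR_ge0// sqr_ge0.
- by move=> x; exact: lorentz_ge0.
- exact: measurable_lorentz.
- exact/integral_lorentz_le/sqrt_eps_gt0.
- by [].
- by move=> s; exact: hg.
move=> s x t; set s' := upd _ _ _.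
have pr0 : 0 <= \prod_(i < 2 * n) hgt y (s i.+2).
  by rewrite prodr_ge0// => i _; exact: lorentz_ge0.
case: ifPn => z1; last by rewrite lee_fin mulr_ge0// mulr_ge0// mulr_ge0// mulr_ge0 ?powR_ge0.
rewrite lee_fin.
apply: le_trans (ler_wpM2r (powR_ge0 _ _) (hf _ z1)) _.
rewrite -!mulrA ler_wpM2l// ler_wpM2l ?powR_ge0//.
by rewrite (mulrA K1); exact: (hgb s y x t y4 z1).
Qed.

End BergmanUpper.

(** * Siegel coordinates *)

Section Siegel.
Local Open Scope complex_scope.
Variables (R : realType) (n : nat).
Local Notation C := (Cx R).
Local Notation V := 'rV[C]_n.+1.
Implicit Types (z : V) (y : R).

(* Siegel coordinates: the ball becomes 2 Re v > 1 + |u|^2 and e1 goes to infinity. *)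
Definition sv z : C := (1 - z 0 0)^-1.
Definition su z (j : 'I_n) : C := z 0 (lift 0 j) * sv z.
Definition iy (y : R) : C := mkC 0 y.

(** For bounded w, |w + iy|^2 is comparable to y^2 and so to 1 / eps; this converts sizes between
    the original and the Siegel coordinates. *)
Lemma eps_cabs2_shift (B y : R) (w : C) : cnorm w <= B -> 8 * B + 8 <= y ->
  2^-1 <= eps y * cabs2 (w + iy y) <= 2.
Proof.
move=> wB yB.
have ha := le_trans (cRe_le w) wB; have hb := le_trans (cIm_le w) wB.
rewrite cabs2E cReD cImD /= addr0.
have e0 : 0 < 1 + y ^+ 2 by rewrite ltr_pwDl// sqr_ge0.
move: ha hb; rewrite !ler_norml.
move: (cRe w) (cIm w) => a b /andP[a1 a2] /andP[b1 b2].
have B0 : 0 <= B by lra.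
rewrite mulrC ler_pdivlMr// ler_pdivrMr//.
by apply/andP; split; nra.
Qed.

Lemma sqnorm_split z : sqnorm z = cabs2 (z 0 0) + \sum_(j < n) cabs2 (z 0 (lift 0 j)).
Proof. by rewrite sqnormE big_ord_recl. Qed.

Lemma cabs2M (a b : C) : cabs2 (a * b) = cabs2 a * cabs2 b.
Proof. by rewrite -!sqr_cnorm cnormM exprMn. Qed.

(** Multiply 1 - |z_1|^2 - |z'|^2 by |v|^2 and use z_1 v = v - 1. The imaginary part of v drops out,
    whence the invariance under v -> v + iy. *)
Lemma siegel_defect z : z 0 0 != 1 ->
  (1 - sqnorm z) * cabs2 (sv z) = 2 * cRe (sv z) - 1 - \sum_(j < n) cabs2 (su z j).
Proof.
move=> z1; have s0 : sv z != 0 by rewrite invr_neq0// subr_eq0 eq_sym.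
have -> : \sum_(j < n) cabs2 (su z j) = (\sum_(j < n) cabs2 (z 0 (lift 0 j))) * cabs2 (sv z).
  by rewrite mulr_suml; apply: eq_bigr => j _; rewrite cabs2M.
rewrite sqnorm_split opprD addrA mulrBl; congr (_ - _).
have h : z 0 0 * sv z = sv z - 1.
  by rewrite -{1}[z 0 0](subKr 1) mulrBl mul1r mulfV// subr_eq0 eq_sym.
rewrite mulrBl mul1r -cabs2M h !cabs2E cReD cImD cReN cImN.
have [-> ->] : cRe (1 : C) = 1 /\ cIm (1 : C) = 0 by [].
ring.
Qed.

(* [region] is a neighbourhood of the translate of z0 by iy in Siegel coordinates;
   [base] is that translate, and [near_base] is a box around it in the original
   coordinates, of the size eps x sqrt eps dictated by the geometry at e1. *)
Definition region (z0 : V) (y eta : R) z :=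
  [/\ z 0 0 != 1, cnorm (sv z - iy y - sv z0) <= eta &
      forall j, cnorm (su z j - su z0 j) <= eta].

Definition base (z0 : V) (y : R) : V :=
  \row_j if unlift 0 j is Some i then su z0 i / (sv z0 + iy y) else 1 - (sv z0 + iy y)^-1.

Definition near_base (z0 : V) (y c : R) z :=
  cnorm (z 0 0 - base z0 y 0 0) <= c * eps y /\
  forall j : 'I_n, cnorm (z 0 (lift 0 j) - base z0 y 0 (lift 0 j)) <= c * Num.sqrt (eps y).

(** With V = v(z0) + iy and d the offset of z_1 one has v - V = d V^2 / (1 - d V). As |V|^2 is of
    order 1 / eps, an offset c eps of z_1 moves v by O(c), and offsets c sqrt eps of the other
    coordinates move u by O(c). *)
Lemma near_base_region (z0 : V) (eta : R) : 0 < eta ->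
  exists c Y : R, [/\ 0 < c, 0 < Y & forall y z, Y <= y -> near_base z0 y c z -> region z0 y eta z].
Proof.
move=> eta0.
pose U := \sum_(j < n) cnorm (su z0 j).
have U0 : 0 <= U by apply: sumr_ge0 => j _; exact: cnorm_ge0.
have hU j : cnorm (su z0 j) <= U.
  by rewrite /U (bigD1 j)//= lerDl sumr_ge0// => i _; exact: cnorm_ge0.
have d0 : 0 < 8 * U + 7 by rewrite ltr_wpDl ?mulr_ge0.
(* v moves by at most 4 c and each u_j by at most 8 U c + 3 c; one condition covers both. *)
have [c [c0 c1 c2]] : exists c : R, [/\ 0 < c, c <= 4^-1 & c * (8 * U + 7) <= eta].
  exists (Num.min (4^-1) (eta / (8 * U + 7))); split.
  - by rewrite lt_min invr_gt0 ltr0n/= divr_gt0.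
  - by rewrite ge_min lexx.
  - by rewrite -ler_pdivlMr// ge_min lexx orbT.
exists c, (8 * cnorm (sv z0) + 8); split => //.
  by rewrite ltr_wpDl// mulr_ge0 ?cnorm_ge0.
move=> y z yY [h0 hj].
have /andP[W1 W2] := eps_cabs2_shift (lexx (cnorm (sv z0))) yY.
set Vv := sv z0 + iy y in W1 W2.
have ep0 := eps_gt0 y; have ep1 := eps_le1 y; have s0 := sqrt_eps_gt0 y.
have sgE : eps y = Num.sqrt (eps y) ^+ 2 by rewrite sqr_sqrtr// ltW.
set sg := Num.sqrt (eps y) in s0 hj sgE.
rewrite -sqr_cnorm sgE in W1 W2; rewrite sgE in h0 ep0 ep1.
have sg1 : sg <= 1 by rewrite -(@expr_le1 _ 2)// ltW.
have VV0 := cnorm_ge0 Vv.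
have VV : 0 < cnorm Vv.
  rewrite lt_neqAle VV0 andbT; apply/eqP => e; move: W1; rewrite -e expr0n/= mulr0; lra.
have V0 : Vv != 0 by rewrite -cnorm_gt0.
have sV : sg * cnorm Vv <= 2.
  by rewrite -(@ler_pXn2r _ 2) ?nnegrE ?mulr_ge0 ?(ltW s0)// exprMn; lra.
have sVl : 2^-1 <= sg * cnorm Vv.
  by rewrite -(@ler_pXn2r _ 2) ?nnegrE ?mulr_ge0 ?(ltW s0) ?invr_ge0// exprMn; lra.
have V1 : 2^-1 <= cnorm Vv by nra.
pose d := z 0 0 - (1 - Vv^-1).
have hd : cnorm d <= c * sg ^+ 2 by move: h0; rewrite mxE unlift_none.
have dd0 := cnorm_ge0 d.
have hdV : cnorm (d * Vv) <= 2^-1.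
  rewrite cnormM; apply: (@le_trans _ _ (c * sg ^+ 2 * cnorm Vv)).
    by rewrite ler_wpM2r.
  have -> : c * sg ^+ 2 * cnorm Vv = (c * sg) * (sg * cnorm Vv) by ring.
  have : c * sg <= 4^-1 by nra.
  have : 0 <= c * sg by rewrite mulr_ge0 ?ltW.
  by move: (c * sg) (sg * _) sV sVl => a b; nra.
have oneE : 1 - z 0 0 = Vv^-1 * (1 - d * Vv).
  by rewrite /d; field.
have nz : 2^-1 <= cnorm (1 - d * Vv).
  by apply: le_trans (cnormBl _ _); rewrite cnorm1; lra.
have nz0 : 1 - d * Vv != 0 by rewrite -cnorm_gt0; lra.
have z1 : z 0 0 != 1.
  by rewrite eq_sym -subr_eq0 oneE mulf_neq0 ?invr_eq0.
have svE : sv z - Vv = d * Vv ^+ 2 / (1 - d * Vv).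
  by rewrite /sv oneE; field; rewrite V0 nz0.
have hsv : cnorm (sv z - Vv) <= 4 * c.
  rewrite svE cnormM cnormV cnormM cnormX ler_pdivrMr; last by lra.
  have : cnorm d * cnorm Vv ^+ 2 <= c * (sg ^+ 2 * cnorm Vv ^+ 2).
    by rewrite [leRHS]mulrA ler_wpM2r ?sqr_ge0.
  have : c * (sg ^+ 2 * cnorm Vv ^+ 2) <= c * 2 by rewrite ler_wpM2l// ltW.
  by nra.
have cU : 0 <= c * U by rewrite mulr_ge0// ltW.
split => //.
  have -> : sv z - iy y - sv z0 = sv z - Vv by rewrite /Vv; ring.
  by apply: (le_trans hsv); lra.
move=> j.
pose dj := z 0 (lift 0 j) - su z0 j / Vv.
have hdj : cnorm dj <= c * sg by move: (hj j); rewrite mxE liftK.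
have -> : su z j - su z0 j = su z0 j * (sv z - Vv) / Vv + dj * (Vv + (sv z - Vv)).
  by rewrite /dj {1}/su; field.
apply: le_trans (cnormD _ _) _.
rewrite (cnormM (su z0 j * _)) (cnormM (su z0 j)) (cnormM dj) cnormV.
have h1 : cnorm (su z0 j) * cnorm (sv z - Vv) / cnorm Vv <= U * (4 * c) * 2.
  rewrite ler_pdivrMr//.
  have : cnorm (su z0 j) * cnorm (sv z - Vv) <= U * (4 * c).
    by apply: ler_pM; rewrite ?cnorm_ge0.
  have : 0 <= U * (4 * c) by rewrite !mulr_ge0// ltW.
  by move: (U * (4 * c)) => a; nra.
have h2 : cnorm dj * cnorm (Vv + (sv z - Vv)) <= c * sg * (cnorm Vv + 4 * c).
  apply: ler_pM; rewrite ?cnorm_ge0//.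
  by apply: le_trans (cnormD _ _) _; rewrite lerD2l.
apply: (le_trans (lerD h1 h2)).
have h3 : c * sg * (cnorm Vv + 4 * c) <= c * 3.
  rewrite -mulrA ler_wpM2l ?(ltW c0)//.
  have : sg * (4 * c) <= 1 by nra.
  by rewrite mulrDr; lra.
by apply: (le_trans (lerD (lexx _) h3)); lra.
Qed.

(** By [siegel_defect] the product (1 - |z|^2) |v|^2 depends only on u and Re v, so on the region it
    stays near its value rho at z0, whatever y; and |v|^2 is of order 1 / eps there. *)
Lemma region_defect (z0 : V) : sqnorm z0 < 1 ->
  exists eta Y t1 t2 : R, [/\ 0 < eta, 0 < Y, 0 < t1, 0 < t2 &
    forall y z, Y <= y -> region z0 y eta z -> t1 * eps y <= 1 - sqnorm z <= t2 * eps y].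
Proof.
move=> z01.
have zz : z0 0 0 != 1.
  apply/eqP => e; have := cabs2_le_sqnorm z0 0.
  by rewrite e -sqr_cnorm cnorm1 expr1n; lra.
pose U := \sum_(j < n) cnorm (su z0 j).
have U0 : 0 <= U by apply: sumr_ge0 => j _; exact: cnorm_ge0.
have s0 : sv z0 != 0 by rewrite invr_neq0// subr_eq0 eq_sym.
pose rho := 2 * cRe (sv z0) - 1 - \sum_(j < n) cabs2 (su z0 j).
have rho0 : 0 < rho.
  by rewrite /rho -siegel_defect// mulr_gt0 ?subr_gt0// -sqr_cnorm exprn_gt0// cnorm_gt0.
(* A perturbation by eta changes 2 Re v by at most 2 eta and each |u_j|^2 by at most eta (2
   |u_j(z0)| + 1). *)
pose m := 2 + 2 * U + n%:R.
have m0 : 0 < m by rewrite /m ltr_wpDr ?ler0n// ltr_wpDr// mulr_ge0.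
have [eta [eta0 eta1 etam]] : exists eta : R, [/\ 0 < eta, eta <= 1 & eta * m <= rho / 2].
  exists (Num.min 1 (rho / (2 * m))); split.
  - by rewrite lt_min ltr01 divr_gt0// mulr_gt0.
  - by rewrite ge_min lexx.
  - rewrite -ler_pdivlMr// ge_min; apply/orP; right.
    by rewrite le_eqVlt; apply/orP; left; apply/eqP; field; rewrite gt_eqF.
exists eta, (8 * (cnorm (sv z0) + 1) + 8), (rho / 4), (3 * rho); split => //.
- by rewrite ltr_wpDl// mulr_ge0// addr_ge0// cnorm_ge0.
- by rewrite divr_gt0.
- by rewrite mulr_gt0.
move=> y z yY [z1 hv hu].
have svE : sv z = (sv z - iy y) + iy y by ring.
have hw : cnorm (sv z - iy y) <= cnorm (sv z0) + 1.
  have -> : sv z - iy y = sv z0 + (sv z - iy y - sv z0) by ring.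
  by apply: le_trans (cnormD _ _) _; rewrite lerD2l (le_trans hv).
have := eps_cabs2_shift hw yY; rewrite -svE => /andP[W1 W2].
have := siegel_defect z1.
set S := \sum_(j < n) _; set T := 1 - sqnorm z => TE.
have hS : `|S - \sum_(j < n) cabs2 (su z0 j)| <= eta * (2 * U + n%:R).
  rewrite /S -sumrB; apply: le_trans (ler_norm_sum _ _ _) _.
  have -> : eta * (2 * U + n%:R) = \sum_(j < n) (eta * (2 * cnorm (su z0 j) + 1)).
    by rewrite -mulr_sumr big_split/= sumr_const card_ord -mulr_sumr.
  apply: ler_sum => j _; rewrite -!sqr_cnorm subr_sqr normrM.
  have := hu j; have := cnorm_ge0 (su z j); have := cnorm_ge0 (su z0 j).
  have h1 := cnormBl (su z j) (su z0 j); have h2 := cnormBl (su z0 j) (su z j).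
  rewrite (cnormC (su z0 j)) in h2.
  move: (cnorm (su z j - su z0 j)) (cnorm (su z0 j)) (cnorm (su z j)) h1 h2 => d b a h1 h2 b0 a0 d1.
  have ab : `|a - b| <= eta by rewrite ler_norml; apply/andP; split; lra.
  rewrite (ger0_norm (addr_ge0 a0 b0)).
  by apply: ler_pM => //; [exact: addr_ge0|lra].
have hR : `|cRe (sv z) - cRe (sv z0)| <= eta.
  apply: le_trans hv; apply: le_trans (cRe_le _).
  by rewrite !cReD !cReN /= oppr0 addr0.
have hT : rho / 2 <= T * cabs2 (sv z) <= 3 / 2 * rho.
  rewrite TE; move: hS hR; rewrite !ler_norml => /andP[S1 S2] /andP[R1 R2].
  have e1 : eta * m = 2 * eta + eta * (2 * U + n%:R) by rewrite /m; ring.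
  rewrite e1 /rho in etam; rewrite /rho.
  by apply/andP; split; lra.
case/andP: hT => T1 T2; clearbody rho.
have c0 : 0 < cabs2 (sv z).
  by rewrite -sqr_cnorm exprn_gt0// cnorm_gt0 invr_neq0// subr_eq0 eq_sym.
have ep0 := eps_gt0 y.
move: (cabs2 (sv z)) (eps y) T W1 W2 T1 T2 c0 ep0 {TE hv} => w e T W1 W2 T1 T2 c0 ep0.
have h1 : T * w * e <= 3 / 2 * rho * e by rewrite ler_pM2r.
have h2 : rho / 2 * e <= T * w * e by rewrite ler_pM2r.
have T0 : 0 < T by rewrite -(pmulr_lgt0 _ c0); apply: lt_le_trans T1; rewrite divr_gt0.
have h3 : T * (e * w) <= T * 2 by rewrite ler_wpM2l// ltW.
have h4 : T * 2^-1 <= T * (e * w) by rewrite ler_wpM2l// ltW.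
by apply/andP; split; lra.
Qed.

End Siegel.

(** * Lower bounds for the norms *)

Section NormLower.
Local Open Scope complex_scope.
Variables (R : realType) (n : nat).
Local Notation C := (Cx R).
Local Notation V := 'rV[C]_n.+1.
Implicit Types (z : V) (y : R) (f : V -> C) (s : nat -> R).

Definition slanted_box (m : R -> R) (c l : nat -> R) s :=
  `|s 0%N - m (s 1%N)| <= l 0%N /\
  forall i, (1 <= i < (2 * n).+2)%N -> `|s i - c i| <= l i.

Lemma nu_int_ge (g : V -> \bar R) m c l (k : R) : (forall z, 0 <= g z)%E -> 0 <= k ->
  (forall i, 0 <= l i) ->
  (forall s, slanted_box m c l s -> sqnorm (vec_of n.+1 s) < 1 /\ (k%:E <= g (vec_of n.+1 s))%E) ->
  ((k * \prod_(i < (2 * n).+2) (2 * l i) / @ball_vol R n.+1)%:E <= nu_int g)%E.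
Proof.
move=> g0 k0 l0 h; rewrite nu_intE EFinM; apply: lee_pmul.
- by rewrite lee_fin mulr_ge0// prodr_ge0// => i _; rewrite mulr_ge0.
- by rewrite lee_fin invr_ge0 ltW// ball_vol_gt0.
- apply: (iint_lower (m := m) (c := c)) => // [s|s h0 h1]; first by case: ifP.
  by have [-> ] := h s (conj h0 h1).
- by [].
Qed.

Lemma bergman_lower (al : R) f m c l (k : R) : -1 < al -> 0 <= k -> (forall i, 0 <= l i) ->
  (forall s, slanted_box m c l s -> let z := vec_of n.+1 s in
      sqnorm z < 1 /\ k <= cabs2 (f z) * (1 - sqnorm z) `^ al) ->
  ((c_alpha n.+1 al * (k * \prod_(i < (2 * n).+2) (2 * l i) / @ball_vol R n.+1))%:E <= A2norm2 al f)%E.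
Proof.
move=> al1 k0 l0 h; rewrite /A2norm2 [leLHS]EFinM; apply: lee_wpmul2l.
  by rewrite lee_fin ltW// c_alpha_gt0.
apply: (nu_int_ge (m := m) (c := c)) => // z.
by rewrite lee_fin mulr_ge0 ?cabs2_ge0 ?powR_ge0.
Qed.

Lemma hardy_lower (r : R) f m c l (k : R) : 0 < r < 1 -> 0 <= k -> (forall i, 0 <= l i) ->
  (forall s, slanted_box m c l s -> let z := vec_of n.+1 s in
      sqnorm z < 1 /\ k <= cabs2 (f (RtoC r *: (RtoC (Num.sqrt (sqnorm z))^-1 *: z)))) ->
  ((k * \prod_(i < (2 * n).+2) (2 * l i) / @ball_vol R n.+1)%:E <= H2norm2 f)%E.
Proof.
move=> r01 k0 l0 h; apply: (@le_trans _ _ (sigma_int (fun zeta : V => (cabs2 (f (RtoC r *: zeta)))%:E))).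
  apply: (nu_int_ge (m := m) (c := c)) => // z.
  by rewrite lee_fin cabs2_ge0.
by apply: ereal_sup_ubound; exists r.
Qed.

(** Errors are tracked coordinate by coordinate because the boxes are anisotropic. The error of the
    radial rescaling is proportional to p_j and governed by E, which bounds the change of |z|^2; the
    deviation from the ray is only multiplied by a constant. *)
Lemma radial_projection (r lam E : R) (p z : V) : 0 < r -> 0 < lam -> sqnorm p = r ^+ 2 ->
  \sum_j cnorm (z 0 j - RtoC lam * p 0 j) *
     (2 * lam * cnorm (p 0 j) + cnorm (z 0 j - RtoC lam * p 0 j)) <= E ->
  E <= (lam * r) ^+ 2 / 2 ->
  sqnorm z <= 3 / 2 * (lam * r) ^+ 2 /\
  forall j, cnorm ((RtoC r *: (RtoC (Num.sqrt (sqnorm z))^-1 *: z)) 0 j - p 0 j) <=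
    2 * E / (lam * r) ^+ 2 * cnorm (p 0 j) + 2 / lam * cnorm (z 0 j - RtoC lam * p 0 j).
Proof.
move=> r0 lam0 pr hE hE2.
have lr0 : 0 < lam * r by rewrite mulr_gt0.
have XE : `|sqnorm z - (lam * r) ^+ 2| <= E.
  apply: le_trans hE; rewrite exprMn -pr !sqnormE mulr_sumr -sumrB.
  apply: le_trans (ler_norm_sum _ _ _) _; apply: ler_sum => j _.
  set d := z 0 j - _; have zE : z 0 j = RtoC lam * p 0 j + d by rewrite /d; ring.
  have h1 := cnormBl (z 0 j) (RtoC lam * p 0 j).
  have h2 := cnormBl (RtoC lam * p 0 j) (z 0 j).
  rewrite (cnormC (RtoC lam * _)) in h2.
  have h3 : cnorm (z 0 j) <= lam * cnorm (p 0 j) + cnorm d.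
    by rewrite zE (le_trans (cnormD _ _))// cnormM cnorm_RtoC gtr0_norm.
  have h4 : cnorm (RtoC lam * p 0 j) = lam * cnorm (p 0 j).
    by rewrite cnormM cnorm_RtoC gtr0_norm.
  rewrite -!sqr_cnorm -exprMn -h4 subr_sqr normrM.
  apply: ler_pM; rewrite ?normr_ge0//.
    by rewrite ler_norml; apply/andP; split; rewrite /d; lra.
  by rewrite ger0_norm ?addr_ge0 ?cnorm_ge0//; lra.
move: XE; rewrite ler_norml => /andP[X1 X2].
split; first by lra.
set X := Num.sqrt _.
have XX : X ^+ 2 = sqnorm z by rewrite sqr_sqrtr// sqnorm_ge0.
have X0 : 0 <= X by exact: sqrtr_ge0.
have Xl : lam * r / 2 <= X.
  rewrite -(@ler_pXn2r _ 2) ?nnegrE ?divr_ge0 ?(ltW lr0)// XX.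
  by rewrite exprMn; have := sqr_ge0 (lam * r); move: ((lam * r) ^+ 2) X1 hE2 => a; lra.
have Xp : 0 < X by apply: lt_le_trans Xl; rewrite divr_gt0.
have dX : `|lam * r - X| <= E / (lam * r).
  rewrite ler_pdivlMr//.
  have h : `|lam * r - X| * (lam * r + X) <= E.
    rewrite -[lam * r + X]ger0_norm ?addr_ge0 ?(ltW lr0)// -normrM -subr_sqr XX.
    by rewrite ler_norml; apply/andP; split; lra.
  apply: le_trans h; rewrite ler_wpM2l ?normr_ge0//; lra.
move=> j.
have -> : (RtoC r *: (RtoC X^-1 *: z)) 0 j - p 0 j =
    RtoC ((lam * r - X) / X) * p 0 j + RtoC (r / X) * (z 0 j - RtoC lam * p 0 j).
  rewrite !mxE mulrA -RtoCM mulrBr mulrA -RtoCM.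
  have -> : (lam * r - X) / X = r / X * lam + (- 1) by field; rewrite gt_eqF.
  rewrite RtoCD mulrDl.
  have -> : RtoC (-1) = -1 :> C by apply: complex_ext; rewrite /cRe /cIm//= oppr0.
  ring.
apply: le_trans (cnormD _ _) _; rewrite !cnormM !cnorm_RtoC.
apply: lerD.
  rewrite ler_wpM2r ?cnorm_ge0// normrM normfV (gtr0_norm Xp).
  rewrite ler_pdivrMr//; apply: (le_trans dX).
  have E0 : 0 <= E by have := normr_ge0 (lam * r - X); move/le_trans/(_ dX); rewrite pmulr_lge0 ?invr_gt0.
  have -> : E / (lam * r) = 2 * E / (lam * r) ^+ 2 * (lam * r / 2) by field; rewrite !gt_eqF.
  by rewrite ler_wpM2l//; apply: divr_ge0; [exact: mulr_ge0|exact: sqr_ge0].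
rewrite ler_wpM2r ?cnorm_ge0// ger0_norm ?divr_ge0 ?(ltW r0)//.
rewrite ler_pdivrMr//; have e : r = 2 / lam * (lam * r / 2) by field; rewrite gt_eqF.
by rewrite {1}e ler_wpM2l// divr_ge0// ltW.
Qed.

(** The Hardy box is cut along the ray through [base], so the slope Im p_1 / Re p_1 must be known up
    to constants. It is of order sqrt eps, since p_1 = 1 - 1 / V with V = v(z0) + iy. *)
Lemma base_bounds (z0 : V) : sqnorm z0 < 1 ->
  exists K Y : R, [/\ 0 <= K, 4 <= Y & forall y, Y <= y -> let p := base z0 y in
    let sg := Num.sqrt (eps y) in
    [/\ 2^-1 <= cRe (p 0 0), sg / 8 <= cIm (p 0 0) <= 2 * sg,
        forall j : 'I_n, cnorm (p 0 (lift 0 j)) <= K * sg & 4^-1 <= sqnorm p < 1]].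
Proof.
move=> z01.
have [eta [Y1 [t1 [t2 [eta0 Y10 t10 t20 hreg]]]]] := region_defect z01.
pose U := \sum_(j < n) cnorm (su z0 j).
have U0 : 0 <= U by apply: sumr_ge0 => j _; exact: cnorm_ge0.
have hU j : cnorm (su z0 j) <= U.
  by rewrite /U (bigD1 j)//= lerDl sumr_ge0// => i _; exact: cnorm_ge0.
have cv := cnorm_ge0 (sv z0).
exists (2 * U), (Y1 + (8 * cnorm (sv z0) + 8)); split; [by rewrite mulr_ge0|lra|].
move=> y yY p sg.
have yY1 : Y1 <= y by lra.
have yY2 : 8 * cnorm (sv z0) + 8 <= y by lra.
have /andP[W1 W2] := eps_cabs2_shift (lexx (cnorm (sv z0))) yY2.
set Vv := sv z0 + iy y in W1 W2.
have ep0 := eps_gt0 y; have s0 : 0 < sg := sqrt_eps_gt0 y.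
have sgE : eps y = sg ^+ 2 by rewrite sqr_sqrtr// ltW.
have VV0 := cnorm_ge0 Vv.
have c0 : 0 < cabs2 Vv.
  by rewrite lt_neqAle cabs2_ge0 andbT; apply/eqP => e; move: W1; rewrite -e mulr0; lra.
have V0 : Vv != 0 by rewrite -cnorm_gt0 sqrtr_gt0.
have p0 : p 0 0 = 1 - Vv^-1 by rewrite mxE unlift_none.
have iV : cnorm Vv^-1 <= 2 * sg.
  rewrite cnormV -(@ler_pXn2r _ 2) ?nnegrE ?invr_ge0 ?mulr_ge0 ?(ltW s0)// exprVn sqr_cnorm exprMn -sgE.
  by rewrite -div1r ler_pdivrMr//; lra.
have y8 : 8 <= y by lra.
have sg4 : sg <= 8^-1.
  rewrite -(@ler_pXn2r _ 2) ?nnegrE ?(ltW s0) ?invr_ge0// -sgE.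
  rewrite /eps exprVn lef_pV2 ?posrE ?ltr_pwDl ?sqr_ge0 ?exprn_gt0//; nra.
have p12 : 2^-1 <= cRe (p 0 0).
  rewrite p0 cReD cReN; have := le_trans (ler_norm _) (le_trans (cRe_le Vv^-1) iV).
  by have -> : cRe (1 : C) = 1 by []; lra.
split => //.
- rewrite p0 cImD cImN /= add0r; apply/andP; split; last first.
    by rewrite (le_trans _ iV)// (le_trans _ (cIm_le _))// -normrN ler_norm.
  rewrite cImV opprK ler_pdivlMr//.
  have hy : y / 2 <= cIm Vv.
    rewrite cImD; have := cIm_le (sv z0); rewrite ler_norml => /andP[h1 h2].
    have -> : cIm (iy y) = y by []; lra.
  have ys : 2^-1 <= y * sg.
    have y0 : 0 <= y by lra.
    rewrite -(@ler_pXn2r _ 2) ?nnegrE ?mulr_ge0 ?(ltW s0) ?invr_ge0// exprMn -sgE.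
    have := epsK y; rewrite mulrDr mulr1 => e; have := eps_le1 y; have : eps y <= 2^-1 by rewrite sgE; nra.
    by move: (y ^+ 2) (eps y) e => a b e; nra.
  apply: le_trans hy; rewrite -(ler_pM2l s0).
  have -> : sg * (sg / 8 * cabs2 Vv) = eps y * cabs2 Vv / 8 by rewrite sgE; ring.
  by lra.
- move=> j; rewrite mxE liftK cnormM -/Vv.
  by rewrite mulrAC mulrC ler_pM ?cnorm_ge0 ?hU ?mulr_ge0 ?(ltW s0)// mulrC.
- apply/andP; split.
    apply: le_trans (cabs2_le_sqnorm _ 0); rewrite cabs2E.
    by have := sqr_ge0 (cIm (p 0 0)); nra.
  have pr : region z0 y eta p.
    have svp : sv p = Vv by rewrite /sv p0 subKr invrK.
    split.
    - by rewrite p0 -subr_eq0 addrAC subrr add0r oppr_eq0 invr_eq0.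
    - by rewrite svp /Vv (_ : _ - _ = 0) ?cnorm0 ?(ltW eta0)//; ring.
    - move=> j; rewrite /su svp mxE liftK divfK// subrr cnorm0 ltW//.
  have /andP[h _] := hreg _ _ yY1 pr.
  rewrite -subr_gt0; apply: lt_le_trans h; by rewrite mulr_gt0.
Qed.

End NormLower.

(** * Lower bounds near a fixed point of the ball *)

Section BoxLower.
Local Open Scope complex_scope.
Variables (R : realType) (n : nat).
Local Notation C := (Cx R).
Local Notation V := 'rV[C]_n.+1.
Implicit Types (z : V) (y : R) (f : V -> C) (s : nat -> R).

Definition rcoord (p : V) (i : nat) : R :=
  if odd i then cIm (p 0 (inord i./2)) else cRe (p 0 (inord i./2)).

Lemma coord_even p (j : 'I_n.+1) : rcoord p (2 * j) = cRe (p 0 j).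
Proof. by rewrite /rcoord oddM/= mul2n doubleK inord_val. Qed.

Lemma coord_odd p (j : 'I_n.+1) : rcoord p (2 * j + 1) = cIm (p 0 j).
Proof.
rewrite /rcoord oddD oddM/= addn1 mul2n.
by rewrite (half_bit_double j true) inord_val.
Qed.

Lemma vec_coord_le (p : V) s (j : 'I_n.+1) (d : R) :
  `|s (2 * j)%N - rcoord p (2 * j)| <= d -> `|s (2 * j + 1)%N - rcoord p (2 * j + 1)| <= d ->
  cnorm (vec_of n.+1 s 0 j - p 0 j) <= 2 * d.
Proof.
rewrite coord_even coord_odd mxE => h1 h2; apply: le_trans (cnorm_le _) _.
by rewrite cReD cImD cReN cImN mulr_natl mulr2n lerD.
Qed.

Lemma powR_between (al a b t : R) : 0 < a -> a <= t <= b ->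
  Num.min (a `^ al) (b `^ al) <= t `^ al.
Proof.
move=> a0 /andP[at_ tb]; have t0 := lt_le_trans a0 at_.
have [al0|al0] := leP 0 al.
  by rewrite ge_min ge0_ler_powR ?nnegrE ?(ltW a0) ?(ltW t0).
rewrite ge_min; apply/orP; right.
rewrite -[al]opprK !(powRN _ (- al)) lef_pV2 ?posrE ?powR_gt0//; last exact: lt_le_trans tb.
by rewrite ge0_ler_powR ?nnegrE ?oppr_ge0 ?(ltW al0) ?(ltW t0)// (le_trans (ltW t0)).
Qed.

Lemma sqnorm_close (z p : V) (d : R) : d <= 1 -> sqnorm p < 1 ->
  (forall j, cnorm (z 0 j - p 0 j) <= d) ->
  `|sqnorm z - sqnorm p| <= 3 * n.+1%:R * d.
Proof.
move=> d1 p1 h; rewrite !sqnormE -sumrB; apply: le_trans (ler_norm_sum _ _ _) _.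
have -> : 3 * n.+1%:R * d = \sum_(j < n.+1) (d * 3).
  by rewrite sumr_const card_ord -[RHS]mulr_natr; ring.
apply: ler_sum => j _; rewrite -!sqr_cnorm subr_sqr normrM.
have pj : cnorm (p 0 j) <= 1.
  rewrite -(@ler_pXn2r _ 2) ?nnegrE ?cnorm_ge0// sqr_cnorm expr1n.
  exact: le_trans (cabs2_le_sqnorm _ _) (ltW p1).
have h1 := cnormBl (z 0 j) (p 0 j); have h2 := cnormBl (p 0 j) (z 0 j).
rewrite (cnormC (p 0 j)) in h2; have hj := h j.
apply: ler_pM; rewrite ?normr_ge0//.
  by rewrite ler_norml; apply/andP; split; lra.
by rewrite ger0_norm ?addr_ge0 ?cnorm_ge0//; lra.
Qed.

Lemma sqnorm_radial (r : R) z : 0 <= r < 1 ->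
  sqnorm (RtoC r *: (RtoC (Num.sqrt (sqnorm z))^-1 *: z)) < 1.
Proof.
move=> /andP[r0 r1]; rewrite !sqnorm_scale; apply: (@le_lt_trans _ _ (r ^+ 2)); last first.
  by rewrite expr_lt1.
rewrite ler_piMr ?sqr_ge0//; set X := Num.sqrt _.
have <- : X ^+ 2 = sqnorm z by rewrite sqr_sqrtr// sqnorm_ge0.
rewrite -exprMn; have [->|X0] := eqVneq X 0; first by rewrite mulr0 expr0n.
by rewrite mulVf// expr1n.
Qed.

Definition straight_box (p : V) (l : nat -> R) s :=
  forall i, (i < (2 * n).+2)%N -> `|s i - rcoord p i| <= l i.

Lemma slanted_straight p l s : slanted_box n (fun=> rcoord p 0) (rcoord p) l s -> straight_box p l s.
Proof. by move=> [h0 h1] [|i] // hi; exact: h1. Qed.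

Lemma straight_close p (d : R) s : straight_box p (fun=> d) s ->
  forall j, cnorm (vec_of n.+1 s 0 j - p 0 j) <= 2 * d.
Proof.
move=> h j; have := ltn_ord j => jn.
by apply: vec_coord_le; apply: h; lia.
Qed.

(** Identifies the norm limit: it must be small wherever the approximating functions are. The origin
    is excluded because the Hardy norm is tested on the sphere through [z0], whose radius must be
    positive. *)
Definition local_lower (nrm2 : (V -> C) -> \bar R) :=
  forall z0, sqnorm z0 < 1 -> z0 != 0 -> forall d : R, 0 < d ->
  exists2 c : R, 0 < c & forall f (k : R), 0 <= k ->
    (forall z, sqnorm z < 1 -> (forall j, cnorm (z 0 j - z0 0 j) <= d) -> k <= cabs2 (f z)) ->
    ((c * k)%:E <= nrm2 f)%E.

(** The counterpart on boxes that shrink towards e1: a peak of height eps^(-sg) on them keeps the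
    norm bounded below uniformly in y. *)
Definition box_lower (sg : R) (nrm2 : (V -> C) -> \bar R) :=
  forall z0, sqnorm z0 < 1 -> forall c : R, 0 < c ->
  exists c' Y : R, 0 < c' /\ forall y f (k : R), Y <= y -> 0 <= k ->
    (forall z, sqnorm z < 1 -> near_base z0 y c z -> k * eps y `^ (- sg) <= cabs2 (f z)) ->
    ((c' * k)%:E <= nrm2 f)%E.

Lemma prod_const_gt0 (d : R) k : 0 < d -> 0 < \prod_(i < k) (2 * d).
Proof. by move=> d0; apply: prodr_gt0 => i _; rewrite mulr_gt0. Qed.

Lemma bergman_local (al : R) : -1 < al -> local_lower (@A2norm2 R n.+1 al).
Proof.
move=> al1 z0 z01 _ d d0.
have T0 : 0 < 1 - sqnorm z0 by rewrite subr_gt0.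
have N0 : 0 < n.+1%:R :> R by rewrite ltr0n.
have [e [e0 e1 e2 e3]] : exists e : R, [/\ 0 < e, 2 * e <= 1, 2 * e <= d & 3 * n.+1%:R * (2 * e) <= (1 - sqnorm z0) / 2].
  exists (Num.min (2^-1) (Num.min (d / 2) ((1 - sqnorm z0) / (12 * n.+1%:R)))).
  set a := (1 - _) / (12 * _); have a0 : 0 < a by rewrite divr_gt0 ?mulr_gt0.
  have ha : 12 * n.+1%:R * a = 1 - sqnorm z0 by rewrite mulrC /a divfK// gt_eqF// mulr_gt0.
  set e := Num.min _ _.
  have h1 : e <= 2^-1 by rewrite ge_min lexx.
  have h2 : e <= d / 2 by rewrite !ge_min lexx orbT.
  have h3 : e <= a by rewrite !ge_min lexx !orbT.
  split; [|lra|lra|].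
    by rewrite !lt_min a0 invr_gt0 ltr0n divr_gt0.
  have : n.+1%:R * e <= n.+1%:R * a by rewrite ler_pM2l.
  lra.
pose w := Num.min (((1 - sqnorm z0) / 2) `^ al) ((3 / 2 * (1 - sqnorm z0)) `^ al).
have w0 : 0 < w by rewrite lt_min !powR_gt0// ?mulr_gt0 ?invr_gt0.
have ca := c_alpha_gt0 n al1; have bv := ball_vol_gt0 R n.
exists (c_alpha n.+1 al * (w * \prod_(i < (2 * n).+2) (2 * e) / @ball_vol R n.+1)).
  by rewrite mulr_gt0// divr_gt0// mulr_gt0// prod_const_gt0.
move=> f k k0 hf.
have -> : c_alpha n.+1 al * (w * \prod_(i < (2 * n).+2) (2 * e) / @ball_vol R n.+1) * k =
  c_alpha n.+1 al * ((k * w) * \prod_(i < (2 * n).+2) (2 * e) / @ball_vol R n.+1) by ring.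
apply: (bergman_lower (m := fun=> rcoord z0 0) (c := rcoord z0) (l := fun=> e)) => //.
- by rewrite mulr_ge0// ltW.
- by move=> _; rewrite ltW.
move=> s /slanted_straight/straight_close hs z.
have := sqnorm_close e1 z01 hs; rewrite -/z ler_norml => /andP[z1 z2].
have zb : sqnorm z < 1 by lra.
split => //; apply: ler_pM => //; first exact: ltW.
  by apply: hf => // j; apply: le_trans e2.
by apply: powR_between; [rewrite divr_gt0|apply/andP; split; lra].
Qed.

Lemma RtoC1 : RtoC 1 = 1 :> C.
Proof. exact: complex_ext. Qed.

Lemma hardy_local : local_lower (@H2norm2 R n.+1).
Proof.
move=> z0 z01 z00 d d0.
have T0 : 0 < 1 - sqnorm z0 by rewrite subr_gt0.
have N0 : 1 <= n.+1%:R :> R by rewrite ler1n.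
pose r := Num.sqrt (sqnorm z0).
have r2 : sqnorm z0 = r ^+ 2 by rewrite sqr_sqrtr// sqnorm_ge0.
have sz : 0 < sqnorm z0.
  rewrite lt_neqAle sqnorm_ge0 andbT eq_sym; apply: contraNneq z00 => e.
  apply/eqP/rowP => j; rewrite mxE; apply/eqP; rewrite -cnorm_eq0.
  have := cabs2_le_sqnorm z0 j; rewrite e -sqr_cnorm => h.
  have : cnorm (z0 0 j) ^+ 2 == 0 by rewrite eq_le h sqr_ge0.
  by rewrite sqrf_eq0.
have r0 : 0 < r by rewrite sqrtr_gt0.
have r1 : r < 1 by rewrite -(@expr_lt1 _ 2) ?(ltW r0)// -r2.
have r01 : 0 < r < 1 by rewrite r0.
have rr0 : 0 < r ^+ 2 by rewrite exprn_gt0.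
(* The expression 3 N (2 e) bounds the change of |z|^2 on the cube; the last condition is the
   displacement that [radial_projection] yields with factor 1. *)
have [e [e0 e1 e3 e4 e5]] : exists e : R, [/\ 0 < e, 2 * e <= 1,
   3 * n.+1%:R * (2 * e) <= (1 - sqnorm z0) / 2,
   3 * n.+1%:R * (2 * e) <= r ^+ 2 / 2 &
   2 * (3 * n.+1%:R * (2 * e)) / r ^+ 2 + 4 * e <= d].
  have pos (M : R) (b : R) : 0 < M -> 0 < b -> exists2 a : R, 0 < a & forall e, 0 < e -> e <= a -> M * e <= b.
    move=> M0 b0; exists (b / M); first by rewrite divr_gt0.
    by move=> e _; rewrite ler_pdivlMr// mulrC.
  have NN : 0 < n.+1%:R :> R by lra.
  have [a1 a10 h1] := pos 2 1 ltac:(by []) ltr01.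
  have [a2 a20 h2] := pos (6 * n.+1%:R) ((1 - sqnorm z0) / 2) ltac:(by rewrite mulr_gt0) ltac:(by rewrite divr_gt0).
  have [a3 a30 h3] := pos (6 * n.+1%:R) (r ^+ 2 / 2) ltac:(by rewrite mulr_gt0) ltac:(by rewrite divr_gt0).
  have [a4 a40 h4] := pos (12 * n.+1%:R / r ^+ 2 + 4) d ltac:(by rewrite addr_gt0// divr_gt0// mulr_gt0) d0.
  exists (Num.min a1 (Num.min a2 (Num.min a3 a4))); set e := Num.min _ _.
  have e0 : 0 < e by rewrite !lt_min a10 a20 a30.
  split => //.
  - by apply: h1; rewrite // !ge_min lexx.
  - by have := h2 e e0; rewrite !ge_min lexx !orbT => /(_ isT); lra.
  - by have := h3 e e0; rewrite !ge_min lexx !orbT => /(_ isT); lra.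
  - have := h4 e e0; rewrite !ge_min lexx !orbT => /(_ isT); apply: le_trans.
    by rewrite le_eqVlt; apply/orP; left; apply/eqP; field; rewrite gt_eqF.
have bv := ball_vol_gt0 R n.
exists (\prod_(i < (2 * n).+2) (2 * e) / @ball_vol R n.+1).
  by rewrite divr_gt0// prod_const_gt0.
move=> f k k0 hf; rewrite mulrC mulrA.
apply: (hardy_lower (m := fun=> rcoord z0 0) (c := rcoord z0) (l := fun=> e) r01) => //.
  by move=> _; rewrite ltW.
move=> s /slanted_straight/straight_close hs z.
have := sqnorm_close e1 z01 hs; rewrite -/z ler_norml => /andP[z1 z2].
have zb : sqnorm z < 1 by lra.
split => //; apply: hf; first by apply: sqnorm_radial; rewrite r1 ltW.
have pj j : cnorm (z0 0 j) <= 1.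
  rewrite -(@ler_pXn2r _ 2) ?nnegrE ?cnorm_ge0// sqr_cnorm expr1n.
  exact: le_trans (cabs2_le_sqnorm _ _) (ltW z01).
have hE : \sum_j cnorm (z 0 j - RtoC 1 * z0 0 j) *
     (2 * 1 * cnorm (z0 0 j) + cnorm (z 0 j - RtoC 1 * z0 0 j)) <= 3 * n.+1%:R * (2 * e).
  have -> : 3 * n.+1%:R * (2 * e) = \sum_(j < n.+1) (2 * e * 3).
    by rewrite sumr_const card_ord -[RHS]mulr_natr; ring.
  apply: ler_sum => j _; rewrite RtoC1 mul1r.
  have := hs j; have := pj j; have := cnorm_ge0 (z0 0 j); have := cnorm_ge0 (z 0 j - z0 0 j) => a b c h.
  by apply: ler_pM => //; [rewrite addr_ge0// mulr_ge0// mulr_ge0|lra].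
have hE2 : 3 * n.+1%:R * (2 * e) <= (1 * r) ^+ 2 / 2 by rewrite mul1r.
have [_ hp] := radial_projection r0 ltr01 r2 hE hE2.
move=> j; apply: le_trans (hp j) _; rewrite RtoC1 !mul1r divr1.
apply: le_trans e5; apply: lerD.
  rewrite -[leRHS]mulr1 ler_wpM2l// divr_ge0 ?(ltW rr0)// !mulr_ge0// ltW//.
have := hs j; rewrite -/z; lra.
Qed.

End BoxLower.

(** * Lower bounds on the concentrating boxes *)

Section ConcentrationLower.
Local Open Scope complex_scope.
Variables (R : realType) (n : nat).
Local Notation C := (Cx R).
Local Notation V := 'rV[C]_n.+1.
Implicit Types (z : V) (y : R) (f : V -> C) (s : nat -> R).

Lemma coord_index_bounds (j : nat) : (j < n)%N ->
  [/\ (2 * j.+1 < (2 * n).+2)%N, (2 * j.+1 + 1 < (2 * n).+2)%N,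
      (1 <= 2 * j.+1)%N /\ (1 <= 2 * j.+1 + 1)%N, (2 * j.+1 < 2)%N = false &
      (2 * j.+1 + 1 < 2)%N = false /\ (2 * j.+1 == 1)%N = false /\ (2 * j.+1 + 1 == 1)%N = false].
Proof. by move=> jn; split; lia. Qed.

(** The box has volume of order eps^2 (sqrt eps)^(2n), and by [region_defect] the weight on it is of
    order eps^al; the product compensates the height. *)
Lemma bergman_box (al : R) : -1 < al -> box_lower (n.+1%:R + 1 + al) (@A2norm2 R n.+1 al).
Proof.
move=> al1 z0 z01 c c0; set sg := n.+1%:R + 1 + al.
have [eta [Y1 [t1 [t2 [eta0 Y10 t10 t20 hreg]]]]] := region_defect z01.
have [cb [Y2 [cb0 Y20 hnear]]] := near_base_region z0 eta0.
have [c1 [c10 c1c c1b]] : exists c1 : R, [/\ 0 < c1, c1 <= c & c1 <= cb].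
  by exists (Num.min c cb); rewrite lt_min c0 cb0 !ge_min !lexx orbT.
pose w := Num.min (t1 `^ al) (t2 `^ al).
have w0 : 0 < w by rewrite lt_min !powR_gt0.
have ca := c_alpha_gt0 n al1; have bv := ball_vol_gt0 R n.
exists (c_alpha n.+1 al * (w * c1 ^+ (2 * n).+2 / @ball_vol R n.+1)), (Y1 + Y2); split.
  by rewrite mulr_gt0// divr_gt0// mulr_gt0// exprn_gt0.
move=> y f k yY k0 hf.
have ep0 := eps_gt0 y; have s0 := sqrt_eps_gt0 y.
pose l i := (if (i < 2)%N then c1 * eps y / 2 else c1 * Num.sqrt (eps y) / 2).
have l0 i : 0 <= l i by rewrite /l; case: ifP => _; rewrite divr_ge0// mulr_ge0// ltW.
have -> : (c_alpha n.+1 al * (w * c1 ^+ (2 * n).+2 / @ball_vol R n.+1)) * k =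
  c_alpha n.+1 al * ((k * eps y `^ (- sg) * (eps y `^ al * w)) * \prod_(i < (2 * n).+2) (2 * l i) / @ball_vol R n.+1).
  have -> : \prod_(i < (2 * n).+2) (2 * l i) = c1 ^+ (2 * n).+2 * eps y ^+ (2 + n).
    rewrite 2!big_ord_recl.
    have -> : \prod_(i < 2 * n) (2 * l (lift ord0 (lift ord0 i))) = (c1 * Num.sqrt (eps y)) ^+ (2 * n).
      rewrite (eq_bigr (fun=> c1 * Num.sqrt (eps y))); last first.
        by move=> i _; rewrite /l /= mulrC divfK.
      by rewrite prodr_const card_ord.
    rewrite exprMn sqrt_epsX /l /= exprD 2!exprS.
    by move: (c1 ^+ _) (eps y ^+ n) => a b; field.
  have ea : sg = al + (2 + n)%:R by rewrite /sg natrD -natr1; ring.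
  have e1 := powR_eps_cancel y ea.
  rewrite [RHS](_ : _ = c_alpha n.+1 al * (k * w * c1 ^+ (2 * n).+2 / ball_vol R n.+1) *
    (eps y `^ (- sg) * eps y `^ al * eps y ^+ (2 + n))); last by ring.
  by rewrite e1; ring.
pose p := base z0 y.
apply: (bergman_lower (m := fun=> rcoord p 0) (c := rcoord p) (l := l)) => //.
  by rewrite !mulr_ge0 ?powR_ge0 ?(ltW w0).
move=> s /slanted_straight hs z.
have nb : near_base z0 y c1 z.
  split.
    apply: le_trans (vec_coord_le (d := c1 * eps y / 2) _ _) _; last by lra.
    - exact: (hs 0%N).
    - exact: (hs 1%N).
  move=> j; apply: le_trans (vec_coord_le (d := c1 * Num.sqrt (eps y) / 2) _ _) _; last by lra.
  - by have [h1 _ _ h2 _] := coord_index_bounds (ltn_ord j); have := hs _ h1; rewrite /l h2.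
  - by have [_ h1 _ _ [h2 _]] := coord_index_bounds (ltn_ord j); have := hs _ h1; rewrite /l h2.
have wid (c2 : R) : c1 <= c2 -> near_base z0 y c2 z.
  move=> c12; case: nb => h0 hj; split; first by rewrite (le_trans h0)// ler_wpM2r// ltW.
  by move=> j; rewrite (le_trans (hj j))// ler_wpM2r// ltW.
have yY1 : Y1 <= y by lra. 
have yY2 : Y2 <= y by lra.
have /andP[T1 T2] := hreg _ _ yY1 (hnear _ _ yY2 (wid _ c1b)).
have zb : sqnorm z < 1 by rewrite -subr_gt0; apply: lt_le_trans T1; rewrite mulr_gt0.
split => //; apply: ler_pM.
- by rewrite mulr_ge0 ?powR_ge0.
- by rewrite mulr_ge0 ?powR_ge0// ltW.
- exact: hf zb (wid _ c1c).
- have := @powR_between R al (t1 * eps y) (t2 * eps y) (1 - sqnorm z).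
  rewrite T1 T2 mulr_gt0// => /(_ isT isT); apply: le_trans.
  rewrite !powRM ?(ltW ep0) ?(ltW t10) ?(ltW t20)// /w.
  have h : 0 <= eps y `^ al by exact: powR_ge0.
  rewrite le_min; apply/andP; split.
    by rewrite mulrC ler_wpM2r// ge_min lexx.
  by rewrite mulrC ler_wpM2r// ge_min lexx orbT.
Qed.

(** Points whose radial projection falls into the box around p form a cone; its part around p / 2 is
    well inside the ball. Across the ray z_1 must be accurate to order eps, but the ray is nearly
    horizontal, with slope of order sqrt eps: for given Im z_1, the real part may range over an
    interval of length of order sqrt eps. Hence Re z_1, the innermost variable, carries the moving
    centre. *)
Lemma hardy_box : box_lower n.+1%:R (@H2norm2 R n.+1).
Proof.
move=> z0 z01 c c0.
have [K [Y [K0 Y4 hb]]] := base_bounds z01.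
have N0 : 0 <= n%:R :> R by rewrite ler0n.
(* c1 m eps will bound the change of |z|^2: the first coordinate gives 4 * 3 = 12, each of the n
   others (2 + 3K) sqrt eps times (2 + 5K) sqrt eps. *)
pose m := 12 + n%:R * ((2 + 3 * K) * (2 + 5 * K)).
have m0 : 0 < m by rewrite /m ltr_wpDr// !mulr_ge0// addr_ge0// mulr_ge0.
(* In order: [lam] stays within 1/4 of 1/2; [E] is at most half of (lam r)^2, which is at least
   1/64; the projected point lies in the box, in its first coordinate and in the others. *)
have [c1 [c10 c112 c1a c1b c1c]] : exists c1 : R,
  [/\ 0 < c1, c1 <= 12^-1, c1 * m <= 128^-1, c1 * (128 * m + 32) <= c &
      c1 * (128 * m * K + 8 * (2 + 3 * K)) <= c].
  have p1 : 0 < 128 * m + 32 by rewrite addr_gt0// mulr_gt0.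
  have p2 : 0 < 128 * m * K + 8 * (2 + 3 * K).
    by rewrite ltr_wpDl// ?mulr_ge0 ?(ltW m0)// mulr_gt0// ltr_pwDl// mulr_ge0.
  have p3 : 0 < c / (128 * m + 32) by rewrite divr_gt0.
  have p4 : 0 < c / (128 * m * K + 8 * (2 + 3 * K)) by rewrite divr_gt0.
  exists (Num.min 12^-1 (Num.min (128^-1 / m) (Num.min (c / (128 * m + 32)) (c / (128 * m * K + 8 * (2 + 3 * K)))))).
  have p5 : 0 < 128^-1 / m by rewrite divr_gt0 ?invr_gt0.
  have p6 : 0 < 12^-1 :> R by rewrite invr_gt0.
  split.
  - by rewrite !lt_min p3 p4 p5 p6.
  - by rewrite ge_min lexx.
  - by rewrite -ler_pdivlMr// !ge_min lexx orbT.
  - by rewrite -ler_pdivlMr// !ge_min lexx !orbT.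
  - by rewrite -ler_pdivlMr// !ge_min lexx !orbT.
have bv := ball_vol_gt0 R n.
exists ((2 * c1) ^+ (2 * n).+2 / 8 / @ball_vol R n.+1), Y; split.
  by rewrite !divr_gt0// exprn_gt0// mulr_gt0.
move=> y f k yY k0 hf.
have ep0 := eps_gt0 y; have s0 := sqrt_eps_gt0 y.
have sgE : eps y = Num.sqrt (eps y) ^+ 2 by rewrite sqr_sqrtr// ltW.
have sgX := sqrt_epsX y n; rewrite /near_base in hf.
have [] := hb _ yY; move: (base z0 y) hf => p.
move: (Num.sqrt (eps y)) s0 sgE sgX => sg s0 sgE sgX hf.
move=> a12 /andP[b1 b2] hpj /andP[p4 p1].
set a1 := cRe (p 0 0) in a12; set a2 := cIm (p 0 0) in b1 b2.
have sg1 : sg <= 1 by rewrite -(@expr_le1 _ 2) ?(ltW s0)// -sgE eps_le1.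
have a10 : 0 < a1 by lra.
have a20 : 0 < a2 by apply: lt_le_trans b1; rewrite divr_gt0.
pose l i := (if i == 1%N then c1 * a2 else c1 * sg).
have l0 i : 0 <= l i by rewrite /l; case: ifP => _; rewrite mulr_ge0// ltW.
pose r := Num.sqrt (sqnorm p).
have r2 : sqnorm p = r ^+ 2 by rewrite sqr_sqrtr// sqnorm_ge0.
have r0 : 0 < r by rewrite sqrtr_gt0; lra.
have r1 : r < 1 by rewrite -(@expr_lt1 _ 2) ?(ltW r0)// -r2.
have r01 : 0 < r < 1 by rewrite r0.
pose q i : R := rcoord p i / 2.
apply: (@le_trans _ _ ((k * eps y `^ (- n.+1%:R)) * \prod_(i < (2 * n).+2) (2 * l i) / @ball_vol R n.+1)%:E).
  have -> : \prod_(i < (2 * n).+2) (2 * l i) = (2 * c1) ^+ (2 * n).+2 * (sg * a2 * eps y ^+ n).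
    rewrite 2!big_ord_recl.
    have -> : \prod_(i < 2 * n) (2 * l (lift ord0 (lift ord0 i))) = (2 * c1 * sg) ^+ (2 * n).
      rewrite (eq_bigr (fun=> 2 * c1 * sg)); last by move=> i _; rewrite /l /= mulrA.
      by rewrite prodr_const card_ord.
    rewrite exprMn sgX /l /= 2!exprS.
    by move: ((2 * c1) ^+ (2 * n)) (eps y ^+ n) => a b; ring.
  have ea : n.+1%:R = 1 + n%:R :> R by rewrite -natr1 addrC.
  have e1 := powR_eps_cancel y ea; rewrite (powRr1 (ltW ep0)) in e1.
  rewrite lee_fin [leLHS](_ : _ = (k * eps y `^ (- n.+1%:R)) * ((2 * c1) ^+ (2 * n).+2 * (eps y / 8 * eps y ^+ n)) / ball_vol R n.+1); last first.
    rewrite [RHS](_ : _ = (2 * c1) ^+ (2 * n).+2 / 8 / ball_vol R n.+1 * k *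
      (eps y `^ (- n.+1%:R) * eps y * eps y ^+ n)); last by ring.
    by rewrite e1 mulr1.
  rewrite ler_pM2r ?invr_gt0// ler_wpM2l ?mulr_ge0 ?powR_ge0//.
  rewrite ler_pM2l ?exprn_gt0 ?mulr_gt0// ler_pM2r ?exprn_gt0//.
  by rewrite sgE expr2 -mulrA ler_pM2l.
apply: (hardy_lower (m := fun t => a1 / a2 * t) (c := q) (l := l) r01) => //.
  by rewrite mulr_ge0 ?powR_ge0.
move=> s [h0 h1] z.
(* This [lam] matches the real parts, so z_1 - lam p_1 is purely imaginary, of modulus |lam - s_1 /
   a2| a2: a product of two factors of order sqrt eps. *)
have [lam lamE] : exists lam, lam = s 0%N / a1 by eexists.
have h0' : `|lam - s 1%N / a2| <= 2 * c1 * sg.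
  have -> : lam - s 1%N / a2 = (s 0%N - a1 / a2 * s 1%N) / a1 by rewrite lamE; field; rewrite !gt_eqF.
  rewrite normrM normfV (gtr0_norm a10) ler_pdivrMr//.
  apply: (le_trans h0); rewrite /l /=.
  rewrite (_ : 2 * c1 * sg * a1 = 2 * a1 * (c1 * sg)); last by ring.
  by rewrite ler_peMl ?mulr_ge0 ?(ltW c10) ?(ltW s0)//; lra.
have h1' : `|s 1%N / a2 - 2^-1| <= c1.
  have -> : s 1%N / a2 - 2^-1 = (s 1%N - a2 / 2) / a2 by field; rewrite gt_eqF.
  rewrite normrM normfV (gtr0_norm a20) ler_pdivrMr//.
  have := h1 1%N isT; rewrite /q /l /=.
  by have := coord_odd p 0; rewrite muln0 => ->.
have hlam : `|lam - 2^-1| <= 3 * c1.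
  have -> : lam - 2^-1 = (lam - s 1%N / a2) + (s 1%N / a2 - 2^-1) by ring.
  apply: le_trans (ler_normD _ _) _.
  have : c1 * sg <= c1 by rewrite ler_piMr// ltW.
  by lra.
have [lam1 lam2] : 4^-1 <= lam /\ lam <= 3 / 4.
  clear - hlam c112; move: hlam; rewrite ler_norml => /andP[? ?]; split; lra.
have lam0 : 0 < lam by lra.
have d0 : cnorm (z 0 0 - RtoC lam * p 0 0) <= 4 * c1 * eps y.
  have -> : z 0 0 - RtoC lam * p 0 0 = mkC 0 (s 1%N - lam * a2).
    rewrite vec_of0; apply: complex_ext; rewrite ?cReD ?cImD ?cReN ?cImN ?cRe_RtoCM ?cIm_RtoCM //.
    by rewrite -/a1 lamE divfK ?gt_eqF// /cRe /= subrr.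
  have -> : mkC 0 (s 1%N - lam * a2) = RtoC (s 1%N - lam * a2) * mkC 0 1.
    by apply: complex_ext; rewrite ?cRe_RtoCM ?cIm_RtoCM /cRe /cIm /= ?mulr0 ?mulr1.
  rewrite cnormM cnorm_RtoC.
  have -> : cnorm (mkC 0 1 : C) = 1.
    by rewrite /cnorm cabs2E /cRe /cIm /= (_ : 0 ^+ 2 + 1 ^+ 2 = 1) ?sqrtr1//; ring.
  rewrite mulr1 (_ : s 1%N - lam * a2 = - (lam - s 1%N / a2) * a2); last by field; rewrite gt_eqF.
  rewrite normrM normrN (gtr0_norm a20) sgE expr2.
  apply: (@le_trans _ _ ((2 * c1 * sg) * (2 * sg))); last by rewrite le_eqVlt; apply/orP; left; apply/eqP; ring.
  by apply: ler_pM => //; exact: ltW.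
have dj (j : 'I_n) : cnorm (z 0 (lift 0 j) - RtoC lam * p 0 (lift 0 j)) <= c1 * (2 + 3 * K) * sg.
  have half : cnorm (z 0 (lift 0 j) - RtoC (2^-1) * p 0 (lift 0 j)) <= 2 * (c1 * sg).
    have qE i : rcoord (RtoC (2^-1) *: p) i = q i.
      by rewrite /rcoord /q /rcoord; case: ifP => _; rewrite mxE ?cRe_RtoCM ?cIm_RtoCM mulrC.
    have := @vec_coord_le R n (RtoC (2^-1) *: p) s (lift 0 j) (c1 * sg).
    rewrite !qE [X in cnorm (_ - X)]mxE; apply.
    - have [h2 _ [h3 _] _ [_ [h5 _]]] := coord_index_bounds (ltn_ord j).
      by have := h1 (2 * j.+1)%N; rewrite h2 h3 /l h5; apply.
    - have [_ h2 [_ h3] _ [_ [_ h5]]] := coord_index_bounds (ltn_ord j).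
      by have := h1 (2 * j.+1 + 1)%N; rewrite h2 h3 /l h5; apply.
  have -> : z 0 (lift 0 j) - RtoC lam * p 0 (lift 0 j) = (z 0 (lift 0 j) - RtoC (2^-1) * p 0 (lift 0 j))
      - RtoC (lam - 2^-1) * p 0 (lift 0 j).
    rewrite RtoCD; have -> : RtoC (- 2^-1) = - RtoC (2^-1) :> C.
      by apply: complex_ext; rewrite /cRe /cIm//= oppr0.
    ring.
  apply: le_trans (cnormB _ _) _; rewrite cnormM cnorm_RtoC.
  have : `|lam - 2^-1| * cnorm (p 0 (lift 0 j)) <= (3 * c1) * (K * sg).
    by apply: ler_pM; rewrite ?cnorm_ge0.
  by move: half; clear; lra.
pose E := c1 * m * eps y.
have E0 : 0 <= E by rewrite !mulr_ge0// ltW.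
have pc0 : cnorm (p 0 0) <= 1 by exact: cnorm_le1.
have c1e : c1 * eps y <= 12^-1.
  by apply: le_trans c112; rewrite ler_piMr ?(ltW c10)// eps_le1.
have nn j : 0 <= 2 * lam * cnorm (p 0 j) + cnorm (z 0 j - RtoC lam * p 0 j).
  apply: addr_ge0; rewrite ?cnorm_ge0//; apply: mulr_ge0; rewrite ?cnorm_ge0//.
  by rewrite mulr_ge0// ltW.
have hE : \sum_j cnorm (z 0 j - RtoC lam * p 0 j) *
     (2 * lam * cnorm (p 0 j) + cnorm (z 0 j - RtoC lam * p 0 j)) <= E.
  have -> : E = c1 * 12 * eps y + \sum_(j < n) (c1 * (2 + 3 * K) * sg * ((2 + 5 * K) * sg)).
    by rewrite sumr_const card_ord -[X in _ + X]mulr_natr /E /m {2}sgE; rewrite {1}sgE; ring.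
  rewrite big_ord_recl; apply: lerD.
    apply: (@le_trans _ _ ((4 * c1 * eps y) * 3)); last by clear; lra.
    apply: ler_pM; rewrite ?cnorm_ge0//.
    have : 2 * lam * cnorm (p 0 0) <= 2.
      by have := cnorm_ge0 (p 0 0); move: (cnorm (p 0 0)) pc0 => a; clear - lam0 lam2; nra.
    by clear - d0 c1e; lra.
  apply: ler_sum => j _; apply: ler_pM; rewrite ?cnorm_ge0//.
  have h2 : 2 * lam * cnorm (p 0 (lift ord0 j)) <= 2 * (K * sg).
    have := hpj j; have := cnorm_ge0 (p 0 (lift 0 j)); move: (cnorm _) => a aa0 aK.
    by have : 0 <= K * sg by [exact: le_trans aK]; clear - aa0 aK lam0 lam2; nra.
  have h3 : c1 * (2 + 3 * K) * sg <= (2 + 3 * K) * sg.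
    rewrite ler_pM2r// ler_piMl ?addr_ge0 ?mulr_ge0//; clear - c112; lra.
  by have := dj j; clear - h2 h3; lra.
have lr : 64^-1 <= (lam * r) ^+ 2.
  rewrite exprMn -r2 (_ : 64^-1 = 4^-1 ^+ 2 * 4^-1); last by field.
  by apply: ler_pM => //; rewrite ler_pXn2r ?nnegrE ?(ltW lam0).
have hE2 : E <= (lam * r) ^+ 2 / 2.
  have : E <= c1 * m by rewrite /E ler_piMr ?eps_le1// mulr_ge0// ltW.
  by clear - c1a lr; lra.
have [hz hp] := radial_projection r0 lam0 r2 hE hE2.
have zb : sqnorm z < 1.
  apply: (le_lt_trans hz); rewrite exprMn.
  have l2 : lam ^+ 2 <= (3 / 4) ^+ 2.
    by rewrite ler_pXn2r ?nnegrE ?(ltW lam0)// divr_ge0.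
  have : lam ^+ 2 * r ^+ 2 <= (3 / 4) ^+ 2 * 1.
    by apply: ler_pM; rewrite ?sqr_ge0// -r2 ltW.
  by clear; lra.
split => //; apply: hf; first by apply: sqnorm_radial; rewrite r1 ltW.
have EE : 2 * E / (lam * r) ^+ 2 <= 128 * E.
  rewrite ler_pdivrMr; last by apply: lt_le_trans lr; rewrite invr_gt0.
  by have : 128 * E * 64^-1 <= 128 * E * (lam * r) ^+ 2; [rewrite ler_wpM2l// mulr_ge0|clear; lra].
have LL : 2 / lam <= 8 by rewrite ler_pdivrMr//; clear - lam1; lra.
have L0 : 0 <= 2 / lam by rewrite divr_ge0// ltW.
have EE0 : 0 <= 2 * E / (lam * r) ^+ 2 by apply: divr_ge0; [exact: mulr_ge0|exact: sqr_ge0].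
split.
  apply: le_trans (hp 0) _.
  apply: (@le_trans _ _ (128 * E * 1 + 8 * (4 * c1 * eps y))).
    by apply: lerD; apply: ler_pM; rewrite ?cnorm_ge0.
  have -> : 128 * E * 1 + 8 * (4 * c1 * eps y) = c1 * (128 * m + 32) * eps y by rewrite /E; ring.
  by rewrite ler_pM2r.
move=> j; apply: le_trans (hp (lift 0 j)) _.
apply: (@le_trans _ _ (128 * E * (K * sg) + 8 * (c1 * (2 + 3 * K) * sg))).
  by apply: lerD; apply: ler_pM; rewrite ?cnorm_ge0.
apply: (@le_trans _ _ (c1 * (128 * m * K + 8 * (2 + 3 * K)) * sg)); last by rewrite ler_pM2r.
have -> : c1 * (128 * m * K + 8 * (2 + 3 * K)) * sg = 128 * (c1 * m) * (K * sg) + 8 * (c1 * (2 + 3 * K) * sg) by ring.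
rewrite lerD2r ler_wpM2r ?mulr_ge0 ?(ltW s0)// ler_wpM2l//.
by rewrite /E ler_piMr ?eps_le1// mulr_ge0 ?(ltW c10) ?(ltW m0).
Qed.

End ConcentrationLower.

(** * Derivative of a linear-fractional function along a line *)

Lemma quotient_limit (K : numFieldType) (k q c : K) : q != 0 ->
  ((fun h : K => q + h * c) @ (0 : K)^' --> q) /\ ((fun h : K => k / (q + h * c)) @ (0 : K)^' --> k / q).
Proof.
move=> q0.
have b : (fun h : K => h) @ (0 : K)^' --> (0 : K) by apply: cvg_within_filter; exact: cvg_id.
have e : (fun h : K => q + h * c) @ (0 : K)^' --> q.
  rewrite -[X in _ --> X]addr0 -[X in _ --> _ + X](mul0r c).
  exact: (cvgD (cvg_cst _) (cvgM b (cvg_cst _))).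
split => //.
exact: (cvgM (cvg_cst _) (cvgV q0 e)).
Qed.
(** For small h <> 0 the difference quotient is exactly k / (q + h c), and limits are unique. *)
Lemma quotient_deriv (K : numFieldType) (V : normedModType K) (f : V -> K) (a v : V) (k q c l : K) : q != 0 ->
  (forall h : K, q + h * c != 0 -> f (h *: v + a) = 1 + k * h / (q + h * c)) ->
  is_derive a v f l -> k / q = l.
Proof.
move=> q0 ht [dv dE].
have [den c2] := quotient_limit k c q0.
have h1 : (fun h : K => h^-1 *: ((f \o shift a) (h *: v) - f a)) @ (0 : K)^' --> l.
  by move: dv; rewrite /derivable -dE.
have t1 : f a = 1.
  by have := ht 0; rewrite mul0r addr0 scale0r add0r mulr0 mul0r addr0; apply.
have c1 : (fun h : K => k / (q + h * c)) @ (0 : K)^' --> l.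
  apply: cvg_trans h1; apply: near_eq_cvg.
  have hn : \forall h \near (0 : K)^', q + h * c != 0.
    exact: (cvgr_neq0 _ den q0).
  near=> h.
  have h0 : h != 0 by near: h; exact: nbhs_dnbhs_neq.
  have hq : q + h * c != 0 by near: h.
  rewrite /= ht// t1 addrAC subrr add0r /GRing.scale/=.
  by field; rewrite h0 hq.
by apply: (cvg_unique _ c2 c1); exact: norm_hausdorff.
Unshelve. all: by end_near. Qed.

(** * Parabolic maps in Siegel coordinates *)

Section Parabolic.
Local Open Scope complex_scope.
Variables (R : realType) (n : nat).
Local Notation C := (Cx R).
Local Notation V := 'rV[C]_n.+1.
Implicit Types (z : V).
Local Notation e1 := (@e1 R n.+1).

Definition aff (a : V) (b : C) z : C := \sum_k z 0 k * a 0 k + b.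

Lemma e1_0 : e1 0 0 = 1.
Proof. by rewrite mxE. Qed.

Lemma e1_lift (j : 'I_n) : e1 0 (lift 0 j) = 0.
Proof. by rewrite mxE. Qed.

Lemma aff_e1 a b z : aff a b z =
  aff a b e1 + (z 0 0 - 1) * a 0 0 + \sum_(k < n) z 0 (lift 0 k) * a 0 (lift 0 k).
Proof.
rewrite /aff !big_ord_recl e1_0.
have -> : \sum_(i < n) e1 0 (lift ord0 i) * a 0 (lift ord0 i) = 0.
  by rewrite big1// => k _; rewrite e1_lift mul0r.
ring.
Qed.

Lemma affB a b a' b' z : aff a b z - aff a' b' z = aff (a - a') (b - b') z.
Proof.
rewrite /aff opprD addrACA -sumrB; congr (_ + _).
by apply: eq_bigr => k _; rewrite !mxE mulrBr.
Qed.

Definition cconj (x : C) : C := mkC (cRe x) (- cIm x).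

Lemma cconjD x y : cconj (x + y) = cconj x + cconj y.
Proof. by case: x => a b; case: y => c d; apply: complex_ext; rewrite /cRe /cIm /=; ring. Qed.

Lemma cconjN x : cconj (- x) = - cconj x.
Proof. by case: x => a b; apply: complex_ext. Qed.

Lemma cconjM x y : cconj (x * y) = cconj x * cconj y.
Proof. by case: x => a b; case: y => c d; apply: complex_ext; rewrite /cRe /cIm /=; ring. Qed.

Lemma cconj_RtoC (t : R) : cconj (RtoC t) = RtoC t.
Proof. by apply: complex_ext; rewrite /cRe /cIm /= ?oppr0. Qed.

Lemma cnorm_cconj x : cnorm (cconj x) = cnorm x.
Proof. by rewrite /cnorm !cabs2E /cRe /cIm /= sqrrN. Qed.

Lemma mulr_cconj x : x * cconj x = RtoC (cnorm x ^+ 2).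
Proof.
by rewrite sqr_cnorm; case: x => a b; apply: complex_ext; rewrite /cRe /cIm /cabs2 /=; ring.
Qed.

(** Both forms are taken at (1 - s^2) e1 + s w e_j; the leading 0 is the value of P at e1. Only the
    tangential coefficient pj enters the first-order term in s. *)
Lemma tangential_expand (s : R) (kp c0 cj pj w q : C) (X := cconj (w * cj - RtoC s * c0)) :
  (0 - RtoC (s ^+ 2) * kp + RtoC s * w * pj) * cconj (q - RtoC (s ^+ 2) * c0 + RtoC s * w * cj) =
  RtoC s * (pj * w * cconj q) +
  RtoC (s ^+ 2) * (- kp * cconj q + pj * w * X - RtoC s * kp * X).
Proof. rewrite /X !(cconjD, cconjM, cconjN, cconj_RtoC) expr2 RtoCM; ring. Qed.

(* A linear-fractional self-map fixing e1 has 1 - tau_1 vanishing to first order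
   at e1 only in the normal direction: a nonzero tangential coefficient would be
   visible at scale s while the ball only allows a normal displacement s^2. *)
Lemma tangential_vanish (P Q : V) (b d : C) : aff P b e1 = 0 -> aff Q d e1 != 0 ->
  (forall z, sqnorm z < 1 -> cabs2 (aff Q d z - aff P b z) < cabs2 (aff Q d z)) ->
  forall j : 'I_n, P 0 (lift 0 j) = 0.
Proof.
move=> P1 Q1 h j; apply/eqP; apply/negPn/negP => pj0.
set q1 := aff Q d e1 in Q1; set pj := P 0 (lift 0 j) in pj0.
pose M := cnorm pj * cnorm q1.
have M0 : 0 < M by rewrite mulr_gt0 ?cnorm_gt0.
(* The phase of w turns the first-order term of P conj(Q) into the negative number - s M. *)
have [w [w1 mw]] : exists w : C, cnorm w = 1 /\ pj * w * cconj q1 = - RtoC M.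
  exists (- (cconj pj * q1) * RtoC M^-1); split.
    rewrite cnormM cnormN cnormM cnorm_cconj cnorm_RtoC ger0_norm ?invr_ge0 ?(ltW M0)//.
    by rewrite -/M mulfV// gt_eqF.
  rewrite (_ : pj * _ * _ = - ((pj * cconj pj) * (q1 * cconj q1) * RtoC M^-1)); last by ring.
  rewrite !mulr_cconj -!RtoCM; congr (- RtoC _).
  by rewrite -exprMn -/M; field; rewrite gt_eqF.
pose kp := P 0 0; pose c0 := Q 0 0; pose cj := Q 0 (lift 0 j).
pose K := cnorm kp * cnorm q1 + (cnorm pj + cnorm kp) * (cnorm cj + cnorm c0).
have K0 : 0 <= K by rewrite addr_ge0// ?mulr_ge0 ?addr_ge0 ?cnorm_ge0.
(* So small that the first-order term s M dominates the remainder, which is at most s^2 K. *)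
pose s := Num.min (2^-1) (M / (K + 1)).
have s0 : 0 < s by rewrite lt_min invr_gt0 ltr0n divr_gt0// ltr_wpDl.
have s1 : s <= 2^-1 by rewrite ge_min lexx.
have sK : s * (K + 1) <= M by rewrite -ler_pdivlMr ?ltr_wpDl// ge_min lexx orbT.
pose z : V := \row_k (if k == 0 then RtoC (1 - s ^+ 2) else if k == lift 0 j then RtoC s * w else 0).
have z00 : z 0 0 = RtoC (1 - s ^+ 2) by rewrite mxE eqxx.
have zj : z 0 (lift 0 j) = RtoC s * w by rewrite mxE eqxx.
have zk k : k != j -> z 0 (lift 0 k) = 0.
  by move=> kj; rewrite mxE (inj_eq lift_inj) (negPf kj).
have zb : sqnorm z < 1.
  rewrite sqnorm_split (bigD1 j)//= big1 => [|k kj]; last first.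
    by rewrite zk// -sqr_cnorm cnorm0 expr0n.
  rewrite z00 zj -!sqr_cnorm cnormM !cnorm_RtoC w1 mulr1 addr0.
  rewrite !real_normK ?num_real//.
  have : 0 < s ^+ 2 by rewrite exprn_gt0.
  have : s ^+ 2 < 1 by rewrite expr_lt1 ?(ltW s0)//; lra.
  by move: (s ^+ 2) => t; nra.
have affz (a : V) bb : aff a bb z = aff a bb e1 - RtoC (s ^+ 2) * a 0 0 + RtoC s * w * a 0 (lift 0 j).
  rewrite aff_e1 (bigD1 j)//= big1 => [|k kj]; last by rewrite zk// mul0r.
  have -> : z 0 0 - 1 = - RtoC (s ^+ 2).
    by rewrite z00; apply: complex_ext; rewrite ?cReD ?cImD ?cReN ?cImN /cRe /cIm /=; ring.
  by rewrite zj; ring.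
have := h z zb; rewrite (affz P) (affz Q) P1 -/q1 -/pj -/kp -/c0 -/cj.
set Pz := 0 - _ + _; set Qz := q1 - _ + _ => hlt.
(* |Q - P| < |Q| means 2 Re (P conj Q) > |P|^2. *)
have re : 0 < cRe (Pz * cconj Qz).
  move: hlt; rewrite !cabs2E cReD cImD cReN cImN cReM.
  have -> : cRe (cconj Qz) = cRe Qz by [].
  have -> : cIm (cconj Qz) = - cIm Qz by [].
  by have := sqr_ge0 (cRe Pz); have := sqr_ge0 (cIm Pz); nra.
pose X : C := cconj (w * cj - RtoC s * c0).
have E : Pz * cconj Qz = RtoC s * (- RtoC M) + RtoC (s ^+ 2) * (- kp * cconj q1 + pj * w * X - RtoC s * kp * X).
  by rewrite -mw; exact: tangential_expand.
move: re; rewrite E cReD cRe_RtoCM cReN cRe_RtoCM.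
set G := _ - _ * X.
have GK : cnorm G <= K.
  have X1 : cnorm X <= cnorm cj + cnorm c0.
    rewrite /X cnorm_cconj; apply: le_trans (cnormB _ _) _.
    rewrite !cnormM w1 mul1r cnorm_RtoC lerD2l ger0_norm ?(ltW s0)//.
    by rewrite ler_piMl ?cnorm_ge0//; lra.
  apply: le_trans (cnormB _ _) _; apply: le_trans (lerD (cnormD _ _) (lexx _)) _.
  rewrite !cnormM cnormN cnorm_cconj w1 mulr1 cnorm_RtoC (ger0_norm (ltW s0)).
  have h1 : cnorm pj * cnorm X <= cnorm pj * (cnorm cj + cnorm c0) by rewrite ler_wpM2l ?cnorm_ge0.
  have h2 : s * cnorm kp * cnorm X <= cnorm kp * (cnorm cj + cnorm c0).
    apply: ler_pM; rewrite ?cnorm_ge0 ?mulr_ge0 ?cnorm_ge0 ?(ltW s0)//.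
    by rewrite ler_piMl ?cnorm_ge0//; lra.
  by rewrite /K mulrDl addrA; apply: lerD => //; apply: lerD.
have := le_trans (le_trans (ler_norm _) (cRe_le G)) GK.
have -> : cRe (RtoC M) = M by [].
move: (cRe G) => g gK hh.
have : s * (- M + s * g) <= 0.
  rewrite pmulr_rle0//.
  have : s * g <= s * K by rewrite ler_wpM2l// ltW.
  by move: sK; rewrite mulrDr mulr1; lra.
by rewrite (_ : s * (- M + s * g) = s * - M + s ^+ 2 * g); [lra|ring].
Qed.

Lemma mulmx_aff (A : 'M[C]_n.+1) (B z : V) j : (z *m A^T + B) 0 j = aff (row j A) (B 0 j) z.
Proof. by rewrite !mxE /aff; congr (_ + _); apply: eq_bigr => k _; rewrite !mxE. Qed.

Lemma inner_aff (D z : V) d : inner z D + d = aff (map_mx (fun x => x^*) D) d z.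
Proof. by rewrite /inner /aff; congr (_ + _); apply: eq_bigr => k _; rewrite mxE. Qed.

Lemma ball_neq1 z : sqnorm z < 1 -> z 0 0 != 1.
Proof.
move=> z1; apply/eqP => e; have := cabs2_le_sqnorm z 0.
by rewrite e -sqr_cnorm cnorm1 expr1n; lra.
Qed.

(** Write 1 - tau_1 = P / Q. Then P(z) = Q(e1) (1 - z_1), so v(tau z) = Q(z) v / Q(e1), and an
    affine form times v is affine in (u, v). The numerators of the other components vanish at e1,
    hence produce no term in v. *)
Lemma parabolic_siegel (tau : V -> V) : parabolic_e1 tau ->
  exists (c : C) (b f : 'I_n -> C) (D : 'I_n -> 'I_n -> C),
  forall z, sqnorm z < 1 ->
    [/\ sqnorm (tau z) < 1, sv (tau z) = sv z + c + \sum_k b k * su z k &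
       forall j, su (tau z) j = f j + \sum_k D j k * su z k].
Proof.
move=> [[A [B [Cv [d [tE hq hb]]]]] te1 td _].
pose Q : V := map_mx (fun x => x^*) Cv.
have qE z : inner z Cv + d = aff Q d z by exact: inner_aff.
have tauE z j : tau z 0 j = (aff Q d z)^-1 * aff (row j A) (B 0 j) z.
  by rewrite tE /linfrac mxE qE mulmx_aff.
set q1 := aff Q d e1.
(* The inverse of 0 is 0, so a zero denominator at e1 would make the first component of tau e1 equal
   to 0 instead of 1. *)
have q10 : q1 != 0.
  apply/eqP => e; have := tauE e1 0; rewrite te1 e1_0 -/q1 e invr0 mul0r.
  by move/eqP; rewrite oner_eq0.
have p1 j : aff (row j A) (B 0 j) e1 = q1 * e1 0 j.
  by rewrite -{2}te1 tauE -/q1 mulrA mulfV// mul1r.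
pose P : V := Q - row 0 A; pose bb := d - B 0 0.
have PE z : aff P bb z = aff Q d z - aff (row 0 A) (B 0 0) z by rewrite affB.
have P1 : aff P bb e1 = 0 by rewrite PE p1 e1_0 mulr1 subrr.
have Qn z : sqnorm z < 1 -> aff Q d z != 0 by move=> /hq; rewrite qE.
have Pt j : P 0 (lift 0 j) = 0.
  apply: (tangential_vanish P1 q10) => z z1.
  rewrite PE opprB addrCA subrr addr0.
  have := cabs2_le_sqnorm (tau z) 0; rewrite tauE cabs2M.
  move=> /le_lt_trans/(_ (hb z z1)).
  rewrite -!sqr_cnorm cnormV exprVn mulrC ltr_pdivrMr ?mul1r// exprn_gt0// cnorm_gt0.
  exact: Qn.
have Pz z : aff P bb z = (z 0 0 - 1) * P 0 0.
  by rewrite aff_e1 P1 add0r big1 ?addr0// => k _; rewrite Pt mulr0.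
(* On the line e1 + h e1, tau_1 equals 1 - P_0 h / (q1 + h Q_0), with derivative - P_0 / q1 at h =
   0. *)
have kE : - P 0 0 = q1.
  suff h1 : - P 0 0 / q1 = 1 by rewrite -[LHS](divfK q10) h1 mul1r.
  apply: (quotient_deriv (c := Q 0 0) q10 _ td) => h hn.
  have shE (a : V) b' : aff a b' (h *: e1 + e1) = aff a b' e1 + h * a 0 0.
    rewrite aff_e1 big1 => [|k _]; last by rewrite !mxE/= mulr0 addr0 mul0r.
    by rewrite !mxE/= mulr1 addr0; ring.
  rewrite inner_e1 tauE !shE p1 e1_0 mulr1 -/q1.
  have -> : row 0 A 0 0 = Q 0 0 - P 0 0 by rewrite /P !mxE; ring.
  by field.
have tau0 z : sqnorm z < 1 -> 1 - tau z 0 0 = q1 * (1 - z 0 0) / aff Q d z.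
  move=> z1; rewrite tauE; have := PE z; rewrite Pz => e.
  have -> : aff (row 0 A) (B 0 0) z = aff Q d z - (z 0 0 - 1) * P 0 0 by rewrite e; ring.
  by rewrite -kE; field; exact: Qn.
exists (- Q 0 0 / q1), (fun k => Q 0 (lift 0 k) / q1), (fun j => - A (lift 0 j) 0 / q1),
  (fun j k => A (lift 0 j) (lift 0 k) / q1) => z z1.
have zn : 1 - z 0 0 != 0 by rewrite subr_eq0 eq_sym ball_neq1.
have qz := Qn z z1.
split; first exact: hb.
- rewrite {1}/sv tau0//.
  have -> : \sum_k Q 0 (lift 0 k) / q1 * su z k = (\sum_k z 0 (lift 0 k) * Q 0 (lift 0 k)) / (q1 * (1 - z 0 0)).
    by rewrite mulr_suml; apply: eq_bigr => k _; rewrite /su /sv; field; rewrite q10 zn.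
  rewrite invf_div aff_e1 -/q1 /sv; set S := \sum_(_ < _) _.
  by field; rewrite q10 zn.
- move=> j; rewrite /su {1}/sv tau0// tauE.
  have -> : \sum_k A (lift 0 j) (lift 0 k) / q1 * (z 0 (lift 0 k) * sv z) =
     (\sum_k z 0 (lift 0 k) * row (lift 0 j) A 0 (lift 0 k)) / (q1 * (1 - z 0 0)).
    by rewrite mulr_suml; apply: eq_bigr => k _; rewrite mxE /sv; field; rewrite q10 zn.
  rewrite (aff_e1 (row _ _)) p1 e1_lift mulr0 add0r mxE; set S := \sum_(_ < _) _.
  by field; rewrite q10 zn qz.
Qed.

End Parabolic.

(** * Differentiability and continuity over a numeric field *)

Section NumFieldAnalysis.
Variable K : numFieldType.
Lemma differentiable_test (n m : nat) (c a : K) (j : 'I_n.+1) (z : 'rV[K]_n.+1) :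
  1 - a * z 0 0 != 0 ->
  differentiable (fun z : 'rV[K]_n.+1 => c * ((1 - a * z 0 0)^-1) ^+ m) z /\
  differentiable (fun z : 'rV[K]_n.+1 => c * z 0 j * ((1 - a * z 0 0)^-1) ^+ m) z.
Proof.
move=> h.
have d k : differentiable (fun z : 'rV[K]_n.+1 => z 0 k : K^o) z by exact: differentiable_coord.
have d1 : differentiable (fun z : 'rV[K]_n.+1 => 1 - a * z 0 0 : K^o) z.
  by apply: differentiableB => //; apply: differentiableM.
have d2 : differentiable (fun z : 'rV[K]_n.+1 => ((1 - a * z 0 0)^-1) ^+ m : K^o) z.
  have dV : differentiable (fun z : 'rV[K]_n.+1 => (1 - a * z 0 0)^-1 : K^o) z by exact: differentiableV.
  elim: m => [|m IH]; first exact: (@differentiable_cst _ _ _ (1 : K^o)).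
  rewrite (_ : (fun z => _) = (fun z : 'rV[K]_n.+1 => (1 - a * z 0 0)^-1 : K) *
     (fun z : 'rV[K]_n.+1 => ((1 - a * z 0 0)^-1) ^+ m : K)).
    exact: differentiableM.
  by apply/funext => w; rewrite exprS.
split; apply: differentiableM => //; exact: differentiableM.
Qed.

(** For the bounded factor in [kernel_inv_pow], with k = 1 / y and p the offset v - iy. *)
Lemma power_limit (m : nat) (i p0 e : K) : p0 != 0 -> 0 < e -> exists2 d : K, 0 < d &
  forall k p, `|k| < d -> `|p - p0| < d -> `|(k + i / p) ^+ m - (i / p0) ^+ m| < e.
Proof.
move=> p00 e0.
have c : (fun t : K * K => (t.1 + i / t.2) ^+ m) @ nbhs ((0 : K), p0) --> (0 + i / p0) ^+ m.
  have c1 : (fun t : K * K => t.1) @ nbhs ((0 : K), p0) --> (0 : K) by exact: cvg_fst.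
  have c2 : (fun t : K * K => t.2) @ nbhs ((0 : K), p0) --> p0 by exact: cvg_snd.
  have c3 : (fun t : K * K => t.1 + i / t.2) @ nbhs ((0 : K), p0) --> 0 + i / p0.
    exact: (cvgD c1 (cvgM (cvg_cst _) (cvgV p00 c2))).
  elim: m => [|m IH]; first exact: cvg_cst.
  by under eq_fun do rewrite exprS; rewrite exprS; exact: (cvgM c3 IH).
move/cvgrPdist_lt : c => /(_ e e0) /nbhs_ballP [d /= d0 hd].
exists d => // k p kd pd.
have := hd (k, p); rewrite add0r distrC; apply; split => /=.
  by rewrite -ball_normE /= sub0r normrN.
by rewrite -ball_normE /= distrC.
Qed.

Lemma continuous_row (n : nat) (g : 'rV[K]_n.+1 -> K) (z : 'rV[K]_n.+1) (e : K) : differentiable (g : _ -> K^o) z -> 0 < e ->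
  exists2 d : K, 0 < d & forall w : 'rV[K]_n.+1, (forall j, `|w 0 j - z 0 j| < d) -> `|g w - g z| < e.
Proof.
move=> /differentiable_continuous c e0.
move/cvgrPdist_lt : c => /(_ e e0) /nbhs_ballP [d /= d0 hd].
exists d => // w hw; rewrite distrC; apply: hd; split => // i j.
by rewrite -ball_normE /= ord1 distrC.
Qed.
End NumFieldAnalysis.

(** * Test functions *)

Section TestFunctions.
Local Open Scope complex_scope.
Variables (R : realType) (n : nat).
Local Notation C := (Cx R).
Local Notation V := 'rV[C]_n.+1.
Implicit Types (z : V) (y : R) (f : V -> C).

(** Positive elements of the complex field are real, which transfers epsilon-delta statements from
    [C] to [R]. *)
Lemma posC (e : C) : 0 < e -> exists2 r : R, 0 < r & e = RtoC r.
Proof.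
case: e => a b; rewrite ltcE /= => /andP[/eqP -> a0].
by exists a.
Qed.

Lemma RtoC_gt0 (r : R) : 0 < r -> 0 < RtoC r :> C.
Proof. by move=> r0; rewrite /RtoC ltcE /= eqxx. Qed.

Lemma normr_ltRtoC (x : C) (r : R) : (`|x| < RtoC r) = (cnorm x < r).
Proof. by rewrite normr_cnorm /RtoC ltcE /= eqxx. Qed.

Lemma cpower_limit (m : nat) (p0 : C) (e : R) : p0 != 0 -> 0 < e -> exists2 d : R, 0 < d &
  forall k p : C, cnorm k < d -> cnorm (p - p0) < d ->
    cnorm ((k + iy 1 / p) ^+ m - (iy 1 / p0) ^+ m) < e.
Proof.
move=> p00 e0; have [dc /posC [d d0 ->] h] := power_limit m (iy 1) p00 (RtoC_gt0 e0).
exists d => // k p kd pd; have := h k p; rewrite !normr_ltRtoC; exact.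
Qed.

Lemma holomorphic_continuous (g : V -> C) z (e : R) : differentiable g z -> 0 < e ->
  exists2 d : R, 0 < d & forall w : V, (forall j, cnorm (w 0 j - z 0 j) < d) -> cnorm (g w - g z) < e.
Proof.
move=> dg e0; have [dc /posC [d d0 ->] h] := continuous_row dg (RtoC_gt0 e0).
exists d => // w hw; have := h w; rewrite normr_ltRtoC; apply => j.
by rewrite normr_ltRtoC.
Qed.

Lemma abarE y : abar y * (1 - iy y) = - iy y.
Proof.
have := epsK y => e.
have e1 : eps y * y ^+ 2 = 1 - eps y by rewrite -e; ring.
apply: complex_ext; rewrite ?cReM ?cImM !cReD !cImD !cReN !cImN.
  have [-> ->] : cRe (iy y) = 0 /\ cIm (iy y) = y by [].
  have [-> ->] : cRe (abar y) = eps y * y ^+ 2 /\ cIm (abar y) = - (eps y * y) by [].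
  have [-> ->] : cRe (1 : C) = 1 /\ cIm (1 : C) = 0 by [].
  ring.
have [-> ->] : cRe (iy y) = 0 /\ cIm (iy y) = y by [].
have [-> ->] : cRe (abar y) = eps y * y ^+ 2 /\ cIm (abar y) = - (eps y * y) by [].
have [-> ->] : cRe (1 : C) = 1 /\ cIm (1 : C) = 0 by [].
by rewrite e1; ring.
Qed.

Lemma cnorm_1iy y : cnorm (1 - iy y) ^+ 2 = (eps y)^-1.
Proof.
rewrite sqr_cnorm cabs2E cReD cImD cReN cImN.
have [-> ->] : cRe (iy y) = 0 /\ cIm (iy y) = y by [].
have [-> ->] : cRe (1 : C) = 1 /\ cIm (1 : C) = 0 by [].
by rewrite /eps invrK; ring.
Qed.

Lemma iy1_neq0 y : 1 - iy y != 0.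
Proof.
rewrite -cnorm_gt0 lt_neqAle cnorm_ge0 andbT eq_sym; apply/eqP => e.
have := cnorm_1iy y; rewrite e expr0n/= => /esym/eqP.
by rewrite invr_eq0 gt_eqF// eps_gt0.
Qed.

Lemma sv_neq0 z : z 0 0 != 1 -> sv z != 0.
Proof. by move=> z1; rewrite invr_neq0// subr_eq0 eq_sym. Qed.

(** Substitute z_1 = 1 - 1 / v and conj(a) = - iy / (1 - iy). The kernel is of order eps where v
    stays within bounded distance of iy. *)
Lemma kernel_siegel y z : z 0 0 != 1 ->
  1 - abar y * z 0 0 = (sv z - iy y) / (sv z * (1 - iy y)).
Proof.
move=> z1; have s0 := sv_neq0 z1; have i0 := iy1_neq0 y.
have zE : z 0 0 = 1 - (sv z)^-1 by rewrite /sv invrK; ring.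
apply: (mulIf (mulf_neq0 s0 i0)); rewrite divfK ?mulf_neq0//.
rewrite {1}zE mulrBl mul1r [X in _ - X](_ : _ = (abar y * (1 - iy y)) * (sv z - 1)).
  by rewrite abarE; ring.
by field.
Qed.

Lemma kernel_neq0 y z : sqnorm z < 1 -> 1 - abar y * z 0 0 != 0.
Proof. by move=> z1; rewrite -cnorm_gt0; exact: kdist_gt0 (cnorm_le1 z1). Qed.

(** The exponent makes |f|^2 equal to eps^(-sg) (eps / |1 - conj(a) z_1|)^(2m). *)
Definition peak_fun (sg : R) (m : nat) y : V -> C := fun z =>
  RtoC (eps y `^ (m%:R - sg / 2)) * ((1 - abar y * z 0 0)^-1) ^+ m.

(** The additional - 1/2 in the exponent offsets the factor z_j, which is of order sqrt eps at the
    peak. *)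
Definition peak_coord_fun (sg : R) (m : nat) (j : 'I_n.+1) y : V -> C := fun z =>
  RtoC (eps y `^ (m%:R - 2^-1 - sg / 2)) * z 0 j * ((1 - abar y * z 0 0)^-1) ^+ m.

Lemma cabs2_RtoC (r : R) : cabs2 (RtoC r : C) = r ^+ 2.
Proof. by rewrite -sqr_cnorm cnorm_RtoC real_normK ?num_real. Qed.

Lemma powR_eps_sqr y a : (eps y `^ a) ^+ 2 = eps y `^ (2 * a).
Proof. by rewrite -powR_mulrn ?powR_ge0// -powRrM mulrC. Qed.

Lemma powR_epsD y (a : R) (k : nat) : eps y `^ (k%:R + a) = eps y ^+ k * eps y `^ a.
Proof.
have e0 : eps y != 0 by rewrite gt_eqF// eps_gt0.
by rewrite powRD ?e0 ?implybT// powR_mulrn// ltW// eps_gt0.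
Qed.

Lemma cabs2_VX (x : C) m : cabs2 (x^-1 ^+ m) = (cabs2 x)^-1 ^+ m.
Proof. by rewrite -!sqr_cnorm cnormX cnormV -exprM mulnC exprM (exprVn _ 2). Qed.

Lemma cabs2_peak_fun sg m y z : cabs2 (peak_fun sg m y z) =
  eps y `^ (- sg) * eps y ^+ (2 * m) * (cabs2 (1 - abar y * z 0 0))^-1 ^+ m.
Proof.
rewrite /peak_fun cabs2M cabs2_RtoC powR_eps_sqr.
have -> : 2 * (m%:R - sg / 2) = (2 * m)%:R + - sg by rewrite natrM; field.
by rewrite powR_epsD cabs2_VX [X in X * _]mulrC.
Qed.

Lemma cabs2_peak_coord_fun sg m j y z : cabs2 (peak_coord_fun sg m.+1 j y z) =
  eps y `^ (- sg) * eps y ^+ (2 * m).+1 * cabs2 (z 0 j) * (cabs2 (1 - abar y * z 0 0))^-1 ^+ m.+1.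
Proof.
rewrite /peak_coord_fun !cabs2M cabs2_RtoC powR_eps_sqr.
have -> : 2 * (m.+1%:R - 2^-1 - sg / 2) = (2 * m).+1%:R + - sg.
  by rewrite -!natr1 natrM; field.
by rewrite powR_epsD cabs2_VX [X in X * _ * _]mulrC.
Qed.

Lemma peak_fun_bound sg m y : peak_bound sg (2 * m) 1 y (peak_fun sg m y).
Proof.
move=> z z1; rewrite cabs2_peak_fun mul1r le_eqVlt; apply/orP; left; apply/eqP.
rewrite -sqr_cnorm -/(kdist y (z 0 0)) exprMn -mulrA; congr (_ * (_ * _)).
by rewrite -exprVn -exprM.
Qed.

(** In the ball |z_j|^2 <= 1 - |z_1|^2 <= 2 |1 - conj(a) z_1|, so the coordinate factor costs one
    power of decay: 2m + 1 instead of 2m + 2. *)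
Lemma peak_coord_fun_bound sg m (j : 'I_n) y : peak_bound sg (2 * m).+1 2 y (peak_coord_fun sg m.+1 (lift 0 j) y).
Proof.
move=> z z1; rewrite cabs2_peak_coord_fun.
have zn := cnorm_le1 z1; have D0 := kdist_gt0 y zn; have Dd := kdist_ge_defect y zn.
have hz : cabs2 (z 0 (lift 0 j)) <= 2 * kdist y (z 0 0).
  have : cabs2 (z 0 (lift 0 j)) <= \sum_(i < n) cabs2 (z 0 (lift 0 i)).
    by rewrite (bigD1 j)//= lerDl sumr_ge0// => i _; exact: cabs2_ge0.
  by move: z1; rewrite sqnorm_split; lra.
rewrite -(sqr_cnorm (1 - _)) -/(kdist y (z 0 0)) exprMn.
set D := kdist y _ in D0 Dd hz *.
have -> : 2 * eps y `^ (- sg) * (eps y ^+ (2 * m).+1 * D^-1 ^+ (2 * m).+1) =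
   eps y `^ (- sg) * eps y ^+ (2 * m).+1 * (2 * D) * (D ^+ 2)^-1 ^+ m.+1.
  rewrite -exprVn -exprM mulnS addSn add1n !exprSr.
  by field; rewrite gt_eqF.
rewrite ler_wpM2r ?exprn_ge0 ?invr_ge0 ?sqr_ge0//.
by rewrite ler_wpM2l// mulr_ge0 ?powR_ge0// exprn_ge0// ltW// eps_gt0.
Qed.

Lemma peak_fun_holomorphic sg m y : holomorphic_ball (peak_fun sg m y).
Proof. by move=> z z1; have [] := differentiable_test m (RtoC (eps y `^ (m%:R - sg / 2))) 0 (kernel_neq0 y z1). Qed.

Lemma peak_coord_fun_holomorphic sg m j y : holomorphic_ball (peak_coord_fun sg m j y).
Proof. by move=> z z1; have [] := differentiable_test m (RtoC (eps y `^ (m%:R - 2^-1 - sg / 2))) j (kernel_neq0 y z1). Qed.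

Definition saff (c : C) (b : 'I_n -> C) z : C := c + \sum_k b k * su z k.

Lemma saff_region c b z0 y eta z : region z0 y eta z ->
  cnorm (saff c b z - saff c b z0) <= (\sum_k cnorm (b k)) * eta.
Proof.
move=> [_ _ hu]; rewrite /saff opprD addrACA subrr add0r -sumrB mulr_suml.
elim/big_ind2: _ => [|x1 x2 y1 y2 h1 h2|k _]; first by rewrite cnorm0.
  by apply: le_trans (cnormD _ _) _; exact: lerD.
by rewrite -mulrBr cnormM ler_wpM2l ?cnorm_ge0.
Qed.

End TestFunctions.

(** * Separation of the composed test functions *)

Section Separation.
Local Open Scope complex_scope.
Variables (R : realType) (n : nat).
Local Notation C := (Cx R).
Local Notation V := 'rV[C]_n.+1.
Implicit Types (z : V) (y : R).

Definition siegel_affine (phi : V -> V) (c : C) (b f : 'I_n -> C) (D : 'I_n -> 'I_n -> C) :=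
  forall z, sqnorm z < 1 ->
    [/\ sqnorm (phi z) < 1, sv (phi z) = sv z + saff c b z &
       forall j, su (phi z) j = saff (f j) (D j) z].

Lemma pos_small (M b : R) : 0 <= M -> 0 < b -> exists2 e : R, 0 < e & M * e <= b.
Proof.
move=> M0 b0; exists (b / (M + 1)); first by rewrite divr_gt0// ltr_wpDl.
rewrite mulrCA ler_piMr ?(ltW b0)// ler_pdivrMr ?ltr_wpDl// mul1r; lra.
Qed.

(** The affine parts involve u only, which v -> v + iy leaves unchanged, so one eta serves all y. *)
Lemma image_region phi c b f D z0 (d : R) : siegel_affine phi c b f D -> sqnorm z0 < 1 -> 0 < d ->
  exists2 eta : R, 0 < eta & forall y z, sqnorm z < 1 -> region z0 y eta z ->
    cnorm (sv (phi z) - iy y - sv (phi z0)) < d /\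
    forall j, cnorm (su (phi z) j - su (phi z0) j) < d.
Proof.
move=> hphi z01 d0.
pose B := \sum_k cnorm (b k); pose BD := \sum_j \sum_k cnorm (D j k).
have B0 : 0 <= B by apply: sumr_ge0 => k _; exact: cnorm_ge0.
have BD0 : 0 <= BD by apply: sumr_ge0 => j _; apply: sumr_ge0 => k _; exact: cnorm_ge0.
have [eta eta0 he] := @pos_small (1 + B + BD) (d / 2) ltac:(by rewrite !addr_ge0) ltac:(by rewrite divr_gt0).
have h1 : (1 + B) * eta <= d / 2.
  by apply: le_trans he; rewrite ler_pM2r// lerDl.
have h2 : BD * eta <= d / 2.
  by apply: le_trans he; rewrite ler_pM2r// lerDr addr_ge0.
exists eta => // y z z1 hz; have [_ hv hu] := hz.
have [_ -> hsu] := hphi z z1; have [_ -> hsu0] := hphi z0 z01.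
split.
  have -> : sv z + saff c b z - iy y - (sv z0 + saff c b z0) =
     (sv z - iy y - sv z0) + (saff c b z - saff c b z0) by ring.
  apply: le_lt_trans (cnormD _ _) _; have := saff_region c b hz; rewrite -/B; lra.
move=> j; rewrite hsu hsu0; apply: le_lt_trans (saff_region _ _ hz) _.
have : \sum_k cnorm (D j k) <= BD.
  rewrite /BD [leRHS](bigD1 j)//= lerDl; apply: sumr_ge0 => i _.
  by apply: sumr_ge0 => k _; exact: cnorm_ge0.
by move=> h; have : (\sum_k cnorm (D j k)) * eta <= BD * eta; [rewrite ler_pM2r|lra].
Qed.

(** If two consecutive powers agreed, dividing them would give p = q. *)
Lemma distinct_powers (p q : C) (m : nat) : p != 0 -> q != 0 -> p != q ->
  exists2 k, (m <= k <= m.+1)%N & (iy 1 / p) ^+ k != (iy 1 / q) ^+ k :> C.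
Proof.
move=> p0 q0 pq.
have i0 : (iy 1 : C) != 0.
  by rewrite -cnorm_eq0; apply/negP => /eqP e; have := cIm_le (iy 1 : C); rewrite e /cIm /= normr1; lra.
have [e|ne] := eqVneq ((iy 1 / p) ^+ m) ((iy 1 / q) ^+ m); last by exists m => //; rewrite leqnn leqnSn.
exists m.+1; first by rewrite leqnn leqnSn.
rewrite !exprSr e; apply: contra pq => /eqP h.
have h1 : iy 1 / p = iy 1 / q :> C.
  by apply: (mulfI _ h); rewrite expf_neq0// mulf_neq0// invr_neq0.
by have /invr_inj -> := mulfI i0 h1.
Qed.

Lemma iyE y : iy y = RtoC y * iy 1 :> C.
Proof. by apply: complex_ext; rewrite ?cRe_RtoCM ?cIm_RtoCM /cRe /cIm /= ?mulr0 ?mulr1. Qed.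

Lemma half_le_sqr_eps y : 4 <= y -> 2^-1 <= y ^+ 2 * eps y.
Proof.
move=> y4; have := eps_small y4; have := epsK y; rewrite mulrDr mulr1 => e.
by rewrite mulrC; lra.
Qed.

(** v / (v - iy) = 1 + iy / (v - iy); pulling out y leaves a factor that tends to i / (v - iy) as y
    grows with fixed offset v - iy. *)
Lemma kernel_inv_pow y m z : z 0 0 != 1 -> sv z != iy y -> y != 0 ->
  (1 - abar y * z 0 0)^-1 ^+ m =
  (1 - iy y) ^+ m * RtoC y ^+ m * (RtoC y^-1 + iy 1 / (sv z - iy y)) ^+ m.
Proof.
move=> z1 s1 y0; rewrite kernel_siegel// -!exprMn; congr (_ ^+ m).
have s0 := sv_neq0 z1; have i0 := iy1_neq0 y.
have d0 : sv z - iy y != 0 by rewrite subr_eq0.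
have yy : RtoC y * RtoC y^-1 = 1 :> C by rewrite -RtoCM mulfV.
set x := 1 - iy y in i0 *.
rewrite invf_div [RHS]mulrDr -(mulrA x (RtoC y) (RtoC y^-1)) yy mulr1.
rewrite (_ : x * RtoC y * (iy 1 / (sv z - iy y)) = x * ((RtoC y * iy 1) / (sv z - iy y))); last by ring.
by rewrite -iyE /x; field.
Qed.

Lemma peak_fun_separation (sg : R) phi c b f D psi c' b' f' D' z0 m0 :
  siegel_affine phi c b f D -> siegel_affine psi c' b' f' D' -> sqnorm z0 < 1 ->
  phi z0 0 0 != psi z0 0 0 -> exists2 m, (m0 <= m)%N &
  exists eta k Y : R, [/\ 0 < eta, 0 < k & forall y z, Y <= y -> sqnorm z < 1 -> region z0 y eta z ->
     k * eps y `^ (- sg) <= cabs2 (peak_fun sg m y (phi z) - peak_fun sg m y (psi z))].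
Proof.
move=> hphi hpsi z01 hne.
have [p1 _ _] := hphi z0 z01; have [q1 _ _] := hpsi z0 z01.
set p0 := sv (phi z0); set q0 := sv (psi z0).
have p00 : p0 != 0 by rewrite sv_neq0// ball_neq1.
have q00 : q0 != 0 by rewrite sv_neq0// ball_neq1.
have pq : p0 != q0.
  by apply: contra hne => /eqP/invr_inj h; rewrite -(subKr 1 (phi z0 0 0)) h subKr.
have [m /andP[m0m _] hm] := distinct_powers m0 p00 q00 pq.
exists m => //.
have [g gE] : exists g : R, g = cnorm ((iy 1 / p0) ^+ m - (iy 1 / q0) ^+ m) by eexists.
have g0 : 0 < g by rewrite gE cnorm_gt0 subr_eq0.
have g4 : 0 < g / 4 by rewrite divr_gt0.
have [d1 d10 hd1] := cpower_limit m p00 g4.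
have [d2 d20 hd2] := cpower_limit m q00 g4.
have np : 0 < cnorm p0 by rewrite cnorm_gt0.
have nq : 0 < cnorm q0 by rewrite cnorm_gt0.
have [d [d0 dd1 dd2 dd3 dd4]] : exists d, [/\ 0 < d, d <= d1, d <= d2, d <= cnorm p0 & d <= cnorm q0].
  exists (Num.min (Num.min d1 d2) (Num.min (cnorm p0) (cnorm q0))).
  by rewrite !lt_min d10 d20 np nq !ge_min !lexx !orbT.
have [e1 e10 he1] := image_region hphi z01 d0.
have [e2 e20 he2] := image_region hpsi z01 d0.
(* The power of 1/2 comes from y^2 eps >= 1/2, two errors of g / 4 leave g / 2 of the gap, and the
   threshold on y puts 1 / y below both tolerances. *)
exists (Num.min e1 e2), ((2^-1) ^+ m * (g / 2) ^+ 2), (4 + (d1^-1 + d2^-1) * 2); split.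
- by rewrite lt_min e10.
- by rewrite mulr_gt0 ?exprn_gt0 ?divr_gt0 ?invr_gt0.
move=> y z yY z1 [z01' hv hu].
have r1 : region z0 y e1 z.
  by split => // [|j]; [apply: (le_trans hv)|apply: (le_trans (hu j))]; rewrite ge_min lexx.
have r2 : region z0 y e2 z.
  by split => // [|j]; [apply: (le_trans hv)|apply: (le_trans (hu j))]; rewrite ge_min lexx orbT.
have [hp _] := he1 y z z1 r1; have [hq _] := he2 y z z1 r2.
rewrite -/p0 in hp; rewrite -/q0 in hq.
have i10 : 0 < d1^-1 by rewrite invr_gt0.
have i20 : 0 < d2^-1 by rewrite invr_gt0.
have y4 : 4 <= y by lra.
have y0 : 0 < y by lra.
have yn : y != 0 by rewrite gt_eqF.
have [pz _ _] := hphi z z1; have [qz _ _] := hpsi z z1.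
have sne (w u : C) : cnorm (w - iy y - u) < cnorm u -> w != iy y.
  by move=> h; apply/eqP => e; move: h; rewrite e subrr sub0r cnormN ltxx.
have ky (d' : R) : 0 < d' -> d'^-1 < y -> cnorm (RtoC y^-1) < d'.
  by move=> d'0 h; rewrite cnorm_RtoC ger0_norm ?invr_ge0 ?(ltW y0)// invf_plt ?posrE.
have k1 : d1^-1 < y by lra.
have k2 : d2^-1 < y by lra.
have H1 := hd1 _ _ (ky _ d10 k1) (lt_le_trans hp dd1).
have H2 := hd2 _ _ (ky _ d20 k2) (lt_le_trans hq dd2).
rewrite /peak_fun -mulrBr (kernel_inv_pow m (ball_neq1 pz) (sne _ _ (lt_le_trans hp dd3)) yn).
rewrite (kernel_inv_pow m (ball_neq1 qz) (sne _ _ (lt_le_trans hq dd4)) yn) -mulrBr.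
set A := (RtoC y^-1 + _) ^+ m in H1 *; set B := (RtoC y^-1 + _) ^+ m in H2 *.
have AB : g / 2 <= cnorm (A - B).
  have -> : A - B = ((iy 1 / p0) ^+ m - (iy 1 / q0) ^+ m) - ((B - (iy 1 / q0) ^+ m) - (A - (iy 1 / p0) ^+ m)) by ring.
  have := cnormBl ((iy 1 / p0) ^+ m - (iy 1 / q0) ^+ m) ((B - (iy 1 / q0) ^+ m) - (A - (iy 1 / p0) ^+ m)).
  have := cnormB (B - (iy 1 / q0) ^+ m) (A - (iy 1 / p0) ^+ m); rewrite -gE; clear - H1 H2; lra.
rewrite !cabs2M cabs2_RtoC powR_eps_sqr.
have -> : 2 * (m%:R - sg / 2) = (2 * m)%:R + - sg by rewrite natrM; field.
rewrite powR_epsD.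
have -> : cabs2 ((1 - iy y) ^+ m) = (eps y)^-1 ^+ m.
  by rewrite -sqr_cnorm cnormX exprAC cnorm_1iy.
have -> : cabs2 (RtoC y ^+ m : C) = (y ^+ 2) ^+ m.
  by rewrite -sqr_cnorm cnormX cnorm_RtoC exprAC real_normK ?num_real.
have ep0 := eps_gt0 y.
have -> : eps y ^+ (2 * m) * eps y `^ (- sg) * ((eps y)^-1 ^+ m * (y ^+ 2) ^+ m * cabs2 (A - B)) =
   ((y ^+ 2 * eps y) ^+ m * cabs2 (A - B)) * eps y `^ (- sg).
  have eE : eps y ^+ (2 * m) = eps y ^+ m * eps y ^+ m by rewrite mul2n -addnn exprD.
  rewrite eE (exprMn _ (y ^+ 2)) (exprVn (eps y)).
  have : eps y ^+ m != 0 by rewrite expf_neq0// gt_eqF.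
  by move: (eps y ^+ m) ((y ^+ 2) ^+ m) => a b'' a0; field.
rewrite ler_wpM2r ?powR_ge0//; apply: ler_pM; rewrite ?exprn_ge0 ?invr_ge0//.
- by rewrite divr_ge0// ltW.
- have h := half_le_sqr_eps y4.
  have h2 : 0 <= 2^-1 :> R by rewrite invr_ge0.
  by rewrite lerXn2r ?nnegrE// (le_trans h2).
- by rewrite -sqr_cnorm lerXn2r ?nnegrE ?cnorm_ge0// divr_ge0// ltW.
Qed.

(** When the first components agree, the kernel is a common factor and so is v; since z_j = u_j / v,
    a fixed gap between the u_j is a gap of order sqrt eps between the z_j, as the normalization
    requires. *)
Lemma peak_coord_fun_separation (sg : R) phi c b f D psi c' b' f' D' z0 m (j : 'I_n) :
  siegel_affine phi c b f D -> siegel_affine psi c' b' f' D' -> sqnorm z0 < 1 ->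
  (forall z, sqnorm z < 1 -> phi z 0 0 = psi z 0 0) ->
  phi z0 0 (lift 0 j) != psi z0 0 (lift 0 j) ->
  exists eta k Y : R, [/\ 0 < eta, 0 < k & forall y z, Y <= y -> sqnorm z < 1 -> region z0 y eta z ->
     k * eps y `^ (- sg) <= cabs2 (peak_coord_fun sg m.+1 (lift 0 j) y (phi z) - peak_coord_fun sg m.+1 (lift 0 j) y (psi z))].
Proof.
move=> hphi hpsi z01 hsame hne.
have [p1 _ _] := hphi z0 z01; have [q1 _ _] := hpsi z0 z01.
have pn := ball_neq1 p1; have s0 := sv_neq0 pn.
have svE z : sqnorm z < 1 -> sv (psi z) = sv (phi z) by move=> z1; rewrite /sv hsame.
pose g : R := cnorm (su (phi z0) j - su (psi z0) j).
have g0 : 0 < g.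
  rewrite cnorm_gt0 subr_eq0 /su svE//; apply: contra hne => /eqP h.
  by apply/eqP/(mulIf s0).
pose B := cnorm (sv (phi z0)).
have B0 : 0 < B by rewrite cnorm_gt0.
(* [g / 4] preserves half of the gap; [B] keeps the offset v(phi z) - iy nonzero and of modulus at
   most 2 B. *)
pose d := Num.min (g / 4) B.
have d0 : 0 < d by rewrite lt_min B0 divr_gt0.
have [dg dB] : d <= g / 4 /\ d <= B by rewrite !ge_min !lexx orbT.
have [e1 e10 he1] := image_region hphi z01 d0.
have [e2 e20 he2] := image_region hpsi z01 d0.
exists (Num.min e1 e2), ((g / 2) ^+ 2 * (2^-1) ^+ m * ((2 * B) ^+ 2)^-1 ^+ m.+1), (16 * B + 8); split.
- by rewrite lt_min e10.
- by rewrite !mulr_gt0 ?exprn_gt0 ?invr_gt0 ?exprn_gt0 ?divr_gt0 ?mulr_gt0.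
move=> y z yY z1 [z01' hv hu].
have r1 : region z0 y e1 z.
  by split => // [|i]; [apply: (le_trans hv)|apply: (le_trans (hu i))]; rewrite ge_min lexx.
have r2 : region z0 y e2 z.
  by split => // [|i]; [apply: (le_trans hv)|apply: (le_trans (hu i))]; rewrite ge_min lexx orbT.
have [hp hpj] := he1 y z z1 r1; have [_ hqj] := he2 y z z1 r2.
have [pz _ _] := hphi z z1.
have pzn := ball_neq1 pz; have sz := sv_neq0 pzn.
set w := sv (phi z) - iy y in hp.
have wB : cnorm w <= 2 * B.
  have -> : w = (w - sv (phi z0)) + sv (phi z0) by ring.
  by apply: le_trans (cnormD _ _) _; rewrite -/B; lra.
have w0 : 0 < cnorm w.
  rewrite cnorm_gt0; apply/eqP => e; move: hp; rewrite e sub0r cnormN -/B; lra.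
have wn : w != 0 by rewrite -cnorm_gt0.
have yB : 8 * (2 * B) + 8 <= y by lra.
have := eps_cabs2_shift wB yB.
rewrite (_ : w + iy y = sv (phi z)); last by rewrite /w; ring.
move=> /andP[W1 _].
rewrite /peak_coord_fun -hsame// -mulrBl -mulrBr.
have hj : phi z 0 (lift 0 j) - psi z 0 (lift 0 j) = (su (phi z) j - su (psi z) j) / sv (phi z).
  by rewrite /su svE// -mulrBl mulfK.
rewrite hj !(cabs2M _ (_ ^+ _)) !(cabs2M (RtoC _)) cabs2_RtoC powR_eps_sqr cabs2_VX.
have -> : 2 * (m.+1%:R - 2^-1 - sg / 2) = (2 * m).+1%:R + - sg.
  by rewrite -!natr1 natrM; field.
rewrite powR_epsD.
have cabs2V (x : C) : cabs2 x^-1 = (cabs2 x)^-1 by have := cabs2_VX x 1; rewrite !expr1.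
have kE : cabs2 (1 - abar y * phi z 0 0) = cabs2 w * (cabs2 (sv (phi z)) * (eps y)^-1)^-1.
  by rewrite kernel_siegel// -/w cabs2M cabs2V cabs2M -[cabs2 (1 - iy y)]sqr_cnorm cnorm_1iy.
rewrite kE.
set S := su (phi z) j - _.
have hS : g / 2 <= cnorm S.
  have -> : S = (su (phi z0) j - su (psi z0) j) - ((su (psi z) j - su (psi z0) j) - (su (phi z) j - su (phi z0) j)) by rewrite /S; ring.
  have := cnormBl (su (phi z0) j - su (psi z0) j) ((su (psi z) j - su (psi z0) j) - (su (phi z) j - su (phi z0) j)).
  have := cnormB (su (psi z) j - su (psi z0) j) (su (phi z) j - su (phi z0) j).
  have := hpj j; have := hqj j; rewrite -/g; lra.
have ep0 := eps_gt0 y.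
have en : eps y != 0 by rewrite gt_eqF.
have cn : cabs2 (sv (phi z)) != 0 by rewrite -sqr_cnorm expf_neq0// cnorm_eq0.
have cw : cabs2 w != 0 by rewrite -sqr_cnorm expf_neq0// cnorm_eq0.
rewrite (cabs2M S) (cabs2V (sv (phi z))).
set W := cabs2 (sv (phi z)) in W1 cn *.
rewrite [leRHS](_ : _ = (cabs2 S * (eps y * W) ^+ m * (cabs2 w)^-1 ^+ m.+1) * eps y `^ (- sg)); last first.
  have eE : eps y ^+ (2 * m).+1 = eps y ^+ m * eps y ^+ m.+1.
    by rewrite -exprD mul2n -addnn addnS.
  have -> : (cabs2 w * (W * (eps y)^-1)^-1)^-1 ^+ m.+1 = (cabs2 w)^-1 ^+ m.+1 * (W * W ^+ m) / eps y ^+ m.+1.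
    by rewrite -exprS -exprVn -!exprMn; congr (_ ^+ _); field; rewrite en cn cw.
  have -> : (eps y * W) ^+ m = eps y ^+ m * W ^+ m by rewrite exprMn.
  rewrite eE.
  have e1' : eps y ^+ m.+1 != 0 by rewrite expf_neq0.
  by move: (eps y ^+ m.+1) e1' => a a0; field; rewrite cn a0.
rewrite ler_wpM2r ?powR_ge0//; apply: ler_pM.
- by rewrite mulr_ge0 ?sqr_ge0// exprn_ge0// invr_ge0.
- by rewrite exprn_ge0// invr_ge0 sqr_ge0.
- apply: ler_pM; rewrite ?sqr_ge0 ?exprn_ge0 ?invr_ge0//.
    by rewrite -sqr_cnorm lerXn2r ?nnegrE ?cnorm_ge0// divr_ge0// ltW.
  by rewrite lerXn2r ?nnegrE ?invr_ge0 ?mulr_ge0 ?(ltW ep0)// cabs2_ge0.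
- rewrite lerXn2r ?nnegrE ?invr_ge0 ?sqr_ge0 ?cabs2_ge0//.
  rewrite lef_pV2 ?posrE -?sqr_cnorm ?exprn_gt0 ?mulr_gt0//.
  by rewrite lerXn2r ?nnegrE ?cnorm_ge0// mulr_ge0// ltW.
Qed.

End Separation.

(** * Non-compactness *)

Section NonCompactness.
Local Open Scope complex_scope.
Variables (R : realType) (n : nat).
Local Notation C := (Cx R).
Local Notation V := 'rV[C]_n.+1.
Implicit Types (z w : V) (y : R).

(** Near a fixed point of the ball 1 - z_1 is bounded below, so u and v are bounded, and v(phi z) is
    affine in them. *)
Lemma image_bounded (phi : V -> V) c b f D z1 :
  siegel_affine phi c b f D -> sqnorm z1 < 1 ->
  exists d B : R, [/\ 0 < d, 1 <= B & forall z, sqnorm z < 1 -> cnorm (z 0 0 - z1 0 0) <= d ->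
    cnorm (sv (phi z)) <= B].
Proof.
move=> hphi z11; have h1 := ball_neq1 z11.
have a0 : 0 < cnorm (1 - z1 0 0) by rewrite cnorm_gt0 subr_eq0 eq_sym.
pose S := (cnorm (1 - z1 0 0) / 2)^-1.
have S0 : 0 < S by rewrite invr_gt0 divr_gt0.
pose B := S + cnorm c + \sum_k cnorm (b k) * S.
have B0 : 0 <= B.
  by rewrite !addr_ge0 ?cnorm_ge0 ?(ltW S0)// sumr_ge0// => k _; rewrite mulr_ge0 ?cnorm_ge0// ltW.
exists (cnorm (1 - z1 0 0) / 2), (1 + B); split; [by rewrite divr_gt0|lra|].
move=> z z2 hz; have [_ -> _] := hphi z z2.
have sS : cnorm (sv z) <= S.
  rewrite /sv cnormV lef_pV2 ?posrE ?divr_gt0 ?cnorm_gt0 ?subr_eq0 1?eq_sym ?ball_neq1//.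
  have := cnormBl (1 - z1 0 0) (z 0 0 - z1 0 0).
  have -> : 1 - z1 0 0 - (z 0 0 - z1 0 0) = 1 - z 0 0 by ring.
  lra.
have uS k : cnorm (su z k) <= S.
  rewrite /su cnormM; apply: le_trans sS; rewrite ler_piMl ?cnorm_ge0//.
  rewrite -(@expr_le1 _ 2) ?cnorm_ge0// sqr_cnorm; exact: le_trans (cabs2_le_sqnorm z _) (ltW z2).
apply: le_trans (cnormD _ _) _; rewrite /saff.
have h : cnorm (c + \sum_k b k * su z k) <= cnorm c + \sum_k cnorm (b k) * S.
  apply: le_trans (cnormD _ _) _; rewrite lerD2l.
  elim/big_ind2: _ => [|x1 x2 y1 y2 q1 q2|k _]; first by rewrite cnorm0.
    by apply: le_trans (cnormD _ _) _; exact: lerD.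
  by rewrite cnormM ler_wpM2l ?cnorm_ge0.
rewrite /B; lra.
Qed.

(** |v - iy| >= y / 2 whereas |v (1 - iy)| <= 2 B y, so the bound does not depend on y. *)
Lemma kdist_lower y z (B : R) : sqnorm z < 1 -> 1 <= B -> cnorm (sv z) <= B -> 2 * B <= y ->
  (4 * B)^-1 <= kdist y (z 0 0).
Proof.
move=> z1 B1 hB yB; have zn := ball_neq1 z1.
have s0 : 0 < cnorm (sv z) by rewrite cnorm_gt0 sv_neq0.
have i0 : 0 < cnorm (1 - iy y : C) by rewrite cnorm_gt0 iy1_neq0.
have y0 : 0 < y by lra.
have iyn : cnorm (iy y : C) = y.
  by rewrite iyE cnormM cnorm_RtoC gtr0_norm// (_ : cnorm (iy 1 : C) = 1) ?mulr1// /cnorm /cabs2 /= expr0n expr1n add0r sqrtr1.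
have h1 : cnorm (1 - iy y : C) <= 2 * y.
  by apply: le_trans (cnormB _ _) _; rewrite cnorm1 iyn; lra.
have h2 : y / 2 <= cnorm (sv z - iy y).
  by rewrite cnormC; apply: le_trans (cnormBl _ _); rewrite iyn; lra.
rewrite /kdist kernel_siegel// cnormM cnormV cnormM ler_pdivlMr ?mulr_gt0//.
rewrite mulrC ler_pdivrMr; last lra.
have : cnorm (sv z) * cnorm (1 - iy y : C) <= B * (2 * y).
  by apply: ler_pM; rewrite ?cnorm_ge0.
have : (y / 2) * (4 * B) <= cnorm (sv z - iy y) * (4 * B) by rewrite ler_pM2r; lra.
lra.
Qed.

(** After the height eps^(-sg) is paid, [sg + 1 <= P] leaves at least one power of eps. *)
Lemma peak_decay (sg M y B : R) P (F : V -> C) z : peak_bound sg P M y F -> 0 <= M -> sg + 1 <= P%:R ->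
  sqnorm z < 1 -> 0 < B -> B^-1 <= kdist y (z 0 0) -> cabs2 (F z) <= M * B ^+ P * eps y.
Proof.
move=> hF M0 sP z1 B0 hk.
have ep0 := eps_gt0 y; have k0 : 0 < kdist y (z 0 0) by apply: lt_le_trans hk; rewrite invr_gt0.
apply: le_trans (hF z z1) _; rewrite -!mulrA ler_wpM2l//.
have : (eps y / kdist y (z 0 0)) ^+ P <= B ^+ P * eps y ^+ P.
  have h1 : 0 <= eps y / kdist y (z 0 0) by rewrite ltW// divr_gt0.
  have h2 : 0 <= B * eps y by rewrite ltW// mulr_gt0.
  rewrite -exprMn lerXn2r// mulrC ler_pM2r//.
  by rewrite -(invrK B) lef_pV2 ?posrE// invr_gt0.
move=> /(ler_wpM2l (powR_ge0 (eps y) (- sg))) /le_trans; apply.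
rewrite mulrCA ler_wpM2l ?exprn_ge0 ?(ltW B0)//.
rewrite mulrC -powR_epsD; apply: ge1r_powR; first by rewrite ep0 eps_le1.
lra.
Qed.

Lemma eps_eventually_small (K t : R) : 0 <= K -> 0 < t -> exists Y, forall y, Y <= y -> K * eps y <= t.
Proof.
move=> K0 t0; exists (4 + K / t) => y hy.
have q0 : 0 <= K / t by rewrite divr_ge0// ltW.
have y4 : 4 <= y by lra.
apply: le_trans (ler_wpM2l K0 (eps_le_inv y4)) _.
by rewrite ler_pdivrMr; [rewrite mulrC -ler_pdivrMr//; lra|lra].
Qed.

Lemma image_decay (sg M : R) P (F : R -> V -> C) (phi : V -> V) c b f D z1 (t : R) :
  siegel_affine phi c b f D -> sqnorm z1 < 1 -> 0 <= M -> sg + 1 <= P%:R ->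
  (forall y, peak_bound sg P M y (F y)) -> 0 < t ->
  exists d Y : R, 0 < d /\ forall y z, Y <= y -> sqnorm z < 1 -> cnorm (z 0 0 - z1 0 0) <= d ->
    cnorm (F y (phi z)) <= t.
Proof.
move=> hphi z11 M0 sP hF t0.
have [d [B [d0 B1 hd]]] := image_bounded hphi z11.
have B40 : 0 < 4 * B by lra.
have [Y hY] := @eps_eventually_small (M * (4 * B) ^+ P) (t ^+ 2)
  ltac:(by rewrite mulr_ge0 ?exprn_ge0 ?(ltW B40)) ltac:(by rewrite exprn_gt0).
exists d, (Num.max Y (2 * B)); split => // y z; rewrite ge_max => /andP[yY yB] z1' hz.
have [pz _ _] := hphi z z1'.
rewrite -(@ler_pXn2r _ 2) ?nnegrE ?cnorm_ge0 ?(ltW t0)// sqr_cnorm.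
apply: le_trans (hY y yY); apply: (peak_decay (hF y)) => //.
by apply: kdist_lower => //; exact: hd.
Qed.

Lemma ereal_cvg0_lt (u : nat -> \bar R) (t : R) : u @ \oo --> 0%E -> 0 < t ->
  exists k0, forall k, (k0 <= k)%N -> (u k < t%:E)%E.
Proof.
move=> h t0.
have [k0 _ hk] := h _ (open_nbhs_nbhs (conj (@open_ereal_lt_ereal R t%:E) (t0 : (0 < t%:E)%E))).
by exists k0 => k kk; exact: (hk k).
Qed.

Lemma nat_ge (Y : R) (sg : nat -> nat) : (forall k, (sg k < sg k.+1)%N) ->
  exists k0, forall k, (k0 <= k)%N -> Y <= (sg k)%:R + 4.
Proof.
move=> inc; have sk k : (k <= sg k)%N by elim: k => // k IH; exact: leq_ltn_trans IH (inc k).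
exists (Num.trunc `|Y|).+1 => k hk.
have h1 : `|Y| <= (Num.trunc `|Y|).+1%:R by rewrite ltW// truncnS_gt.
have h2 : (Num.trunc `|Y|).+1%:R <= (sg k)%:R :> R by rewrite ler_nat (leq_trans hk).
have := ler_norm Y; lra.
Qed.

(** The norm limit is shown to vanish off the origin only, so the region must avoid 0: there v = 1,
    far from v(z0) + iy. *)
Lemma near_base_neq0 z0 (eta y : R) z : cnorm (1 - sv z0) + eta < y -> region z0 y eta z -> z != 0.
Proof.
move=> hy [_ hv _]; apply/eqP => e; move: hv; rewrite e /sv mxE subr0 invr1 -/(sv z0).
have -> : 1 - iy y - sv z0 = (1 - sv z0) - iy y by ring.
have := cnormBl (iy y) (1 - sv z0); rewrite cnormC.
have := cIm_le (iy y : C); rewrite (_ : cIm (iy y) = y)// => h1 h2 h3.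
by have := ler_norm y; lra.
Qed.

(** The norm enters only through an upper bound for peaks and two lower bounds, so the Hardy and
    Bergman spaces share the argument. *)
Lemma not_compact_family (nrm2 : (V -> C) -> \bar R) (sg M K : R) P (F : R -> V -> C)
    phi c b f D psi c' b' f' D' z0 :
  (forall y G, 4 <= y -> peak_bound sg P M y G -> (nrm2 G <= K%:E)%E) ->
  local_lower nrm2 -> box_lower sg nrm2 ->
  0 <= M -> sg + 1 <= P%:R ->
  (forall y, holomorphic_ball (F y)) -> (forall y, peak_bound sg P M y (F y)) ->
  siegel_affine phi c b f D -> siegel_affine psi c' b' f' D' -> sqnorm z0 < 1 ->
  (exists eta k Y : R, [/\ 0 < eta, 0 < k & forall y z, Y <= y -> sqnorm z < 1 -> region z0 y eta z ->
     k * eps y `^ (- sg) <= cabs2 (F y (phi z) - F y (psi z))]) ->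
  ~ compact_op (fun G => holomorphic_ball G /\ (nrm2 G < +oo)%E) nrm2
      (diff_op (comp_op phi) (comp_op psi)).
Proof.
move=> up low box M0 sP holF hF hphi hpsi z01 [eta [k [Y [eta0 k0 sep]]]] cpt.
(* The shift puts every parameter in the range y >= 4 of the norm estimates. *)
pose yk (i : nat) : R := i%:R + 4.
have yk4 i : 4 <= yk i by rewrite lerDr.
have uK i : (nrm2 (F (yk i)) <= K%:E)%E by exact: up.
have [||s [inc [g [[hg _] lim]]]] := cpt (fun i => F (yk i)).
- by move=> i; split => //; apply: le_lt_trans (uK i) _; rewrite ltry.
- by exists K.
have cnt (t : R) : 0 < t -> (exists k1, forall i, (k1 <= i)%N ->
    (t%:E <= nrm2 (fun z => F (yk (s i)) (phi z) - F (yk (s i)) (psi z) - g z)%R)%E) -> False.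
  move=> t0 [k1 h1]; have [k2 h2] := ereal_cvg0_lt lim t0.
  have := le_lt_trans (h1 _ (leq_maxl k1 k2)) (h2 _ (leq_maxr k1 k2)).
  by rewrite ltxx.
(* If |g(z1)| = a > 0, then near z1 the two composed functions are at most a / 8 each and g varies
   by less than a / 2, so the distance to g is at least a / 4. *)
have g0 z1 : sqnorm z1 < 1 -> z1 != 0 -> g z1 = 0.
  move=> z11 zn0; apply/eqP/negPn/negP => gn0.
  have a0 : 0 < cnorm (g z1) by rewrite cnorm_gt0.
  set a := cnorm (g z1) in a0.
  have a2 : 0 < a / 2 by rewrite divr_gt0.
  have a8 : 0 < a / 8 by rewrite divr_gt0.
  have [d1 d10 hd1] := holomorphic_continuous (hg z1 z11) a2.
  have [d2 [Y2 [d20 hd2]]] := image_decay hphi z11 M0 sP hF a8.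
  have [d3 [Y3 [d30 hd3]]] := image_decay hpsi z11 M0 sP hF a8.
  pose d := Num.min (d1 / 2) (Num.min d2 d3).
  have d0 : 0 < d by rewrite !lt_min divr_gt0// d20.
  have [dd1 dd2 dd3] : [/\ d <= d1 / 2, d <= d2 & d <= d3] by rewrite !ge_min !lexx !orbT.
  have [cc cc0 hcc] := low z1 z11 zn0 d d0.
  have [k2 hk2] := nat_ge (Num.max Y2 Y3) inc.
  apply: (cnt (cc * (a / 4) ^+ 2)); first by rewrite mulr_gt0// exprn_gt0// divr_gt0.
  exists k2 => i ik; have := hk2 i ik; rewrite -/(yk (s i)) ge_max => /andP[y2 y3].
  apply: hcc => [|z zz hz]; first by rewrite sqr_ge0.
  have q1 : cnorm (g z - g z1) < a / 2.
    by apply: hd1 => j; apply: le_lt_trans (hz j) _; lra.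
  have q2 := hd2 _ z y2 zz (le_trans (hz 0) dd2).
  have q3 := hd3 _ z y3 zz (le_trans (hz 0) dd3).
  rewrite -sqr_cnorm lerXn2r ?nnegrE ?cnorm_ge0 ?divr_ge0 ?(ltW a0)//.
  set x1 := F _ (phi z) in q2 *; set x2 := F _ (psi z) in q3 *.
  have := cnormBl (g z1) (- (g z - g z1) + (x1 - x2)).
  have -> : g z1 - (- (g z - g z1) + (x1 - x2)) = - (x1 - x2 - g z) by ring.
  rewrite cnormN -/a.
  have := cnormD (- (g z - g z1)) (x1 - x2); have := cnormB x1 x2; rewrite cnormN.
  lra.
have [cb [Y1 [cb0 Y10 hnear]]] := near_base_region z0 eta0.
have [c1 [Y2 [c10 hbox]]] := box z0 z01 cb cb0.
pose Y3 := cnorm (1 - sv z0) + eta + 1.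
have [k1 hk1] := nat_ge (Num.max (Num.max Y Y1) (Num.max Y2 Y3)) inc.
apply: (cnt (c1 * k)); first by rewrite mulr_gt0.
exists k1 => i ik; have := hk1 i ik; rewrite -/(yk (s i)) !ge_max => /andP[/andP[y0 y1] /andP[y2 y3]].
apply: (hbox (yk (s i))) => //; first exact: ltW.
move=> z zz hz; have hr := hnear _ _ y1 hz.
rewrite g0 ?subr0//; first exact: sep.
by apply: near_base_neq0 hr; apply: lt_le_trans y3; rewrite ltrDl.
Qed.

End NonCompactness.

(** * Assembly for both spaces *)

Section Main.
Local Open Scope complex_scope.
Variables (R : realType) (n : nat).
Local Notation C := (Cx R).
Local Notation V := 'rV[C]_n.+1.

Lemma parabolic_siegel_affine (tau : V -> V) : parabolic_e1 tau ->
  exists (c : C) (b f : 'I_n -> C) (D : 'I_n -> 'I_n -> C), siegel_affine tau c b f D.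
Proof.
move=> /parabolic_siegel[c [b [f [D h]]]]; exists c, b, f, D => z /h[h1 h2 h3].
by split; rewrite // h2 /saff addrA.
Qed.

Lemma difference_not_compact (nrm2 : (V -> C) -> \bar R) (sg : R) (P0 : nat) (phi psi : V -> V) :
  (forall P, (P0 <= P)%N -> exists2 K : R, 0 <= K & forall y M f, 4 <= y -> 0 <= M ->
    peak_bound sg P M y f -> (nrm2 f <= (K * M)%:E)%E) ->
  local_lower nrm2 -> box_lower sg nrm2 ->
  parabolic_e1 phi -> parabolic_e1 psi ->
  (exists z : V, sqnorm z < 1 /\ phi z != psi z) ->
  ~ compact_op (fun f => holomorphic_ball f /\ (nrm2 f < +oo)%E) nrm2
      (diff_op (comp_op phi) (comp_op psi)).
Proof.
move=> up low box /parabolic_siegel_affine[c [b [f [D hphi]]]]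
  /parabolic_siegel_affine[c' [b' [f' [D' hpsi]]]] [z2 [z21 hz2]].
(* Large enough both for the upper bound and for the decay condition [sg + 1 <= P]. *)
pose m0 := (P0 + (Num.trunc `|(sg + 1)%R|%R).+1)%N.
have m0P m : (m0 <= m)%N -> (P0 <= m)%N /\ sg + 1 <= m%:R.
  move=> h; split; first exact: leq_trans (leq_addr _ _) h.
  apply: le_trans (ler_norm _) _; apply: le_trans (ltW (truncnS_gt _)) _.
  by rewrite ler_nat; exact: leq_trans (leq_addl _ _) h.
(* Either the first components differ somewhere, or they agree on the ball and some other component
   differs at [z2]. *)
have [[z0 z01 hne]|same] := pselect (exists2 z0, sqnorm z0 < 1 & phi z0 0 0 != psi z0 0 0).
  have [m mm sep] := @peak_fun_separation R n sg _ _ _ _ _ _ _ _ _ _ z0 m0 hphi hpsi z01 hne.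
  have [P1 P2] := m0P (2 * m)%N (leq_trans mm (leq_pmull m (isT : 0 < 2)%N)).
  have [K K0 hK] := up _ P1.
  apply: (@not_compact_family R n nrm2 sg 1 (K * 1) (2 * m) (@peak_fun R n sg m) _ _ _ _ _ _ _ _ _ _ _ _ low box _ P2 _ _ hphi hpsi z01 sep).
  - by move=> y G y4 hG; apply: hK y4 _ hG.
  - by [].
  - by move=> y; exact: peak_fun_holomorphic.
  - by move=> y; exact: peak_fun_bound.
have {}same z : sqnorm z < 1 -> phi z 0 0 = psi z 0 0.
  by move=> z1; apply/eqP/negPn/negP => h; apply: same; exists z.
have [j hj] : exists j : 'I_n, phi z2 0 (lift 0 j) != psi z2 0 (lift 0 j).
  apply/not_existsP => h; move/eqP: hz2; apply; apply/rowP => j.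
  case: (unliftP 0 j) => [i|] ->; last exact: same.
  by apply/eqP/negPn/negP; exact: h.
have sep := @peak_coord_fun_separation R n sg _ _ _ _ _ _ _ _ _ _ z2 m0 j hphi hpsi z21 same hj.
have [P1 P2] := m0P (2 * m0).+1 (leqW (leq_pmull m0 (isT : 0 < 2)%N)).
have [K K0 hK] := up _ P1.
apply: (@not_compact_family R n nrm2 sg 2 (K * 2) (2 * m0).+1 (@peak_coord_fun R n sg m0.+1 (lift 0 j)) _ _ _ _ _ _ _ _ _ _ _ _ low box _ P2 _ _ hphi hpsi z21 sep).
- by move=> y G y4 hG; apply: hK y4 _ hG.
- by [].
- by move=> y; exact: peak_coord_fun_holomorphic.
- by move=> y; exact: peak_coord_fun_bound.
Qed.

End Main.

Theorem theorem5 (R : realType) (N : nat) (hN : (1 < N)%N)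
  (phi psi : 'rV[Cx R]_N -> 'rV[Cx R]_N) :
  parabolic_e1 phi -> parabolic_e1 psi ->
  (exists z : 'rV[Cx R]_N, sqnorm z < 1 /\ phi z != psi z) ->
  ~ compact_op (@inH2 R N) (@H2norm2 R N)
      (diff_op (comp_op phi) (comp_op psi)) /\
  (forall alpha : R, -1 < alpha ->
    ~ compact_op (@inA2 R N alpha) (@A2norm2 R N alpha)
        (diff_op (comp_op phi) (comp_op psi))).
Proof.
case: N hN phi psi => [//|n] _ phi psi hphi hpsi hne; split => [|alpha al1].
  exact: difference_not_compact (@hardy_upper R n) (@hardy_local R n) (@hardy_box R n) hphi hpsi hne.
have [P0 up] := @bergman_upper R n _ al1.
exact: difference_not_compact up (bergman_local al1) (bergman_box al1) hphi hpsi hne.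
Qed.
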